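(* Let $\lambda\in\mathbb C$ be generic, i.e. $\lambda\notin\frac{2\pi i}{\ln q}\mathbb Q$. Let $\Delta$ be a skew-symmetric operator in $U$ commuting with $\hat h$, and let $$r_0^{\lambda,\Delta}=-\tfrac12+A^{-1}+\left(\bar B^{\lambda,\Delta}+\tfrac\lambda2\right)\mathcal P_U,\qquad\bar B^{\lambda,\Delta}=\lambda\left(\frac12\,\frac{1+\hat h^\lambda}{1-\hat h^\lambda}\,\mathcal P_0'+\Delta\right),$$ $r^{\lambda,\Delta}=\frac12(\mathcal P_+-\mathcal P_-)+r_0^{\lambda,\Delta}\mathcal P_0$, $r^{\lambda,\Delta}_\pm=r^{\lambda,\Delta}\pm\frac12$. The Poisson bracket on $L\mathfrak{gl}_q^\lambda$ defined by $$\{\hat\varphi,\hat\psi\}^\lambda_\Delta=\left\langle\left\langle\begin{pmatrix}r^{\lambda,\Delta}&-\hat hr_+^{\lambda,\Delta}\\\hat h^{-1}r_-^{\lambda,\Delta}&-r^{\lambda,\Delta}\end{pmatrix}\begin{pmatrix}\nabla\hat\varphi\\\nabla'\hat\varphi\end{pmatrix},\begin{pmatrix}\nabla\hat\psi\\\nabla'\hat\psi\end{pmatrix}\right\rangle\right\rangle$$ gives rise via Drinfeld-Sokolov reduction to the following bracket on $\widehat{\mathbb G}_\lambda$: $$\{\varphi,\psi\}_\lambda^\Delta=\left\langle\left\langle\begin{pmatrix}R+\left(\frac12\frac{1+\hat h^\lambda}{1-\hat h^\lambda}+\Delta\right)P_0'&-\left(\frac1{1-\hat h^\lambda}+\Delta\right)\hat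 h^\lambda P_0'\\\left(\frac{\hat h^\lambda}{1-\hat h^\lambda}+\Delta\right)\hat h^{-\lambda}P_0'&R-\left(\frac12\frac{1+\hat h^\lambda}{1-\hat h^\lambda}+\Delta\right)P_0'\end{pmatrix}D\varphi,D\psi\right\rangle\right\rangle,$$ where $\mathrm{End}\,U$ and $\mathrm{End}\,\mathbb C((z^{-1}))$ are identified.
   Context: Fix $q\in\mathbb C$, $0<|q|<1$, with $\ln q$ defined by the branch $-\pi<\arg<\pi$, $\ln1=0$, and $q^w=\exp(w\ln q)$. For formal Laurent series in $z^{-1}$: $(\hat h^wa)(z)=a(q^wz)$, $\hat h=\hat h^1$ (also written ${}^ha$; $\hat h$ acts entrywise on matrices), $\int a\,dz/z$ is the constant term. $\mathcal A_0$ is the algebra of functions of a complex variable $w$ generated by $w,q^w,q^{-w}$; an $\mathcal A_0$-function of two variables is an element of $\mathcal A_0\otimes\mathcal A_0$. An $\mathcal A_0$-function is determined by its values at all sufficiently large integers. $\mathfrak{gl}_\infty(\mathfrak a)$ is the algebra of matrices $(A_{i,j})_{i,j\ge0}$ over $\mathfrak a$ with $A_{i,j}=0$ if $i-j>N(A)$. $\mathfrak{gl}_q\subset\mathfrak{gl}_\infty(\mathcal A_0)$ consists of matrices $A(t)$ for which there is an integer $N(A)$ with: (1) $A_{i,i+n}(t)=0$ if $n<-N(A)$; (2) for each fixed $n\ge-N(A)$ there is a two-variable $\mathcal A_0$-function $f$ with $A_{i,i+n}(t)=f(i,t)$ for all $i>N(A)$; (3) $A_{i,j}(m)=0$ for all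 integers $m>N(A)$, $N(A)<i<m$, $j\ge m$. The minimal $N(A)$ is $\mathrm{reg}\,A$. With $[m]$ denoting the coefficient of $z^m$, $L\mathfrak{gl}_q$ consists of $A\in\mathfrak{gl}_\infty(\mathcal A_0((z^{-1})))$ with (1) $A^{[m]}\in\mathfrak{gl}_q$ for all $m$; (2) $\mathrm{reg}\,A^{[m]}\le N(A)$ for all $m$, for some $N(A)$; (3) for each $n$ there is $\tilde N(A,n)$ with $A^{[m]}_{i,i+n}=0$ for all $i$ if $m>\tilde N(A,n)$. $L\mathfrak{gl}_q^\lambda$ is the image of $L\mathfrak{gl}_q$ under evaluation $A\mapsto A|_{t=\lambda}$. $L\mathfrak n_\pm^\lambda$, $L\mathfrak b_+^\lambda$, $L\mathfrak h^\lambda$, $L\mathfrak N_+^\lambda$ are the images of the sets of strictly upper/lower triangular, upper triangular, diagonal, and (unit plus strictly upper triangular) matrices of $L\mathfrak{gl}_q$; $\mathcal P_\pm,\mathcal P_0$ are the projections onto $L\mathfrak n^\lambda_\pm$, $L\mathfrak h^\lambda$ in $L\mathfrak{gl}_q^\lambda=L\mathfrak n_+^\lambda\oplus L\mathfrak h^\lambda\oplus L\mathfrak n_-^\lambda$. For $f=\mathrm{diag}(f_0,f_1,\dots)\in L\mathfrak h^\lambda$, $f(w,z)$ denotes the series in $z$ whose coefficients are the $\mathcal A_0$-functions of $w$ with $f(i,z)=f_i(z)$ for all sufficiently large integers $i$; $f(\lambda)=f(\lambda,z)$. Trace: for $X\in L\mathfrak{gl}_q^\lambda$, $\mathrm{Tr}\,X=\mathbb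 D_X(\lambda,z)$, where $\mathbb D_X(w,z)$ is the unique (coefficientwise in $z$) $\mathcal A_0$-function of $w$ with $\mathbb D_X(n,z)=\sum_{i=0}^{n-1}X_{i,i}(z)$ for all sufficiently large integers $n$. Inner product: $\langle X,Y\rangle=\int\frac{dz}z\mathrm{Tr}\,X(z)Y(z)$. Skew-symmetry and orthogonality are with respect to $\langle\cdot,\cdot\rangle$. On $L\mathfrak h^\lambda$: $\hat s\,\mathrm{diag}(f_0,f_1,\dots)=\mathrm{diag}(f_1,f_2,\dots)$; $A=1-\hat h\hat s$. $A^{-1}$ denotes the inverse of the bijection $A|_{V^\lambda}:V^\lambda\to L\mathfrak h^\lambda$, $V^\lambda=\{f\in L\mathfrak h^\lambda:f_0=0\}$; $U=\mathrm{Ker}\,A=\{\mathrm{diag}(F_0(z),F_0(q^{-1}z),F_0(q^{-2}z),\dots):F_0\in\mathbb C((z^{-1}))\}$; $L\mathfrak h^\lambda$ is the orthogonal sum of $U$ and $A(\{f\in V^\lambda:f(\lambda)=0\})$, and $\mathcal P_U$ is the orthogonal projection onto $U$. $U$ is identified with $\mathbb C((z^{-1}))$ by taking the component $F_0$, which identifies $\mathrm{End}\,U$ with $\mathrm{End}\,\mathbb C((z^{-1}))$. $\mathcal P_{00}$ is the projection onto the one-dimensional subspace of $U$ spanned by the unit matrix, $\mathcal P_0'=\mathcal P_0-\mathcal P_{00}$; $1-\hat h^\lambda$ is invertible on $\mathcal P_0'U$. A smooth functional $\hat\varphi$ on $L\mathfrak{gl}_q^\lambda$ has a linear gradient $d\hat\varphi(\mathcal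 L)\in L\mathfrak{gl}_q^\lambda$, $\langle d\hat\varphi(\mathcal L),X\rangle=\frac d{dt}|_{t=0}\hat\varphi(\mathcal L+tX)$; $\nabla\hat\varphi=\mathcal L\,d\hat\varphi$, $\nabla'\hat\varphi=d\hat\varphi\,\mathcal L$. $\langle\langle(X_1,X_2)^T,(Y_1,Y_2)^T\rangle\rangle=\langle X_1,Y_1\rangle-\langle X_2,Y_2\rangle$. $q$-pseudodifference operators: $\Psi D_q$ is the algebra of formal series $\sum_{i\le N}a_i(z)D^i$, $a_i\in\mathbb C((z^{-1}))$, with $Da={}^ha\,D$; more generally $D^wa=(\hat h^wa)D^w$ for $w\in\mathbb C$. $P_+,P_0,P_-$ project $\Psi D_q$ onto the subspaces $J_+,J_0=\mathbb C((z^{-1})),J_-$ of series with positive, zero, negative powers of $D$; $R=\frac12(P_+-P_-)$; $P_0'X=P_0X-\int P_0X\,dz/z$; $\mathrm{Tr}\,X=\int P_0X\,dz/z$; $\langle X,Y\rangle=\mathrm{Tr}\,XY$. $\widehat{\mathbb G}_\lambda=\{L=D^\lambda+u_1(z)D^{\lambda-1}+u_2(z)D^{\lambda-2}+\cdots:u_i\in\mathbb C((z^{-1}))\}$. Functionals on $\widehat{\mathbb G}_\lambda$ are generated by the Laurent coefficients of the $u_i$; the gradient $d\varphi(L)=D^{-\lambda}\bar f$, $\bar f\in J_+$, is defined by $\mathrm{Tr}(X\,d\varphi(L))=\frac d{dt}|_{t=0}\varphi(L+tX)$ for $X\in J_-D^\lambda$; $\nabla\varphi=L\,d\varphi$, $\nabla'\varphi=d\varphi\,L$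 (both in $\Psi D_q$), $D\varphi=(\nabla\varphi,\nabla'\varphi)^T$. DS-reduction: $L\mathfrak N_+^\lambda$ acts by $\mathcal L\mapsto{}^hT\mathcal LT^{-1}$ and preserves $\mathbb Y_q^\lambda=\{\Lambda+X:X\in L\mathfrak b_+^\lambda\}$, where $\Lambda_{i+1,i}=1$ ($i\ge0$), other entries zero. The quotient $\mathbb Y_q^\lambda/L\mathfrak N_+^\lambda$ is identified with the set of companion matrices (first row $(-u_1(z),-u_2(z),\dots)$, $u_i\in\mathbb C((z^{-1}))$, ones on the first subdiagonal, zeros elsewhere), and hence with $\widehat{\mathbb G}_\lambda$ by letting such a matrix correspond to $L=D^\lambda+u_1D^{\lambda-1}+\cdots$; $\pi:\mathbb Y_q^\lambda\to\widehat{\mathbb G}_\lambda$ is the projection. The reduced bracket is $\{\varphi,\psi\}(\pi(\mathcal L))=\{\hat\varphi,\hat\psi\}(\mathcal L)$, $\mathcal L\in\mathbb Y_q^\lambda$, where $\hat\varphi,\hat\psi$ are $L\mathfrak N_+^\lambda$-invariant functionals on $L\mathfrak{gl}_q^\lambda$ extending $\pi^*\varphi,\pi^*\psi$. *)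

(* Defs.v *)
From HB Require Import structures.
From mathcomp Require Import all_boot all_order all_algebra.
From mathcomp Require Import boolp classical_sets functions fsbigop reals.
From mathcomp Require Import topology normedtype sequences derive exp trigo.
From mathcomp Require Import complex.

Set Implicit Arguments.
Unset Strict Implicit.
Unset Printing Implicit Defensive.

Import Order.TTheory GRing.Theory Num.Theory numFieldNormedType.Exports.
Local Open Scope classical_set_scope.
Local Open Scope ring_scope.

Definition inv_on (T T' : zmodType) (S : set T) (f : T -> T') (y : T') : T :=
  xget 0 [set x | S x /\ f x = y].

Definition block2 (T : zmodType) (a b c d : T -> T) (x : T * T) : T * T :=
  (a x.1 + b x.2, c x.1 + d x.2).

Definition pairing2 (T : Type) (K : zmodType) (ip : T -> T -> K)
    (x y : T * T) : K := ip x.1 y.1 - ip x.2 y.2.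

Section ComplexExp.
Variable R : realType.
Local Notation C := R[i].

Definition cexp (z : C) : C :=
  (expR (complex.Re z))%:C%C *
  Complex (cos (complex.Im z)) (sin (complex.Im z)).

Definition principal_log (q l : C) : Prop :=
  cexp l = q /\ - pi < complex.Im l < pi.

End ComplexExp.

Section Series.
Variable R : realType.
Local Notation C := R[i].

(* [a m] is the coefficient of z^m.  The type is that of all two-sided formal
   series; C((z^-1)) is carved out of it by [laurent]. *)
Definition ser := int -> C.

Definition laurent : set ser :=
  [set a | exists M : int, forall m, M < m -> a m = 0].

Definition sone : ser := fun m => (m == 0)%:R.

(* The sum has finite support when a and b are in C((z^-1)). *)
Definition smul (a b : ser) : ser :=
  fun m => \sum_(k \in [set: int]) a k * b (m - k).

Definition const_term (a : ser) : C := a 0.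

Definition drop_const (a : ser) : ser := a - const_term a *: sone.

(* Infinite matrices over C((z^-1)), indexed from 0. *)
Definition mat := nat -> nat -> ser.

Definition mone : mat := fun i j => if i == j then sone else 0.

(* For fixed i and j, finitely many k contribute when both factors have
   finitely many nonzero subdiagonals. *)
Definition mmul (X Y : mat) : mat :=
  fun i j m => \sum_(k \in [set: nat]) smul (X i k) (Y k j) m.

Definition Pupper (X : mat) : mat := fun i j => if (i < j)%N then X i j else 0.
Definition Plower (X : mat) : mat := fun i j => if (j < i)%N then X i j else 0.
Definition Pdiag (X : mat) : mat := fun i j => if i == j then X i j else 0.

(* On diagonal matrices: diag(f0, f1, ...) |-> diag(f1, f2, ...). *)
Definition shat (X : mat) : mat := fun i j => X i.+1 j.+1.

End Series.

Section QAnalogue.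
Variables (R : realType) (lnq : R[i]).
Local Notation C := R[i].
Local Notation ser := (ser R).
Local Notation mat := (mat R).

Definition qpow (w : C) : C := cexp (w * lnq).

(* a(z) |-> a(q^w z) *)
Definition hs (w : C) (a : ser) : ser := fun m => qpow w ^ m * a m.

Definition hm (w : C) (X : mat) : mat := fun i j => hs w (X i j).

Inductive A0 : (C -> C) -> Prop :=
| A0_const c : A0 (fun=> c)
| A0_id : A0 id
| A0_qpow : A0 qpow
| A0_qpowN : A0 (fun w => qpow (- w))
| A0_add f g : A0 f -> A0 g -> A0 (fun w => f w + g w)
| A0_mul f g : A0 f -> A0 g -> A0 (fun w => f w * g w).

Definition A0_two (f : C -> C -> C) : Prop :=
  exists (p : nat) (a b : 'I_p -> C -> C),
    (forall k, A0 (a k) /\ A0 (b k)) /\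
    (forall w t, f w t = \sum_(k < p) a k w * b k t).

(* The value at w of the A_0-function interpolating s at all sufficiently
   large integers. *)
Definition A0_interp (s : nat -> C) (w : C) : C :=
  xget (fun=> 0)
    [set g : C -> C | A0 g /\
       exists N, forall n, (N <= n)%N -> g n%:R = s n] w.

Definition fmat := nat -> nat -> C -> C.

Definition gl_infty_A0 (A : fmat) : Prop :=
  (forall i j, A0 (A i j)) /\
  exists N : int, forall i j : nat, N < i%:Z - j%:Z -> A i j = 0.

(* reg A <= N: the three defining conditions are monotone in N. *)
Definition reg_le (N : int) (A : fmat) : Prop :=
  [/\ forall i j : nat, j%:Z - i%:Z < - N -> A i j = 0,
      forall n : int, - N <= n ->
        exists2 f, A0_two f &
          forall i j : nat, N < i%:Z -> j%:Z - i%:Z = n ->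
            forall t, A i j t = f i%:R t
    & forall (m : int) (i j : nat),
        N < m -> N < i%:Z -> i%:Z < m -> m <= j%:Z -> A i j m%:~R = 0].

Definition gl_q (A : fmat) : Prop :=
  gl_infty_A0 A /\ exists N, reg_le N A.

(* Infinite matrices over A_0((z^-1)): [A i j m] is the coefficient of z^m in
   the (i, j) entry, as a function of t. *)
Definition lmat := nat -> nat -> int -> C -> C.

Definition lcoef (A : lmat) (m : int) : fmat := fun i j => A i j m.

Definition gl_infty_LA0 (A : lmat) : Prop :=
  (forall i j, (forall m, A0 (A i j m)) /\
     exists M : int, forall m, M < m -> A i j m = 0) /\
  exists N : int, forall i j : nat, N < i%:Z - j%:Z -> A i j = 0.

Definition Lgl_q (A : lmat) : Prop :=
  [/\ gl_infty_LA0 A,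
      forall m, gl_q (lcoef A m),
      exists N, forall m, reg_le N (lcoef A m)
    & forall n : int, exists M : int, forall (m : int) (i j : nat),
        M < m -> j%:Z - i%:Z = n -> A i j m = 0].

Section ComplexSize.
Variable lam : C.

Definition eval_t (A : lmat) : mat := fun i j m => A i j m lam.

Definition Lgl : set mat := [set X | exists2 A, Lgl_q A & X = eval_t A].

Definition Lb_plus : set mat :=
  [set X | exists A, [/\ Lgl_q A,
     forall i j, (j < i)%N -> A i j = 0 & X = eval_t A]].

Definition Lh : set mat :=
  [set X | exists A, [/\ Lgl_q A,
     forall i j, i != j -> A i j = 0 & X = eval_t A]].

Definition LN_plus : set mat :=
  [set X | exists A, [/\ Lgl_q A,
     forall i j, (j <= i)%N -> A i j = 0 & X = mone R + eval_t A]].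

Definition mTr (X : mat) : ser :=
  fun m => A0_interp (fun n => \sum_(i < n) X i i m) lam.

Definition inner (X Y : mat) : C := const_term (mTr (mmul X Y)).

Definition orth_proj (S : set mat) (X : mat) : mat :=
  xget 0 [set Y | S Y /\ forall Z, S Z -> inner (X - Y) Z = 0].

(* F0 |-> diag(F0(z), F0(q^-1 z), F0(q^-2 z), ...) *)
Definition U_of_ser (F : ser) : mat :=
  fun i j => if i == j then hs (- i%:R) F else 0.

Definition U : set mat := [set X | exists2 F, @laurent R F & X = U_of_ser F].

Definition P_U : mat -> mat := orth_proj U.

Definition P00 : mat -> mat := orth_proj [set X | exists c : C, X = c *: mone R].

Definition P0' (X : mat) : mat := Pdiag X - P00 (Pdiag X).

Definition V : set mat := [set f | Lh f /\ f 0%N 0%N = 0].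

Definition Aop (f : mat) : mat := f - hm 1 (shat f).

Definition Aop_inv : mat -> mat := inv_on V Aop.

(* (1 - h^lambda)^-1 on P0' U *)
Definition resolvent_U : mat -> mat :=
  inv_on [set P0' F | F in U] (fun G => G - hm lam G).

Definition cayley_U (F : mat) : mat :=
  2^-1 *: (resolvent_U F + hm lam (resolvent_U F)).

Record skew_operator_on_U (Delta : mat -> mat) : Prop := {
  skewU_stable : forall F, U F -> U (Delta F);
  skewU_linear : forall (c : C) F G, U F -> U G ->
    Delta (c *: F + G) = c *: Delta F + Delta G;
  skewU_skew : forall F G, U F -> U G ->
    inner (Delta F) G = - inner F (Delta G) }.

Section RMatrix.
Variable Delta : mat -> mat.

Definition Bbar (F : mat) : mat := lam *: (cayley_U (P0' F) + Delta F).

Definition r0 (f : mat) : mat :=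
  - (2^-1 *: f) + Aop_inv f + (Bbar (P_U f) + (lam / 2) *: P_U f).

Definition rmat (X : mat) : mat :=
  2^-1 *: (Pupper X - Plower X) + r0 (Pdiag X).

Definition rmat_plus (X : mat) : mat := rmat X + 2^-1 *: X.
Definition rmat_minus (X : mat) : mat := rmat X - 2^-1 *: X.

Definition is_gradient (phi : mat -> C) (M d : mat) : Prop :=
  Lgl d /\ forall X, Lgl X ->
    is_derive (0 : C^o) (1 : C^o)
      (fun t : C^o => phi (M + (t : C) *: X) : C^o) (inner d X : C^o).

Definition grad (phi : mat -> C) (M : mat) : mat :=
  xget 0 [set d | is_gradient phi M d].

Definition nablas (phi : mat -> C) (M : mat) : mat * mat :=
  (mmul M (grad phi M), mmul (grad phi M) M).

Definition Lgl_bracket (phi psi : mat -> C) (M : mat) : C :=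
  pairing2 inner
    (block2 rmat (\- (hm 1 \o rmat_plus))
            (hm (- 1) \o rmat_minus) (\- rmat)
            (nablas phi M))
    (nablas psi M).

End RMatrix.

(* [X n] is the coefficient of D^(w + n), where the offset w is fixed by the
   context: w = 0 gives PsiD_q, w = lambda contains G_lambda and J_- D^lambda,
   and w = - lambda contains D^-lambda J_+. *)
Definition psd := int -> ser.

(* Product of X of offset w with Y of any offset w'; the result has offset
   w + w'. It comes from D^(w + k) b = (h^(w + k) b) D^(w + k). *)
Definition pmul (w : C) (X Y : psd) : psd :=
  fun n m => \sum_(k \in [set: int]) smul (X k) (hs (w + k%:~R) (Y (n - k))) m.

(* D^w, as an operator of offset w *)
Definition pDpow : psd := fun n => if n == 0 then sone R else 0.

Definition J_plus : set psd :=
  [set X | [/\ forall n, @laurent R (X n), forall n, n <= 0 -> X n = 0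
             & exists N : int, forall n, N < n -> X n = 0]].

Definition J_minus : set psd :=
  [set X | (forall n, @laurent R (X n)) /\ forall n, 0 <= n -> X n = 0].

Definition pTr (X : psd) : C := const_term (X 0).

Definition pinner (X Y : psd) : C := pTr (pmul 0 X Y).

Definition Rop (X : psd) : psd :=
  fun n => if 0 < n then 2^-1 *: X n
           else if n < 0 then - (2^-1 *: X n) else 0.

Definition pP0' (X : psd) : ser := drop_const (X 0).

Definition J0_of_ser (F : ser) : psd := fun n => if n == 0 then F else 0.

Definition Ghat : set psd :=
  [set L | [/\ forall n, @laurent R (L n), L 0 = sone R
             & forall n, 0 < n -> L n = 0]].

(* Polynomials in the Laurent coefficients of u_1, u_2, ...; the coefficient
   of z^m in u_(i + 1) is [L (- i.+1) m]. *)
Inductive G_functional : (psd -> C) -> Prop :=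
| GF_const c : G_functional (fun=> c)
| GF_coef (i : nat) (m : int) : G_functional (fun L => L (- (i.+1)%:Z) m)
| GF_add f g :
    G_functional f -> G_functional g -> G_functional (fun L => f L + g L)
| GF_mul f g :
    G_functional f -> G_functional g -> G_functional (fun L => f L * g L).

(* L has offset lambda and d has offset - lambda. An element X of J_- D^lambda
   has the same coefficients, in offset lambda, as X D^-lambda in offset 0. *)
Definition G_is_gradient (phi : psd -> C) (L d : psd) : Prop :=
  (exists2 f, J_plus f & d = pmul (- lam) pDpow f) /\
  forall X, J_minus X ->
    is_derive (0 : C^o) (1 : C^o)
      (fun t : C^o => phi (L + (t : C) *: X) : C^o)
      (pTr (pmul lam X d) : C^o).

Definition G_grad (phi : psd -> C) (L : psd) : psd :=
  xget 0 [set d | G_is_gradient phi L d].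

Definition G_nablas (phi : psd -> C) (L : psd) : psd * psd :=
  (pmul lam L (G_grad phi L), pmul (- lam) (G_grad phi L) L).

(* (1 - h^lambda)^-1 on the series without constant term *)
Definition resolvent : ser -> ser :=
  inv_on [set drop_const F | F in @laurent R] (fun G => G - hs lam G).

Definition cayley (F : ser) : ser :=
  2^-1 *: (resolvent F + hs lam (resolvent F)).

(* The identification of End U with End C((z^-1)). *)
Definition EndU_ser (Delta : mat -> mat) (F : ser) : ser :=
  Delta (U_of_ser F) 0%N 0%N.

Definition G_bracket (Delta : mat -> mat) (phi psi : psd -> C) (L : psd) : C :=
  let D := EndU_ser Delta in
  pairing2 pinner
    (block2
       (Rop \+ (J0_of_ser \o (cayley \+ D) \o pP0'))
       (\- (J0_of_ser \o (resolvent \+ D) \o hs lam \o pP0'))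
       (J0_of_ser \o ((hs lam \o resolvent) \+ D) \o hs (- lam) \o pP0')
       (Rop \- (J0_of_ser \o (cayley \+ D) \o pP0'))
       (G_nablas phi L))
    (G_nablas psi L).

Definition Lambda : mat := fun i j => if i == j.+1 then sone R else 0.

Definition Yq : set mat := [set M | exists2 X, Lb_plus X & M = Lambda + X].

(* M' = (h T) M T^-1 for some T in LN_+^lambda with inverse S. *)
Definition gauge_equiv (M M' : mat) : Prop :=
  exists T S, [/\ LN_plus T, LN_plus S,
    mmul T S = mone R, mmul S T = mone R
    & M' = mmul (mmul (hm 1 T) M) S].

Definition gauge_invariant (phi : mat -> C) : Prop :=
  forall M M', Lgl M -> gauge_equiv M M' -> phi M' = phi M.

Definition companion (L : psd) : mat :=
  fun i j => if i == 0%N then - L (- (j.+1)%:Z)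
             else if i == j.+1 then sone R else 0.

Definition DS_proj (M : mat) : psd :=
  xget 0 [set L | Ghat L /\ gauge_equiv M (companion L)].

End ComplexSize.
End QAnalogue.

(* Main.v *)
(* Both brackets are evaluated at a companion matrix c. Let the defect of d be
   c d - h(d c). Gauge invariance of a functional makes its gradient covariant, so
   the r-matrix bracket is gauge invariant, and it makes the defect of a gradient
   at c upper triangular. For such gradients the bracket only involves r_0 + 1/2
   on the diagonal parts of the defects. The first column f of the gradient d1 at c
   gives the coefficients of the gradient of the reduced functional, and
   d1 = D + E, where E is strictly upper triangular and the defect of D vanishes
   outside its first row v, which is a function of f. On the diagonal part of the
   defect of d1, A^-1 is diag(c E) + v_0 E_00 minus the element of U with component
   v_0 = P_0(L d phi) - h^lambda P_0(d phi L). Cyclicity of the trace then leaves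
   only first rows and columns, and the products of pseudodifference operators
   expand into the same terms u_(i+1-n) h^n(f_i u_(n+j+1)) g_j. An operator Delta
   commuting with h is diagonal on the powers of z, so it enters both sides as the
   same Fourier multiplier. *)
Require Import Defs.
From HB Require Import structures.
From mathcomp Require Import all_boot all_order all_algebra.
From mathcomp Require Import boolp classical_sets functions fsbigop reals.
From mathcomp Require Import topology normedtype sequences derive exp trigo.
From mathcomp Require Import complex zify ring lra.

Set Implicit Arguments.
Unset Strict Implicit.
Unset Printing Implicit Defensive.

Import Order.TTheory GRing.Theory Num.Theory numFieldNormedType.Exports.
Local Open Scope ring_scope.

(** The matrices are infinite, so the trace is not a sum: it is the value at lambda of a function
    interpolating the partial sums. Uniqueness of the interpolation requires that q is not a root of
    unity, which |q| < 1 provides. The third condition of gl_q survives evaluation at t = lambda as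
    zeros at lambda - 1, ..., lambda - n of the function interpolating the n-th superdiagonal. These
    zeros make the trace cyclic, and they select one solution of the difference equations for a
    gauge transformation, so that each orbit in [Yq] contains exactly one companion matrix.
    Genericity enters twice: lambda is non-zero, so the form on U, which is lambda times the
    constant term of a product, is nondegenerate; and q^(lambda m) differs from 1 for m non-zero, so
    1 - h^lambda is inverted mode by mode. The factor lambda in Bbar + lambda/2 cancels the 1/lambda
    of the projection onto U. Away from constants, the three operators (1/2)(1 + h^lambda)/(1 -
    h^lambda), 1/(1 - h^lambda) and h^lambda/(1 - h^lambda) are one operator shifted by 0, 1/2 and
    -1/2, which is how a single Bbar produces all the entries of the second bracket. *)

Lemma cos_eq1 (R : realType) (x : R) : cos x = 1 -> exists k : int, x = pi *+ 2 * k%:~R.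
Proof.
move=> cx.
have pi0 : 0 < (pi : R) *+ 2 by rewrite mulrn_wgt0 // pi_gt0.
pose k := Num.floor (x / (pi *+ 2)).
exists k; pose y := x - pi *+ 2 * k%:~R.
have kx : k%:~R <= x / (pi *+ 2) < (k + 1)%:~R by rewrite floor_le lt_succ_floor.
have y0 : 0 <= y.
  by move: kx => /andP[+ _]; rewrite ler_pdivlMr // subr_ge0 mulrC.
have y1 : y < pi *+ 2.
  by move: kx => /andP[_]; rewrite ltr_pdivrMr // intrD mulrDl mul1r ltrBlDl mulrC.
have cper (z : R) (n : nat) : cos (z + (pi *+ 2) *+ n) = cos z.
  elim: n => [|n IH]; first by rewrite mulr0n addr0.
  by rewrite mulrSr addrA mulr2n cosD2pi.
have cy : cos y = 1.
  rewrite -cx /y; case: k {kx y y0 y1} => n.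
    by rewrite -[RHS](cper _ n) -pmulrn mulr_natr -[in LHS](cper _ n) subrK cper.
  by rewrite NegzE mulrNz mulrN opprK -pmulrn mulr_natr cper.
suff : y = 0 by move=> /subr0_eq.
apply/eqP; rewrite eq_le y0 andbT leNgt; apply/negP => y_gt0.
(* The double angle formula turns cos y = 1 into sin (y / 2) = 0, while the sine is positive on (0,
   pi). *)
have := sin_gt0_pi (x := y / 2).
have -> : 0 < y / 2 < pi.
  by rewrite divr_gt0 //= ltr_pdivrMr // mulr_natr.
move=> /(_ isT); have := cosD (y / 2) (y / 2); rewrite -splitr cy.
have := cos2Dsin2 (y / 2); rewrite !expr2 => h1 h2.
have : sin (y / 2) * sin (y / 2) = 0 by lra.
by move/eqP; rewrite mulf_eq0 orbb => /eqP ->; rewrite ltxx.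
Qed.

(** * Periods of the complex exponential *)

Section ComplexExponential.
Variable R : realType.
Local Notation C := R[i].

Lemma cexpD (z w : C) : cexp (z + w) = cexp z * cexp w.
Proof.
case: z w => a b [c d]; rewrite /cexp /= expRD cosD sinD.
by simpc; congr (_ +i* _)%C; ring.
Qed.

Lemma cexp0 : cexp (0 : C) = 1.
Proof. by rewrite /cexp /= expR0 cos0 sin0 mul1r. Qed.

Lemma cexp_neq0 (z : C) : cexp z != 0.
Proof.
apply/eqP => z0; have := cexpD z (- z).
by rewrite subrr cexp0 z0 mul0r => /eqP; rewrite oner_eq0.
Qed.

(** The imaginary part gives sin b = 0, hence cos b = 1 or -1; positivity of the real exponential
    excludes -1 and then forces the real part of z to vanish. *)
Lemma cexp_eq1 (z : C) : cexp z = 1 -> exists k : int, z = 2 * (pi : R)%:C%C * 'i%C * k%:~R.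
Proof.
case: z => a b; rewrite /cexp /=; simpc => -[h1 h2].
have sb : sin b = 0.
  by apply/eqP; move/eqP: h2; rewrite mulf_eq0 gt_eqF ?expR_gt0.
have cb : cos b = 1.
  have := cos2Dsin2 b; rewrite sb expr0n addr0 => /eqP.
  rewrite sqrf_eq1 => /orP[/eqP//|/eqP cb].
  by have := expR_gt0 a; move: h1; rewrite cb; lra.
have ea : expR a = 1 by move: h1; rewrite cb mulr1.
have a0 : a = 0 by apply: expR_inj; rewrite ea expR0.
have [k ->] := cos_eq1 cb; exists k; rewrite a0.
have -> : k%:~R = (k%:~R : R)%:C%C :> C.
  by rewrite -[LHS](rmorph_int (real_complex R)).
by simpc; rewrite -mulr_natl; congr (_ +i* _)%C; ring.
Qed.

End ComplexExponential.

(** * The algebra A_0 *)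

Section ExponentialPolynomials.
Variable F : numFieldType.

Lemma poly_eq0_large_nat (p : {poly F}) (N : nat) :
  (forall m, (N <= m)%N -> p.[m%:R] = 0) -> p = 0.
Proof.
move=> p0; apply: (@roots_geq_poly_eq0 _ _ [seq i%:R | i <- iota N (size p)]).
- by apply/allP => _ /mapP[i + ->]; rewrite mem_iota => /andP[Ni _]; apply/rootP/p0.
- by rewrite map_inj_uniq ?iota_uniq // => i j /eqP; rewrite eqr_nat => /eqP.
- by rewrite size_map size_iota.
Qed.

Lemma size_comp_XaddC (p : {poly F}) c : size (p \Po ('X + c%:P)) = size p.
Proof. by rewrite size_comp_poly2 // size_XaddC. Qed.

Lemma lead_coef_comp_XaddC (p : {poly F}) c :
  lead_coef (p \Po ('X + c%:P)) = lead_coef p.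
Proof.
by rewrite lead_coef_comp ?size_XaddC // lead_coefXaddC expr1n mulr1.
Qed.

(** The shift X -> X + 1 preserves the leading coefficient, so comparing leading coefficients is
    enough. *)
Lemma poly_shift_eq (c d : F) (p : {poly F}) :
  c != d -> c *: (p \Po ('X + 1)) = d *: p -> p = 0.
Proof.
move=> cd e; apply/eqP; rewrite -lead_coef_eq0; apply/eqP.
have := congr1 lead_coef e; rewrite !lead_coefZ -polyC1 lead_coef_comp_XaddC.
move/eqP; rewrite -subr_eq0 -mulrBl mulf_eq0 subr_eq0 (negPf cd) /=.
by move/eqP.
Qed.

Lemma size_lt_of_coef (p : {poly F}) n :
  (size p <= n.+1)%N -> p`_n = 0 -> (size p <= n)%N.
Proof.
move=> sp pn; apply/leq_sizeP => j; rewrite leq_eqVlt => /orP[/eqP <- //|nj].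
by apply: nth_default; apply: leq_trans sp nj.
Qed.

(* Exponential polynomials are linearly independent: replacing f by
   x^b f(m + 1) - x^B f(m) kills the leading coefficient of the coefficient of
   the top exponential x^(B m), hence the double induction. *)
Lemma exp_poly_eq0 (x : F) n (p : nat -> {poly F}) (N : nat) : x != 0 ->
  (forall k, (0 < k)%N -> x ^+ k != 1) ->
  (forall m, (N <= m)%N -> \sum_(b < n) (p b).[m%:R] * x ^+ b ^+ m = 0) ->
  forall b, (b < n)%N -> p b = 0.
Proof.
move=> x0 xru; elim: n p N => // n IHn p N.
move: {2}(size (p n)) (leqnn (size (p n))) => s.
have xinj b : (b < n)%N -> x ^+ b != x ^+ n.
  move=> bn; rewrite -(subnK (ltnW bn)) exprD -[X in X == _]mul1r.
  rewrite (inj_eq (mulIf (expf_neq0 b x0))) eq_sym xru //; lia.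
elim: s p N => [|s IHs] p N.
  rewrite leqn0 size_poly_eq0 => /eqP pn0 H b.
  rewrite ltnS leq_eqVlt => /orP[/eqP -> //|bn]; apply: (IHn p N) => // m Nm.
  by have := H m Nm; rewrite big_ord_recr /= pn0 horner0 mul0r addr0.
move=> sp H.
pose p' b := x ^+ b *: (p b \Po ('X + 1)) - x ^+ n *: p b.
have p'0 b : (b < n.+1)%N -> p' b = 0.
  move=> bn; apply: (IHs p' N) => //.
    apply: size_lt_of_coef.
      rewrite /p' -scalerBr (leq_trans (size_scale_leq _ _)) //.
      rewrite (leq_trans (size_polyD _ _)) // size_polyN geq_max.
      by rewrite -polyC1 size_comp_XaddC sp.
    rewrite /p' coefB !coefZ -mulrBr.
    have [sps|sps] := leqP (size (p n)) s.
      by rewrite !nth_default ?subrr ?mulr0 // -polyC1 size_comp_XaddC.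
    have sE : size (p n) = s.+1 by apply/eqP; rewrite eqn_leq sp sps.
    have := lead_coef_comp_XaddC (p n) 1; rewrite /lead_coef size_comp_XaddC sE.
    by rewrite polyC1 /= => ->; rewrite subrr mulr0.
  move=> m Nm; have := H m.+1 (leqW Nm); have := H m Nm.
  move=> Hm Hm1.
  transitivity (\sum_(b < n.+1) (p b).[m.+1%:R] * x ^+ b ^+ m.+1 -
    x ^+ n * \sum_(b < n.+1) (p b).[m%:R] * x ^+ b ^+ m); last first.
    by rewrite Hm Hm1 mulr0 subr0.
  rewrite mulr_sumr -sumrB.
  apply: eq_bigr => -[c cn] _ /=.
  rewrite /p' hornerD hornerN !hornerZ horner_comp hornerD hornerX -polyC1 hornerC.
  by rewrite natr1 exprS; ring.
have pb0 b : (b < n)%N -> p b = 0.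
  move=> bn; apply: (poly_shift_eq (xinj b bn)).
  by apply/eqP; rewrite -subr_eq0; apply/eqP; apply: p'0; rewrite ltnW.
(* With the lower coefficients gone, the top one is a polynomial that vanishes at all large
   integers. *)
move=> b; rewrite ltnS leq_eqVlt => /orP[/eqP ->|/pb0 //].
apply: (@poly_eq0_large_nat _ N) => m /H.
rewrite big_ord_recr big1 ?add0r /= => [|[c cn] _]; last first.
  by rewrite /= pb0 // horner0 mul0r.
by move/eqP; rewrite add0r mulf_eq0 expf_eq0 (negPf (expf_neq0 _ x0)) andbF orbF => /eqP.
Qed.

(** Induction on the size of [p]: one polynomial [P0] whose image has a non-zero coefficient at X^s
    and none above suffices to cancel the top coefficient of [p]. If c is not 1, X^s itself works,
    with coefficient c - 1. *)
Lemma poly_diff_solve (c : F) (p : {poly F}) :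
  exists P : {poly F}, c *: (P \Po ('X + 1)) - P = p.
Proof.
move: {2}(size p) (leqnn (size p)) => s; elim: s p => [|s IHs] p sp.
  exists 0; rewrite comp_poly0 scaler0 subr0.
  by apply/esym/eqP; rewrite -size_poly_eq0 -leqn0.
pose T (P : {poly F}) := c *: (P \Po ('X + 1)) - P.
have TD P Q : T (P + Q) = T P + T Q.
  by rewrite /T comp_polyD scalerDr opprD addrACA.
suff [P0 sP0] : exists P0, (size (p - T P0)%R <= s)%N.
  have [P1 TP1] := IHs _ sP0; exists (P0 + P1); rewrite -/(T _) TD.
  by rewrite /T TP1 -/(T _) addrC subrK.
have TZ a P : T (a *: P) = a *: T P.
  by rewrite /T comp_polyZ scalerBr !scalerA mulrC.
suff [P0 [sP0 cP0]] : exists P0, (size (T P0) <= s.+1)%N /\ (T P0)`_s != 0.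
  exists ((p`_s / (T P0)`_s) *: P0); apply: size_lt_of_coef.
    rewrite TZ (leq_trans (size_polyD _ _)) // size_polyN geq_max sp.
    by rewrite (leq_trans (size_scale_leq _ _)).
  by rewrite coefB TZ coefZ divfK // subrr.
have [c1|c1] := eqVneq c 1; last first.
  exists 'X^s; split.
    rewrite /T (leq_trans (size_polyD _ _)) // size_polyN geq_max size_polyXn leqnn andbT.
    by rewrite (leq_trans (size_scale_leq _ _)) // -polyC1 size_comp_XaddC size_polyXn.
  rewrite /T coefB coefZ coefXn eqxx.
  have -> : (('X^s : {poly F}) \Po ('X + 1))`_s = 1.
    have := lead_coef_comp_XaddC 'X^s 1.
    by rewrite /lead_coef size_comp_XaddC size_polyXn polyC1 /= coefXn eqxx.
  by rewrite mulr1 subr_eq0.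
(* In the resonant case c = 1 the operator lowers the degree by one, and X^(s+1) is sent to (s + 1)
   X^s plus lower terms. *)
exists 'X^(s.+1).
have TE : T 'X^(s.+1) = \sum_(i < s.+1) 'X^i *+ 'C(s.+1, i).
  rewrite /T c1 scale1r comp_Xn_poly exprD1n big_ord_recr /= binn mulr1n.
  by rewrite addrK.
have coefT k : (T 'X^(s.+1))`_k = \sum_(i < s.+1) (k == i)%:R *+ 'C(s.+1, i).
  by rewrite TE coef_sum; apply: eq_bigr => i _; rewrite coefMn coefXn.
split.
  apply/leq_sizeP => k sk; rewrite coefT big1 // => -[i si] _ /=.
  by rewrite (_ : k == i = false) ?mul0rn //; apply/eqP => ki; lia.
rewrite coefT big_ord_recr /= eqxx big1 => [|[i si] _ /=]; last first.
  by rewrite (_ : s == i = false) ?mul0rn //; apply/eqP => ki; lia.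
by rewrite add0r binSn pnatr_eq0.
Qed.

End ExponentialPolynomials.

Section A0Functions.
Context (R : realType) (lnq : R[i]).
Local Notation C := R[i].

(* An opaque copy of [qpow], so that unification never unfolds it into real
   exponentials and trigonometric functions. *)
Fact qexp_subproof : {f : C -> C | f = qpow lnq}.
Proof. by exists (qpow lnq). Qed.
Definition qexp : C -> C := sval qexp_subproof.

Lemma qexpE : qpow lnq = qexp.
Proof. by rewrite /qexp; case: qexp_subproof. Qed.

Lemma qexpD w v : qexp (w + v) = qexp w * qexp v.
Proof. by rewrite -qexpE /qpow mulrDl cexpD. Qed.

Lemma qexp0 : qexp 0 = 1.
Proof. by rewrite -qexpE /qpow mul0r cexp0. Qed.

Lemma qexp_neq0 w : qexp w != 0.
Proof. by rewrite -qexpE cexp_neq0. Qed.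

Lemma qexpN w : qexp (- w) = (qexp w)^-1.
Proof.
by apply: (mulfI (qexp_neq0 w)); rewrite -qexpD subrr qexp0 divff ?qexp_neq0.
Qed.

Lemma qexpMn w n : qexp (w *+ n) = qexp w ^+ n.
Proof.
by elim: n => [|n IH]; rewrite ?mulr0n ?qexp0 // mulrS qexpD IH exprS.
Qed.

Lemma A0_qexp : A0 lnq qexp.
Proof. by rewrite -qexpE; apply: A0_qpow. Qed.

Lemma A0_qexpN : A0 lnq (fun w => qexp (- w)).
Proof. by rewrite -qexpE; apply: A0_qpowN. Qed.

(** The outer variable of [P] stands for q^w and the inner one for w; the power of q^(-w) serves as
    a common denominator. *)
Lemma A0_nf f : A0 lnq f -> exists B (P : {poly {poly C}}),
  forall w, f w = qexp (- w) ^+ B * (P.[(qexp w)%:P]).[w].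
Proof.
elim=> [c||||{}f g _ [B1 [P1 h1]] _ [B2 [P2 h2]]|{}f g _ [B1 [P1 h1]] _ [B2 [P2 h2]]].
- by exists 0, c%:P%:P => w; rewrite !hornerC mul1r.
- by exists 0, ('X%:P) => w; rewrite !hornerE.
- by exists 0, 'X => w; rewrite qexpE !hornerE.
- by exists 1, 1 => w; rewrite qexpE !hornerE.
- exists (B1 + B2)%N, (P1 * 'X^B2 + P2 * 'X^B1) => w.
  have qq n : qexp (- w) ^+ n * qexp w ^+ n = 1.
    by rewrite qexpN -exprMn mulVf ?qexp_neq0 // expr1n.
  rewrite h1 h2 !(hornerM, hornerXn, hornerD, horner_exp, hornerC) exprD.
  transitivity (qexp (- w) ^+ B1 * (qexp (- w) ^+ B2 * qexp w ^+ B2) * P1.[(qexp w)%:P].[w]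
    + qexp (- w) ^+ B2 * (qexp (- w) ^+ B1 * qexp w ^+ B1) * P2.[(qexp w)%:P].[w]).
    by rewrite !qq !mulr1.
  by ring.
- exists (B1 + B2)%N, (P1 * P2) => w.
  by rewrite h1 h2 !(hornerM) exprD; ring.
Qed.

Lemma A0_sum I (r : seq I) (P : pred I) (F : I -> C -> C) :
  (forall i, P i -> A0 lnq (F i)) -> A0 lnq (fun w => \sum_(i <- r | P i) F i w).
Proof.
move=> FA; elim: r => [|i r IH].
  by under eq_fun do rewrite big_nil; apply: A0_const.
under eq_fun do rewrite big_cons.
by case Pi: (P i) => //; apply: A0_add => //; apply: FA.
Qed.

Lemma A0_exp f n : A0 lnq f -> A0 lnq (fun w => f w ^+ n).
Proof.
move=> fA; elim: n => [|n IH]; first exact: A0_const.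
by under eq_fun do rewrite exprS; apply: A0_mul.
Qed.

Lemma A0_horner (p : {poly C}) : A0 lnq (fun w => p.[w]).
Proof.
under eq_fun do rewrite horner_coef.
apply: A0_sum => i _; apply: A0_mul; first exact: A0_const.
exact/A0_exp/A0_id.
Qed.

Lemma A0_scale c f : A0 lnq f -> A0 lnq (fun w => c * f w).
Proof. by move=> fA; apply: A0_mul => //; apply: A0_const. Qed.

Lemma A0_sub f g : A0 lnq f -> A0 lnq g -> A0 lnq (fun w => f w - g w).
Proof.
move=> fA gA; apply: A0_add => //.
by under eq_fun do rewrite -mulN1r; apply: A0_scale.
Qed.

Lemma A0_shift f c : A0 lnq f -> A0 lnq (fun w => f (w + c)).
Proof.
elim=> [d||||{}f g _ fA _ gA|{}f g _ fA _ gA].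
- exact: A0_const.
- by apply: A0_add; [apply: A0_id | apply: A0_const].
- under eq_fun do rewrite qexpE qexpD.
  by apply: A0_mul; [apply: A0_qexp | apply: A0_const].
- under eq_fun do rewrite qexpE opprD qexpD.
  by apply: A0_mul; [apply: A0_qexpN | apply: A0_const].
- exact: A0_add.
- exact: A0_mul.
Qed.

Lemma A0_qexpX (k : int) : A0 lnq (fun w => qexp w ^ k).
Proof.
case: k => n; first by apply/A0_exp/A0_qexp.
under eq_fun do rewrite NegzE -exprnN -exprVn -qexpN.
by apply/A0_exp/A0_qexpN.
Qed.

Hypothesis q_ru : forall k, (0 < k)%N -> qexp 1 ^+ k != 1.

Lemma qexp_nat n : qexp n%:R = qexp 1 ^+ n.
Proof. exact: qexpMn. Qed.

(** In normal form, the values of f - g at integers m are q^(-Bm) times an exponential polynomial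
    with base q, and the exponentials q^(bm) are independent since q is not a root of unity. *)
Lemma A0_uniq f g N : A0 lnq f -> A0 lnq g ->
  (forall n, (N <= n)%N -> f n%:R = g n%:R) -> f = g.
Proof.
move=> fA gA fg; apply/funext => w; apply/eqP; rewrite -subr_eq0; apply/eqP.
have [B [P hP]] := A0_nf (A0_sub fA gA); rewrite hP.
suff P0 b : (b < size P)%N -> P`_b = 0.
  rewrite (horner_coef P) big1 ?horner0 ?mulr0 // => i _.
  by rewrite P0 ?mul0r // ltn_ord.
apply: (@exp_poly_eq0 _ (qexp 1) (size P) (fun b => P`_b) N) => [||m Nm].
- exact: qexp_neq0.
- exact: q_ru.
have := hP m%:R; rewrite (fg _ Nm) subrr => /esym/eqP.
rewrite mulf_eq0 expf_eq0 (negPf (qexp_neq0 _)) andbF /= => /eqP P0; rewrite -[RHS]P0.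
rewrite (horner_coef P) horner_sum; apply: eq_bigr => i _.
by rewrite hornerM horner_exp hornerC qexp_nat exprAC.
Qed.

(** Each exponential in the normal form of [g] leads to a polynomial difference equation. This
    first-order equation is the common source of the interpolations needed later: partial traces,
    A^-1 on diagonal matrices, and the diagonals of a gauge transformation. *)
Lemma A0_diff_solve (k : int) g (w0 v : C) : A0 lnq g ->
  exists G, [/\ A0 lnq G, forall w, G (w + 1) = qexp 1 ^ k * G w + g w & G w0 = v].
Proof.
move=> gA; have [B [P hP]] := A0_nf gA.
pose c : C := qexp 1 ^ k.
have c0 : c != 0 by rewrite expfz_neq0 ?qexp_neq0.
(* The factor that q^((b - B) w) acquires under w -> w + 1. *)
pose e (b : nat) : C := qexp 1 ^- B * qexp 1 ^+ b.
have [Q hQ] := choice (fun b => poly_diff_solve (e b / c) (c^-1 *: P`_b)).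
pose G0 (w : C) := \sum_(b < size P) (Q b).[w] * (qexp (- w) ^+ B * qexp w ^+ b).
have G0A : A0 lnq G0.
  apply: A0_sum => b _; apply: A0_mul; first exact: A0_horner.
  by apply: A0_mul; apply: A0_exp; [apply: A0_qexpN|apply: A0_qexp].
have G0E w : G0 (w + 1) = c * G0 w + g w.
  rewrite hP (horner_coef P) horner_sum /G0 !mulr_sumr -big_split /=.
  apply: eq_bigr => b _; rewrite hornerM horner_exp hornerC.
  have := congr1 (fun p => p.[w]) (hQ b).
  rewrite hornerD hornerN !hornerZ horner_comp hornerD hornerX -polyC1 hornerC => hb.
  have {}hb : (P`_b).[w] = e b * (Q b).[w + 1] - c * (Q b).[w].
    by apply: (mulfI (invr_neq0 c0)); rewrite -hb; field.
  rewrite hb !qexpN !qexpD /e; move: (qexp w) (qexp 1) => x y.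
  by rewrite invfM !exprMn !exprVn; ring.
(* The homogeneous solution q^(kw) adjusts the value at [w0]. *)
exists (fun w => G0 w + (v - G0 w0) / qexp w0 ^ k * qexp w ^ k); split.
- by apply: A0_add => //; apply: A0_scale; apply: A0_qexpX.
- move=> w; rewrite G0E qexpD (expfzMl (qexp w) (qexp 1)) -/c; move: (qexp w ^ k) (qexp w0 ^ k) => x y.
  by ring.
- by rewrite divfK ?subrKC // expfz_neq0 ?qexp_neq0.
Qed.

End A0Functions.

(** * Laurent series *)

Lemma fsum_seq (T : choiceType) (W : zmodType) (r : seq T) (f : T -> W) :
  uniq r -> (forall x, x \notin r -> f x = 0) ->
  \sum_(x \in [set: T]%classic) f x = \sum_(x <- r) f x.
Proof.
move=> ur f0; rewrite (fsbigE r) //; first by apply: eq_bigl => x; rewrite in_setT.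
by move=> x _; apply: f0.
Qed.

Section LaurentSeries.
Variable R : realType.
Local Notation C := R[i].
Local Notation ser := (ser R).

Definition vbound (M : int) (a : ser) := forall m, M < m -> a m = 0.

(** For m <= Ma + Mb these are exactly the k with k <= Ma and m - k <= Mb, in decreasing order.
    Otherwise that range is empty and the indices listed contribute only zeros. *)
Definition window (Ma Mb m : int) : seq int :=
  [seq Ma - i%:Z | i <- iota 0 (absz (Ma + Mb - m)%R).+1].

Lemma window_uniq Ma Mb m : uniq (window Ma Mb m).
Proof. by rewrite map_inj_uniq ?iota_uniq // => i j; lia. Qed.

Lemma window_out Ma Mb m k : k \notin window Ma Mb m -> Ma < k \/ Mb < m - k.
Proof.
move=> kr; have [?|kMa] := ltP Ma k; [by left | right].
rewrite ltNge; apply: contra kr => kMb; apply/mapP.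
by exists (absz (Ma - k)%R); rewrite ?mem_iota; lia.
Qed.

Lemma smul_window Ma Mb m a b : vbound Ma a -> vbound Mb b ->
  smul a b m = \sum_(k <- window Ma Mb m) a k * b (m - k).
Proof.
move=> va vb; apply: fsum_seq; first exact: window_uniq.
by move=> k /window_out[/va ->|/vb ->]; rewrite ?mul0r ?mulr0.
Qed.

Lemma smul_vbound Ma Mb a b : vbound Ma a -> vbound Mb b ->
  vbound (Ma + Mb) (smul a b).
Proof.
move=> va vb m mM; rewrite (smul_window m va vb) big1_seq // => k _.
by have [/va ->|kM] := ltP Ma k; rewrite ?mul0r // vb ?mulr0 //; lia.
Qed.

Definition trunc (M : int) (a : ser) (n : nat) : {poly C} := \poly_(i < n) a (M - i%:Z).

(* Truncated at z^(M - n), Laurent series multiply as polynomials in z^-1. *)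
Lemma smul_trunc Ma Mb a b n k : vbound Ma a -> vbound Mb b -> (k < n)%N ->
  smul a b (Ma + Mb - k%:Z) = (trunc Ma a n * trunc Mb b n)`_k.
Proof.
move=> va vb kn; rewrite (smul_window _ va vb) coefM /window big_map.
rewrite (_ : absz _ = k); last by lia.
rewrite -/(index_iota 0 k.+1) big_mkord; apply: eq_bigr => -[i ik] _ /=.
rewrite !coef_poly !ifT; try lia.
by congr (_ * b _); lia.
Qed.

Lemma trunc_eq Ma a (p : {poly C}) n : (forall k, (k < n)%N -> a (Ma - k%:Z) = p`_k) ->
  forall k, (k < n)%N -> (trunc Ma a n)`_k = p`_k.
Proof. by move=> e k kn; rewrite coef_poly kn e. Qed.

Lemma coefM_eq_trunc (p p' r : {poly C}) n k : (k < n)%N ->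
  (forall j, (j < n)%N -> p`_j = p'`_j) -> (p * r)`_k = (p' * r)`_k.
Proof.
move=> kn e; rewrite !coefM; apply: eq_bigr => -[i ik] _ /=; rewrite e //.
by apply: leq_trans kn.
Qed.

Lemma smulC (a b : ser) : laurent a -> laurent b -> smul a b = smul b a.
Proof.
move=> [Ma va] [Mb vb]; apply/funext => m.
have [mM|mM] := ltP (Ma + Mb) m.
  by rewrite (smul_vbound va vb) // (smul_vbound vb va) // addrC.
pose k := absz (Ma + Mb - m)%R; have -> : m = Ma + Mb - k%:Z by lia.
by rewrite (smul_trunc va vb (leqnn _)) mulrC -(smul_trunc vb va (leqnn _)) (addrC Ma).
Qed.

Lemma smulA (a b c : ser) : laurent a -> laurent b -> laurent c ->
  smul a (smul b c) = smul (smul a b) c.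
Proof.
move=> [Ma va] [Mb vb] [Mc vc]; apply/funext => m.
have vab := smul_vbound va vb; have vbc := smul_vbound vb vc.
have [mM|mM] := ltP (Ma + Mb + Mc) m.
  by rewrite (smul_vbound va vbc) ?(smul_vbound vab vc) // addrA.
pose k := absz (Ma + Mb + Mc - m)%R.
have -> : m = Ma + Mb + Mc - k%:Z by lia.
rewrite (smul_trunc vab vc (leqnn _)).
rewrite (coefM_eq_trunc _ (leqnn _) (trunc_eq (fun j => @smul_trunc _ _ _ _ k.+1 j va vb))).
rewrite -(addrA Ma) (smul_trunc va vbc (leqnn _)) mulrC.
rewrite (coefM_eq_trunc _ (leqnn _) (trunc_eq (fun j => @smul_trunc _ _ _ _ k.+1 j vb vc))).
by rewrite mulrC mulrA.
Qed.

Lemma laurent_smul (a b : ser) : laurent a -> laurent b -> laurent (smul a b).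
Proof. by move=> [Ma va] [Mb vb]; exists (Ma + Mb); apply: smul_vbound. Qed.

Lemma laurent_sone : laurent (sone R).
Proof. by exists 0 => m m0; rewrite /sone gt_eqF. Qed.

Lemma smul1s (a : ser) : laurent a -> smul (sone R) a = a.
Proof.
move=> _; apply/funext => m; rewrite /smul (@fsum_seq _ _ [:: 0]) //.
  by rewrite big_seq1 /sone eqxx mul1r subr0.
by move=> k; rewrite inE /sone => /negPf ->; rewrite mul0r.
Qed.

Lemma smulDs (a b c : ser) : laurent a -> laurent b -> laurent c ->
  smul (a + b) c = smul a c + smul b c.
Proof.
move=> [Ma va] [Mb vb] [Mc vc]; apply/funext => m.
pose M := Num.max Ma Mb.
have va' : vbound M a by move=> k; rewrite gt_max => /andP[/va].
have vb' : vbound M b by move=> k; rewrite gt_max => /andP[_ /vb].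
have vab : vbound M (a + b) by move=> k Mk; rewrite !fctE va' ?vb' ?addr0.
rewrite !fctE !(@smul_window M Mc) // -big_split.
by apply: eq_bigr => k _ /=; rewrite mulrDl.
Qed.

Lemma smulZs x (a c : ser) : laurent a -> laurent c -> smul (x *: a) c = x *: smul a c.
Proof.
move=> [Ma va] [Mc vc]; apply/funext => m.
have vxa : vbound Ma (x *: a) by move=> k Mk; rewrite !fctE va ?scaler0.
rewrite !fctE !(@smul_window Ma Mc) // /GRing.scale /= mulr_sumr.
by apply: eq_bigr => k _ /=; rewrite mulrA.
Qed.

Definition laurentb : {pred ser} := fun a => `[< laurent a >].

Lemma laurentb_closed : subsemimod_closed laurentb.
Proof.
split; first split.
- by apply/asboolP; exists 0.
- move=> a b /asboolP[Ma va] /asboolP[Mb vb]; apply/asboolP.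
  exists (Num.max Ma Mb) => m; rewrite gt_max => /andP[/va am /vb bm].
  by rewrite !fctE am bm addr0.
- move=> x a /asboolP[Ma va]; apply/asboolP.
  by exists Ma => m Mm; rewrite !fctE va ?scaler0.
Qed.

HB.instance Definition _ := GRing.isSubmodClosed.Build C ser laurentb laurentb_closed.

Record lser := Lser {lval : ser; _ : laurentb lval}.
HB.instance Definition _ := [isSub for lval].
HB.instance Definition _ := [Choice of lser by <:].
HB.instance Definition _ := [SubChoice_isSubLmodule of lser by <:].

Lemma lvalP (a : lser) : laurent (lval a).
Proof. by case: a => a ha; apply/asboolP. Qed.

Definition mkl (a : ser) (ha : laurent a) : lser := Lser (introT (asboolP _) ha).

Lemma mklK a (ha : laurent a) : lval (mkl ha) = a. Proof. by []. Qed.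

Lemma lval_inj : injective lval. Proof. exact: val_inj. Qed.

Lemma lserP (a b : lser) : (forall m, lval a m = lval b m) -> a = b.
Proof. by move=> e; apply: lval_inj; apply/funext. Qed.

(* Operations on series and matrices are sealed behind opaque proofs, as
   unification would otherwise unfold them down to infinite sums. *)
Fact lmul_key : {m : lser -> lser -> lser | forall a b, lval (m a b) = smul (lval a) (lval b)}.
Proof. by exists (fun a b => mkl (laurent_smul (lvalP a) (lvalP b))). Qed.
Definition lmul : lser -> lser -> lser := sval lmul_key.
Lemma lmulE a b : lval (lmul a b) = smul (lval a) (lval b).
Proof. exact: (svalP lmul_key). Qed.
Definition lone : lser := mkl laurent_sone.

Lemma lmulA : associative lmul.
Proof. by move=> a b c; apply: lval_inj; rewrite !lmulE; apply: smulA; apply: lvalP. Qed.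
Lemma lmulC : commutative lmul.
Proof. by move=> a b; apply: lval_inj; rewrite !lmulE; apply: smulC; apply: lvalP. Qed.
Lemma lmul1 : left_id lone lmul.
Proof. by move=> a; apply: lval_inj; rewrite lmulE; apply: smul1s; apply: lvalP. Qed.
Lemma lmulD : left_distributive lmul +%R.
Proof. by move=> a b c; apply: lval_inj; rewrite -[RHS]/(lval (lmul a c) + lval (lmul b c)) !lmulE; apply: smulDs; apply: lvalP. Qed.
Lemma lone_neq0 : lone != 0.
Proof.
apply/eqP => /(congr1 (fun a => lval a 0)) /eqP.
by rewrite /= /sone eqxx oner_eq0.
Qed.

HB.instance Definition _ :=
  GRing.Zmodule_isComNzRing.Build lser lmulA lmulC lmul1 lmulD lone_neq0.

Lemma lscaleAl (x : C) (a b : lser) : x *: (a * b) = x *: a * b.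
Proof.
apply: lval_inj; rewrite -[LHS]/(x *: lval (lmul a b)) -[RHS]/(lval (lmul (x *: a) b)).
by rewrite !lmulE; apply/esym/smulZs; apply: lvalP.
Qed.

HB.instance Definition _ := GRing.Lmodule_isLalgebra.Build C lser lscaleAl.
HB.instance Definition _ := GRing.Lalgebra_isComAlgebra.Build C lser.

Lemma lvalM (a b : lser) : lval (a * b) = smul (lval a) (lval b).
Proof. exact: lmulE. Qed.

Definition cf (m : int) (a : lser) : C := lval a m.

Lemma cf_is_linear m : linear_for *%R (cf m).
Proof. by []. Qed.
HB.instance Definition _ m := GRing.isLinear.Build C lser C *%R (cf m) (cf_is_linear m).

Definition ct := cf 0.

Lemma ct_is_linear : linear_for *%R ct.
Proof. by []. Qed.
HB.instance Definition _ := GRing.isLinear.Build C lser C *%R ct ct_is_linear.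

Lemma cfP (a b : lser) : (forall m, cf m a = cf m b) -> a = b.
Proof. exact: lserP. Qed.

Lemma cfD m (a b : lser) : cf m (a + b) = cf m a + cf m b. Proof. by []. Qed.

Lemma cfB m (a b : lser) : cf m (a - b) = cf m a - cf m b. Proof. by []. Qed.
Lemma cfZ m x (a : lser) : cf m (x *: a) = x * cf m a. Proof. by []. Qed.
Lemma ctD (a b : lser) : ct (a + b) = ct a + ct b. Proof. by []. Qed.
Lemma ctN (a : lser) : ct (- a) = - ct a. Proof. by []. Qed.
Lemma ctB (a b : lser) : ct (a - b) = ct a - ct b. Proof. by []. Qed.
Lemma ctZ x (a : lser) : ct (x *: a) = x * ct a. Proof. by []. Qed.

Lemma cf1 m : cf m 1 = (m == 0)%:R. Proof. by []. Qed.

Lemma cfM_window Ma Mb m (a b : lser) :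
  vbound Ma (lval a) -> vbound Mb (lval b) ->
  cf m (a * b) = \sum_(k <- window Ma Mb m) cf k a * cf (m - k) b.
Proof. by move=> va vb; rewrite {1}/cf lvalM (smul_window m va vb). Qed.

Lemma laurent_mult (c : int -> C) (a : lser) : laurent (fun m => c m * lval a m).
Proof. by case: (lvalP a) => M va; exists M => m /va ->; rewrite mulr0. Qed.
Fact mult_key : {m : (int -> C) -> lser -> lser | forall c a k, lval (m c a) k = c k * lval a k}.
Proof. by exists (fun c a => mkl (laurent_mult c a)). Qed.
(** Fourier multipliers: the dilations h^w, the removal of the constant term, the resolvent of
    h^lambda and [Delta] all take this form, so identities between them reduce to identities between
    scalar symbols. *)
Definition mult : (int -> C) -> lser -> lser := sval mult_key.

Lemma cf_mult c m a : cf m (mult c a) = c m * cf m a.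
Proof. exact: (svalP mult_key). Qed.

Lemma vbound_mult M c a : vbound M (lval a) -> vbound M (lval (mult c a)).
Proof. by move=> va m /va am; rewrite -/(cf m _) cf_mult /cf am mulr0. Qed.

Lemma mult_is_linear c : linear (mult c).
Proof.
move=> x a b; apply: cfP => m.
by rewrite !(cf_mult, cfD, cfZ) mulrDr mulrCA.
Qed.
HB.instance Definition _ c := GRing.isLinear.Build C lser lser _ (mult c) (mult_is_linear c).

Lemma mult_mult c d a : mult c (mult d a) = mult (fun m => c m * d m) a.
Proof. by apply: cfP => m; rewrite !cf_mult mulrA. Qed.

Lemma mult_ext c d a : c =1 d -> mult c a = mult d a.
Proof. by move=> e; apply: cfP => m; rewrite !cf_mult e. Qed.

Lemma laurent_monom (x : C) (a : int) : laurent (fun m => if m == a then x else 0).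
Proof. by exists a => m am; rewrite gt_eqF. Qed.
Fact monom_key : {m : C -> int -> lser | forall x a k, lval (m x a) k = if k == a then x else 0}.
Proof. by exists (fun x a => mkl (laurent_monom x a)). Qed.
Definition monom : C -> int -> lser := sval monom_key.

Lemma cf_monom x a m : cf m (monom x a) = if m == a then x else 0.
Proof. exact: (svalP monom_key). Qed.

Lemma cf_monomM x a m b : cf m (monom x a * b) = x * cf (m - a) b.
Proof.
rewrite /cf lvalM /smul (@fsum_seq _ _ [:: a]) //.
  by rewrite big_seq1 -/(cf _ _) cf_monom eqxx.
by move=> k; rewrite inE -/(cf _ _) cf_monom => /negPf ->; rewrite mul0r.
Qed.

Lemma ct_monomM x a b : ct (monom x a * b) = x * cf (- a) b.
Proof. by rewrite /ct cf_monomM sub0r. Qed.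

Lemma ct_nondeg (a b : lser) : (forall g, ct (g * a) = ct (g * b)) -> a = b.
Proof.
move=> e; apply: cfP => m; have := e (monom 1 (- m)).
by rewrite !ct_monomM !mul1r opprK.
Qed.

End LaurentSeries.

Arguments cf : simpl never.
Arguments ct : simpl never.
Arguments mult : simpl never.
Arguments monom : simpl never.
Arguments smul : simpl never.

(** * Dilations z -> q^w z and interpolation of Laurent series *)

Section QShift.
Context (R : realType) (lnq : R[i]).
Local Notation C := R[i].
Local Notation lser := (lser R).
Local Notation qexp := (qexp lnq).
Local Notation A0 := (A0 lnq).

Definition hK (w : C) (a : lser) : lser := mult (fun m => qexp w ^ m) a.

Lemma lval_hK w a : lval (hK w a) = hs lnq w (lval a).
Proof. by apply/funext => m; rewrite -/(cf m _) cf_mult /hs qexpE. Qed.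

Lemma cf_hK m w a : cf m (hK w a) = qexp w ^ m * cf m a.
Proof. exact: cf_mult. Qed.

Lemma hK_is_linear w : linear (hK w).
Proof. exact: mult_is_linear. Qed.
HB.instance Definition _ w := GRing.isLinear.Build C lser lser _ (hK w) (hK_is_linear w).

Lemma vbound_hK M w (a : lser) : vbound M (lval a) -> vbound M (lval (hK w a)).
Proof. exact: vbound_mult. Qed.

Lemma hK_is_monoid_morphism w : monoid_morphism (hK w).
Proof.
split=> [|a b]; apply: cfP => m.
  by rewrite cf_hK cf1; case: eqP => [->|_]; rewrite ?expr0z ?mulr1 ?mulr0.
case: (lvalP a) => Ma va; case: (lvalP b) => Mb vb.
rewrite cf_hK (cfM_window _ (vbound_hK w va) (vbound_hK w vb)).
rewrite (cfM_window _ va vb) mulr_sumr; apply: eq_bigr => k _.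
rewrite !cf_hK mulrACA -expfzDr ?qexp_neq0 //.
by rewrite (_ : k + (m - k) = m) //; lia.
Qed.
HB.instance Definition _ w :=
  GRing.isMonoidMorphism.Build lser lser (hK w) (hK_is_monoid_morphism w).

Arguments hK : simpl never.

Lemma hKD w v a : hK w (hK v a) = hK (w + v) a.
Proof. by apply: cfP => m; rewrite !cf_hK qexpD expfzMl mulrA. Qed.

Lemma hK0 a : hK 0 a = a.
Proof. by apply: cfP => m; rewrite cf_hK qexp0 exp1rz mul1r. Qed.

Lemma hKK w : cancel (hK w) (hK (- w)).
Proof. by move=> a; rewrite hKD addNr hK0. Qed.

Lemma hKVK w : cancel (hK (- w)) (hK w).
Proof. by move=> a; rewrite hKD subrr hK0. Qed.

Lemma hK_eq0 w a : hK w a = 0 -> a = 0.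
Proof. by move=> a0; rewrite -[a](hKK w) a0 raddf0. Qed.

Lemma ct_hK w a : ct (hK w a) = ct a.
Proof. by rewrite /ct cf_hK expr0z mul1r. Qed.

Lemma ct_hKM w (a b : lser) : ct (hK w a * b) = ct (a * hK (- w) b).
Proof. by rewrite -[LHS](ct_hK (- w)) rmorphM /= hKK. Qed.

Lemma hK_monom w x a : hK w (monom x a) = monom (qexp w ^ a * x) a.
Proof.
apply: cfP => m; rewrite cf_hK !cf_monom.
by case: eqP => [->|_]; rewrite ?mulr0.
Qed.

(** The bound on the powers of z is uniform in w because an element of [Lgl_q] has one such bound
    along each whole diagonal. *)
Definition A0K (F : C -> lser) : Prop :=
  (exists M, forall w, vbound M (lval (F w))) /\ forall m, A0 (fun w => cf m (F w)).

Lemma A0K_cst a : A0K (fun=> a).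
Proof.
split; first by case: (lvalP a) => M va; exists M.
by move=> m; apply: A0_const.
Qed.

Lemma A0K_add F G : A0K F -> A0K G -> A0K (fun w => F w + G w).
Proof.
move=> [[M vF] FA] [[M' vG] GA]; split.
  exists (Num.max M M') => w m; rewrite gt_max => /andP[/vF Fm /vG Gm].
  by change (lval (F w) m + lval (G w) m = 0); rewrite Fm Gm addr0.
by move=> m; exact: (A0_add (FA m) (GA m)).
Qed.

Lemma A0K_mult c F : A0K F -> A0K (fun w => mult c (F w)).
Proof.
move=> [[M vF] FA]; split.
  by exists M => w; apply: vbound_mult.
by move=> m; under eq_fun do rewrite cf_mult; apply: (A0_scale (c m) (FA m)).
Qed.

Lemma A0K_hK v F : A0K F -> A0K (fun w => hK v (F w)).
Proof. exact: A0K_mult. Qed.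

Lemma A0K_opp F : A0K F -> A0K (fun w => - F w).
Proof.
move=> /(A0K_mult (fun=> -1)).
rewrite (_ : (fun w => _) = fun w => - F w) //; apply/funext => w.
by apply: cfP => m; rewrite cf_mult mulN1r raddfN.
Qed.

Lemma A0K_mul F G : A0K F -> A0K G -> A0K (fun w => F w * G w).
Proof.
move=> [[M vF] FA] [[M' vG] GA]; split.
  by exists (M + M') => w; rewrite lvalM; apply: smul_vbound.
move=> m; under eq_fun do rewrite (cfM_window m (vF _) (vG _)).
by apply: A0_sum => k _; apply: A0_mul.
Qed.

Lemma A0K_sum I (r : seq I) (P : pred I) (F : I -> C -> lser) :
  (forall i, P i -> A0K (F i)) -> A0K (fun w => \sum_(i <- r | P i) F i w).
Proof.
move=> FA; elim: r => [|i r IH].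
  by under eq_fun do rewrite big_nil; apply: A0K_cst.
under eq_fun do rewrite big_cons.
by case Pi: (P i) => //; apply: A0K_add => //; apply: FA.
Qed.

Lemma A0K_shift F c : A0K F -> A0K (fun w => F (w + c)).
Proof.
move=> [[M vF] FA]; split; first by exists M => w; apply: vF.
by move=> m; apply: (A0_shift c (FA m)).
Qed.

Lemma A0K_hKN a : A0K (fun w => hK (- w) a).
Proof.
split; first by case: (lvalP a) => M va; exists M => w; apply: vbound_hK.
move=> m; under eq_fun do rewrite cf_hK qexpN exprz_inv mulrC.
by apply/A0_scale/A0_qexpX.
Qed.

Lemma A0K_ct F : A0K F -> A0 (fun w => ct (F w)).
Proof. by move=> [_ FA]; exact: (FA 0). Qed.

Hypothesis q_ru : forall k, (0 < k)%N -> qexp 1 ^+ k != 1.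

Lemma A0K_uniq F G N : A0K F -> A0K G ->
  (forall n, (N <= n)%N -> F n%:R = G n%:R) -> F = G.
Proof.
move=> [_ FA] [_ GA] FG; apply/funext => w; apply: cfP => m.
have e : (fun w => cf m (F w)) = (fun w => cf m (G w)).
  by apply: (A0_uniq q_ru (FA m) (GA m)) => n /FG ->.
exact: (congr1 (fun f => f w) e).
Qed.

(** The equation is solved coefficient by coefficient, h^-1 acting on z^m by q^(-m). Above the
    bounds of [F] and [a] the zero solution is chosen, which keeps the bound on powers of z
    uniform. *)
Lemma A0K_diff_solve F (w0 : C) a : A0K F ->
  exists G, [/\ A0K G, forall w, G (w + 1) = hK (- 1) (G w) + F w & G w0 = a].
Proof.
move=> [[M vF] FA]; case: (lvalP a) => M' va.
pose good m (g : C -> C) := [/\ A0 g,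
  forall w, g (w + 1) = qexp (- 1) ^ m * g w + cf m (F w), g w0 = cf m a &
  Num.max M M' < m -> g = fun=> 0].
have /choice[g gP] m : exists g, good m g.
  have [mM|mM] := ltP (Num.max M M') m.
    exists (fun=> 0); split => //; first exact: A0_const.
      by move=> w; move: mM; rewrite gt_max => /andP[/vF Fm _]; rewrite /cf Fm mulr0 addr0.
    by move: mM; rewrite gt_max => /andP[_ /va].
  have [g [gA gE g0]] := A0_diff_solve (- m) w0 (cf m a) (FA m).
  exists g; split => // [w|]; last by rewrite ltNge mM.
  by rewrite gE qexpN exprz_inv.
have lG w : laurent (fun m => g m w).
  by exists (Num.max M M') => m mM; case: (gP m) => _ _ _ ->.
exists (fun w => mkl (lG w)); split.
- split; last by move=> m; case: (gP m).
  by exists (Num.max M M') => w m mM; change (g m w = 0); case: (gP m) => _ _ _ ->.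
- move=> w; apply: cfP => m; rewrite raddfD /= cf_hK.
  by case: (gP m) => _ + _ _; apply.
- by apply: cfP => m; case: (gP m).
Qed.

End QShift.

Arguments hK : simpl never.

(** * Matrices over Laurent series *)

Section MatrixAlgebra.
Context (R : realType) (lnq lam : R[i]).
Local Notation C := R[i].
Local Notation lser := (lser R).
Local Notation A0K := (A0K lnq).

Definition kmat := nat -> nat -> lser.

Definition diag_data (N : nat) (n : int) (X : kmat) (F : C -> lser) :=
  [/\ A0K F,
      forall i j : nat, (N < i)%N -> j%:Z = i%:Z + n -> X i j = F i%:R
    & forall k : nat, (0 < k)%N -> k%:Z <= n -> F (lam - k%:R) = 0].

Definition isLN (b N : nat) (X : kmat) :=
  (forall i j : nat, (j + b < i)%N -> X i j = 0) /\
  forall n, exists F, diag_data N n X F.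

(* The image of Lgl_q under t = lam does not depend on the lifts: a lift of an
   entry F(i) on the n-th diagonal is F(i + lam - t), and it satisfies the third
   condition of gl_q exactly when F(lam - 1) = ... = F(lam - n) = 0. *)
Definition isL (X : kmat) := exists b N, isLN b N X.

Lemma isLN_mono b b' N N' X : (b <= b')%N -> (N <= N')%N -> isLN b N X -> isLN b' N' X.
Proof.
move=> bb NN [Xb XF]; split=> [i j ij|n]; first by apply: Xb; lia.
have [F [FA FE F0]] := XF n; exists F; split => // i j Ni ij.
by apply: FE => //; lia.
Qed.

Lemma isL_common X Y : isL X -> isL Y -> exists b N, isLN b N X /\ isLN b N Y.
Proof.
move=> [b [N XL]] [b' [N' YL]]; exists (maxn b b'), (maxn N N').
by split; [apply: isLN_mono XL | apply: isLN_mono YL]; rewrite ?leq_maxl ?leq_maxr.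
Qed.

Lemma isLN_add b N X Y : isLN b N X -> isLN b N Y -> isLN b N (X + Y).
Proof.
move=> [Xb XF] [Yb YF]; split=> [i j ij|n]; first by rewrite !fctE Xb // Yb // addr0.
have [F [FA FE F0]] := XF n; have [G [GA GE G0]] := YF n.
exists (fun w => F w + G w); split; first exact: A0K_add.
  by move=> i j Ni ij; rewrite !fctE (FE i j) // (GE i j).
by move=> k k0 kn; rewrite F0 // G0 // addr0.
Qed.

Lemma isLN_map b N X (c : int -> C) : isLN b N X ->
  isLN b N (fun i j => mult c (X i j)).
Proof.
move=> [Xb XF]; split=> [i j ij|n]; first by rewrite Xb // raddf0.
have [F [FA FE F0]] := XF n.
exists (fun w => mult c (F w)); split; first exact: A0K_mult.
  by move=> i j Ni ij; rewrite (FE i j).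
by move=> k k0 kn; rewrite F0 // raddf0.
Qed.

Lemma isLN_0 b N : isLN b N 0.
Proof.
split=> // n; exists (fun=> 0); split => //; exact: A0K_cst.
Qed.

(* The regularity bound of a product only grows with the number of
   subdiagonals of the left factor; it is constant along the powers of an upper
   triangular matrix. *)
Definition kmul (X Y : kmat) : kmat :=
  fun i j => \sum_(k \in [set: nat]%classic) X i k * Y k j.

Lemma kmulE (X Y : kmat) i j B :
  (forall k, (B <= k)%N -> Y k j = 0) -> kmul X Y i j = \sum_(k < B) X i k * Y k j.
Proof.
move=> Y0; rewrite /kmul (@fsum_seq _ _ (iota 0 B)) ?iota_uniq //.
  by rewrite -(big_mkord xpredT (fun k => X i k * Y k j)) /index_iota subn0.
by move=> k; rewrite mem_iota => kB; rewrite Y0 ?mulr0 //; lia.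
Qed.

Lemma kmul_band (X Y : kmat) b1 N1 b2 N2 i j : isLN b1 N1 X -> isLN b2 N2 Y ->
  (j + (b1 + b2) < i)%N -> kmul X Y i j = 0.
Proof.
move=> [Xb _] [Yb _] ij; rewrite (@kmulE _ _ _ _ (j + b2).+1).
  by rewrite big1 // => -[k kB] _ /=; rewrite Xb ?mul0r //; lia.
by move=> k kj; rewrite Yb.
Qed.

Lemma isLN_mul b1 N1 X b2 N2 Y : isLN b1 N1 X -> isLN b2 N2 Y ->
  isLN (b1 + b2) (maxn N1 (N2 + b1)) (kmul X Y).
Proof.
move=> hX hY; split=> [i j|n]; first exact: kmul_band hX hY.
have [n_small|n_big] := ltP (n + (b1 + b2)%:Z) 0.
  exists (fun=> 0); split => //; first exact: A0K_cst.
  by move=> i j Ni ij; apply: (kmul_band hX hY); lia.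
case: hX hY => [Xb /choice[FX hFX]] [Yb /choice[FY hFY]].
(* The intermediate index is i + [o l], with [o l] running from -b1 (the band of X) to n + b2 (the
   band of Y). *)
pose L := (absz (n + (b1 + b2)%:Z)%R).+1.
pose o (l : nat) : int := l%:Z - b1%:Z.
exists (fun w => \sum_(l < L) FX (o l) w * FY (n - o l) (w + (o l)%:~R)); split.
- apply: A0K_sum => l _; apply: A0K_mul; first by case: (hFX (o l)).
  by apply: A0K_shift; case: (hFY (n - o l)).
- move=> i j; rewrite gtn_max => /andP[N1i N2i] ij.
  rewrite (@kmulE _ _ _ _ (j + b2).+1); last by move=> k kj; rewrite Yb.
  rewrite -(big_mkord xpredT (fun k => X i k * Y k j)).
  rewrite (@big_cat_nat _ _ _ (i - b1)) //=; try lia.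
  rewrite big1_seq ?add0r; last first.
    by move=> k /andP[_]; rewrite mem_index_iota => ki; rewrite Xb ?mul0r //; lia.
  rewrite -{1}[(i - b1)%N]add0n big_addn.
  rewrite (_ : _ - _ = L)%N; last by rewrite /L; lia.
  rewrite big_mkord; apply: eq_bigr => -[l lL] _ /=.
  have [_ XE _] := hFX (o l); rewrite XE //; last by rewrite /o; lia.
  have [_ YE _] := hFY (n - o l); rewrite YE; try by rewrite /o; lia.
  congr (_ * FY _ _); rewrite -[(_ + _)%N%:R]/((l + (i - b1))%N%:~R).
  by rewrite -[i%:R]/(i%:~R) -intrD; congr _%:~R; rewrite /o; lia.
(* At lam - k, either k <= [o l] and the left factor vanishes, or the right factor is evaluated at
   lam - (k - [o l]), which is among its zeros because 0 < k - [o l] <= n - [o l]. *)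
- move=> k k0 kn; apply: big1 => -[l lL] _ /=.
  have [kl|lk] := leP k%:Z (o l).
    have [_ _ F0] := hFX (o l); rewrite F0 ?mul0r //; lia.
  have [_ _ G0] := hFY (n - o l).
  rewrite (_ : lam - _ + _ = lam - (absz (k%:Z - o l))%:R); last first.
    rewrite -addrA; congr (_ + _); rewrite -[k%:R]/(k%:~R) -[RHS]mulrN1z.
    rewrite -[(absz _)%:R]/((absz _)%:~R) -intrN -intrD -mulrzA; congr _%:~R; lia.
  by rewrite G0 ?mulr0 //; lia.
Qed.

Lemma isL_mul X Y : isL X -> isL Y -> isL (kmul X Y).
Proof. by move=> [b [N hX]] [b' [N' hY]]; do 2 eexists; apply: isLN_mul hX hY. Qed.

Definition kone : kmat := fun i j => (i == j)%:R.

Lemma isLN_one : isLN 0 0 kone.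
Proof.
split=> [i j ij|n]; first by rewrite /kone gtn_eqF //; lia.
exists (fun=> (n == 0)%:R); split; first exact: A0K_cst.
  by move=> i j _ ij; rewrite /kone; congr _%:R; apply/eqP/eqP; lia.
by move=> k k0 kn; rewrite gt_eqF //; lia.
Qed.

Lemma kmulA X Y Z : isL X -> isL Y -> isL Z -> kmul X (kmul Y Z) = kmul (kmul X Y) Z.
Proof.
move=> _ [b2 [N2 hY]] [b3 [N3 hZ]]; apply/funext => i; apply/funext => j.
have [Yb _] := hY; have [Zb _] := hZ; pose B := (j + b3).+1; pose B' := (B + b2).+1.
rewrite (@kmulE _ _ _ _ B'); last by move=> k kB; apply: (kmul_band hY hZ); lia.
rewrite (@kmulE _ _ _ _ B); last by move=> k kB; apply: Zb.
under eq_bigr => k _.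
  rewrite (@kmulE _ _ _ _ B); last by move=> l lB; apply: Zb.
  rewrite mulr_sumr; over.
rewrite exchange_big; apply: eq_bigr => -[l lB] _ /=.
rewrite (@kmulE _ _ _ _ B') ?mulr_suml; last by move=> k kB; apply: Yb; lia.
by apply: eq_bigr => k _; rewrite mulrA.
Qed.

Lemma kmul1 X : isL X -> kmul kone X = X.
Proof.
move=> [b [N [Xb _]]]; apply/funext => i; apply/funext => j.
rewrite (@kmulE _ _ _ _ (i + j + b).+1) => [|k kB]; last by apply: Xb; lia.
have iB : (i < (i + j + b).+1)%N by lia.
rewrite (bigD1 (Ordinal iB)) //= /kone eqxx mul1r big1 ?addr0 // => k /negPf ki.
by rewrite (_ : i == k = false) ?mul0r //; apply/eqP => ik; move/eqP: ki; apply; apply: val_inj.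
Qed.

Lemma kmulr1 X : kmul X kone = X.
Proof.
apply/funext => i; apply/funext => j.
rewrite (@kmulE _ _ _ _ j.+1) => [|k kB]; last by rewrite /kone gtn_eqF.
rewrite big_ord_recr /= /kone eqxx mulr1 big1 ?add0r // => -[k kj] _ /=.
by rewrite ltn_eqF ?mulr0.
Qed.

Lemma kmulDl X Y Z : isL Z -> kmul (X + Y) Z = kmul X Z + kmul Y Z.
Proof.
move=> [b [N [Zb _]]]; apply/funext => i; apply/funext => j.
rewrite !fctE !(@kmulE _ _ _ _ (j + b).+1) //; try by move=> k kB; apply: Zb.
by rewrite -big_split; apply: eq_bigr => k _; rewrite !fctE mulrDl.
Qed.

Lemma kmulDr X Y Z : isL Y -> isL Z -> kmul X (Y + Z) = kmul X Y + kmul X Z.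
Proof.
move=> hY hZ; have [b [N [[Yb _] [Zb _]]]] := isL_common hY hZ.
apply/funext => i; apply/funext => j.
rewrite !fctE !(@kmulE _ _ _ _ (j + b).+1); try by move=> k kB; rewrite ?fctE ?Yb ?Zb ?addr0.
by rewrite -big_split; apply: eq_bigr => k _; rewrite !fctE mulrDr.
Qed.

Lemma kmulZl c X Y : isL Y -> kmul (c *: X) Y = c *: kmul X Y.
Proof.
move=> [b [N [Yb _]]]; apply/funext => i; apply/funext => j.
rewrite !fctE !(@kmulE _ _ _ _ (j + b).+1) //; try by move=> k kB; apply: Yb.
by rewrite scaler_sumr; apply: eq_bigr => k _; rewrite !fctE scalerAl.
Qed.

Lemma kmulZr c X Y : isL Y -> kmul X (c *: Y) = c *: kmul X Y.
Proof.
move=> [b [N [Yb _]]]; apply/funext => i; apply/funext => j.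
rewrite !fctE !(@kmulE _ _ _ _ (j + b).+1) //.
- by rewrite scaler_sumr; apply: eq_bigr => k _; rewrite !fctE scalerAr.
- by move=> k kB; apply: Yb.
- by move=> k kB; rewrite !fctE Yb ?scaler0.
Qed.

Definition isLb : {pred kmat} := fun X => `[< isL X >].

Lemma isLb_closed : subsemimod_closed isLb.
Proof.
split; first split.
- by apply/asboolP; exists 0, 0; apply: isLN_0.
- move=> X Y /asboolP hX /asboolP hY; apply/asboolP.
  by have [b [N [? ?]]] := isL_common hX hY; exists b, N; apply: isLN_add.
- move=> c X /asboolP [b [N hX]]; apply/asboolP; exists b, N.
  rewrite (_ : c *: X = fun i j => mult (fun=> c) (X i j)); first exact: isLN_map.
  by apply/funext => i; apply/funext => j; apply: cfP => m; rewrite cf_mult.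
Qed.

HB.instance Definition _ := GRing.isSubmodClosed.Build C kmat isLb isLb_closed.

Record Lmat := MkLmat {lm : kmat; _ : isLb lm}.
Definition lmf (x : Lmat) : nat -> nat -> lser := lm x.
Coercion lmf : Lmat >-> Funclass.
HB.instance Definition _ := [isSub for lm].
HB.instance Definition _ := [Choice of Lmat by <:].
HB.instance Definition _ := [SubChoice_isSubLmodule of Lmat by <:].

Lemma lmP (x : Lmat) : isL (lmf x).
Proof. by case: x => x hx; apply/asboolP. Qed.

Definition mkL (X : kmat) (hX : isL X) : Lmat := MkLmat (introT (asboolP _) hX).

Lemma ent_mkL (X : kmat) (hX : isL X) i j : mkL hX i j = X i j. Proof. by []. Qed.

Lemma LmatP (x y : Lmat) : (forall i j, x i j = y i j) -> x = y.
Proof. by move=> e; apply: val_inj; apply/funext => i; apply/funext => j; apply: e. Qed.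

Fact Lmul_key : {m : Lmat -> Lmat -> Lmat | forall x y, lm (m x y) = kmul (lm x) (lm y)}.
Proof. by exists (fun x y => mkL (isL_mul (lmP x) (lmP y))). Qed.
Definition Lmul : Lmat -> Lmat -> Lmat := sval Lmul_key.
Lemma LmulE x y : lm (Lmul x y) = kmul (lm x) (lm y).
Proof. exact: (svalP Lmul_key). Qed.
Lemma isL_one : isL kone. Proof. by exists 0, 0; apply: isLN_one. Qed.
Definition Lone : Lmat := mkL isL_one.

Lemma LmulA : associative Lmul.
Proof. by move=> x y z; apply: val_inj; rewrite /= !LmulE; apply: kmulA; apply: lmP. Qed.
Lemma Lmul1 : left_id Lone Lmul.
Proof. by move=> x; apply: val_inj; rewrite /= LmulE; apply: kmul1; apply: lmP. Qed.
Lemma Lmulr1 : right_id Lone Lmul.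
Proof. by move=> x; apply: val_inj; rewrite /= LmulE; apply: kmulr1. Qed.
Lemma LmulDl : left_distributive Lmul +%R.
Proof. by move=> x y z; apply: val_inj; rewrite /= !LmulE; apply: kmulDl; apply: lmP. Qed.
Lemma LmulDr : right_distributive Lmul +%R.
Proof. by move=> x y z; apply: val_inj; rewrite /= !LmulE; apply: kmulDr; apply: lmP. Qed.
Lemma Lone_neq0 : Lone != 0.
Proof.
apply/eqP => /(congr1 (fun x : Lmat => x 0%N 0%N)).
by move/eqP; rewrite /= /kone eqxx oner_eq0.
Qed.

HB.instance Definition _ :=
  GRing.Zmodule_isNzRing.Build Lmat LmulA Lmul1 Lmulr1 LmulDl LmulDr Lone_neq0.

Lemma LscaleAl (c : C) (x y : Lmat) : c *: (x * y) = c *: x * y.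
Proof. by apply: val_inj; rewrite /= !LmulE; apply/esym/kmulZl/lmP. Qed.
HB.instance Definition _ := GRing.Lmodule_isLalgebra.Build C Lmat LscaleAl.
Lemma LscaleAr (c : C) (x y : Lmat) : c *: (x * y) = x * (c *: y).
Proof. by apply: val_inj; rewrite /= !LmulE; apply/esym/kmulZr/lmP. Qed.
HB.instance Definition _ := GRing.Lalgebra_isAlgebra.Build C Lmat LscaleAr.

Definition ent (i j : nat) (x : Lmat) : lser := x i j.
Lemma ent_is_linear i j : linear (ent i j). Proof. by []. Qed.
HB.instance Definition _ i j :=
  GRing.isLinear.Build C Lmat lser _ (ent i j) (ent_is_linear i j).

Lemma entD (x y : Lmat) i j : (x + y) i j = x i j + y i j. Proof. by []. Qed.

Lemma entB (x y : Lmat) i j : (x - y) i j = x i j - y i j. Proof. by []. Qed.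
Lemma entZ c (x : Lmat) i j : (c *: x) i j = c *: x i j. Proof. by []. Qed.

Lemma ent1 i j : (1 : Lmat) i j = (i == j)%:R. Proof. by []. Qed.

Lemma entM (x y : Lmat) i j B : (forall k, (B <= k)%N -> y k j = 0) ->
  (x * y) i j = \sum_(k < B) x i k * y k j.
Proof. by move=> y0; rewrite /lmf LmulE; apply: kmulE. Qed.

Lemma isLN_lmul b1 N1 (x : Lmat) b2 N2 (y : Lmat) : isLN b1 N1 (lmf x) ->
  isLN b2 N2 (lmf y) -> isLN (b1 + b2) (maxn N1 (N2 + b1)) (lmf (x * y)).
Proof. by move=> hx hy; rewrite /lmf LmulE; apply: isLN_mul. Qed.

Lemma Lband (x : Lmat) : exists b, forall i j, (j + b < i)%N -> x i j = 0.
Proof. by have [b [N [xb _]]] := lmP x; exists b. Qed.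

End MatrixAlgebra.

Arguments lmf : simpl never.
Arguments mkL : simpl never.
Arguments kmul : simpl never.

(** * The interpolated trace and its cyclicity *)

Section MatrixTrace.
Context (R : realType) (lnq lam : R[i]).
Local Notation C := R[i].
Local Notation lser := (lser R).
Local Notation A0 := (A0 lnq).
Local Notation A0K := (A0K lnq).
Local Notation hK := (hK lnq).
Local Notation Lmat := (Lmat lnq lam).
Local Notation isL := (isL lnq lam).

Lemma isL_hM w (x : Lmat) : isL (fun i j => hK w (x i j)).
Proof. by have [b [N hx]] := lmP x; exists b, N; apply: isLN_map. Qed.
Fact hM_key : {m : C -> Lmat -> Lmat | forall w x i j, m w x i j = hK w (x i j)}.
Proof. by exists (fun w x => mkL (isL_hM w x)). Qed.
Definition hM : C -> Lmat -> Lmat := sval hM_key.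

Lemma ent_hM w x i j : hM w x i j = hK w (x i j).
Proof. exact: (svalP hM_key). Qed.

Lemma hM_is_linear w : linear (hM w).
Proof. by move=> c x y; apply: LmatP => i j; rewrite !(entD, entZ, ent_hM) linearP. Qed.
HB.instance Definition _ w := GRing.isLinear.Build C Lmat Lmat _ (hM w) (hM_is_linear w).

Lemma hM_is_monoid_morphism w : monoid_morphism (hM w).
Proof.
split=> [|x y]; apply: LmatP => i j.
  by rewrite ent_hM !ent1 rmorph_nat.
have [b yb] := Lband y.
rewrite ent_hM !(@entM _ _ _ _ _ _ _ (j + b).+1) ?rmorph_sum /=.
- by apply: eq_bigr => k _; rewrite !ent_hM rmorphM.
- by move=> k kB; rewrite ent_hM yb ?raddf0.
- by move=> k kB; rewrite yb.
Qed.
HB.instance Definition _ w :=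
  GRing.isMonoidMorphism.Build Lmat Lmat (hM w) (hM_is_monoid_morphism w).

Lemma hM_add w x y : hM w (x + y) = hM w x + hM w y. Proof. exact: raddfD. Qed.
Lemma hM_sub w x y : hM w (x - y) = hM w x - hM w y. Proof. exact: raddfB. Qed.
Lemma hM_scale w c x : hM w (c *: x) = c *: hM w x. Proof. exact: linearZ. Qed.
Lemma hM_mul w x y : hM w (x * y) = hM w x * hM w y. Proof. exact: rmorphM. Qed.

Lemma hMD w v x : hM w (hM v x) = hM (w + v) x.
Proof. by apply: LmatP => i j; rewrite !ent_hM hKD. Qed.
Lemma hM0 x : hM 0 x = x.
Proof. by apply: LmatP => i j; rewrite !ent_hM hK0. Qed.

Lemma hMVK w : cancel (hM (- w)) (hM w).
Proof. by move=> x; rewrite hMD subrr hM0. Qed.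

Lemma isL_dmask (P : int -> bool) (x : Lmat) :
  isL (fun i j => if P (j%:Z - i%:Z) then x i j else 0).
Proof.
have [b [N [xb xF]]] := lmP x; exists b, N; split=> [i j ij|n].
  by case: ifP => // _; apply: xb.
have [F [FA FE F0]] := xF n; exists (fun w => if P n then F w else 0).
case Pn: (P n); split => //.
- move=> i j Ni ij; rewrite (_ : _ - _ = n) ?Pn; last by lia.
  exact: FE.
- exact: A0K_cst.
- by move=> i j Ni ij; rewrite (_ : _ - _ = n) ?Pn //; lia.
Qed.
Fact dmask_key : {m : (int -> bool) -> Lmat -> Lmat |
  forall P x i j, m P x i j = if P (j%:Z - i%:Z) then x i j else 0}.
Proof. by exists (fun P x => mkL (isL_dmask P x)). Qed.
Definition dmask : (int -> bool) -> Lmat -> Lmat := sval dmask_key.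

Lemma ent_dmask P x i j : dmask P x i j = if P (j%:Z - i%:Z) then x i j else 0.
Proof. exact: (svalP dmask_key). Qed.

Lemma dmask_is_linear P : linear (dmask P).
Proof.
move=> c x y; apply: LmatP => i j; rewrite !(entD, entZ, ent_dmask).
by case: ifP => // _; rewrite scaler0 addr0.
Qed.
HB.instance Definition _ P :=
  GRing.isLinear.Build C Lmat Lmat _ (dmask P) (dmask_is_linear P).

Lemma dmask_sub P x y : dmask P (x - y) = dmask P x - dmask P y. Proof. exact: raddfB. Qed.

Definition Pu := dmask (fun n => 0 < n).
Definition Pl := dmask (fun n => n < 0).
Definition Pd := dmask (fun n => n == 0).

Lemma ent_Pu x i j : Pu x i j = if (i < j)%N then x i j else 0.
Proof. by rewrite ent_dmask; congr (if _ then _ else _); apply/idP/idP; lia. Qed.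
Lemma ent_Pl x i j : Pl x i j = if (j < i)%N then x i j else 0.
Proof. by rewrite ent_dmask; congr (if _ then _ else _); apply/idP/idP; lia. Qed.
Lemma ent_Pd x i j : Pd x i j = if i == j then x i j else 0.
Proof. by rewrite ent_dmask; congr (if _ then _ else _); apply/idP/idP; lia. Qed.

Lemma Psplit x : x = Pu x + Pd x + Pl x.
Proof.
apply: LmatP => i j; rewrite !entD ent_Pu ent_Pd ent_Pl.
by case: (ltngtP i j); rewrite ?addr0 ?add0r.
Qed.

Lemma hM_dmask w P x : hM w (dmask P x) = dmask P (hM w x).
Proof.
apply: LmatP => i j; rewrite ent_hM !ent_dmask.
by case: ifP => _; rewrite ?ent_hM ?raddf0.
Qed.

Lemma isL_finite_rows (n : nat) (X : kmat R) :
  (forall i j, (n <= i)%N -> X i j = 0) -> isL X.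
Proof.
move=> X0; exists n, n; split=> [i j ij|m]; first by apply: X0; lia.
exists (fun=> 0); split => //; first exact: A0K_cst.
by move=> i j ni _; apply: X0; lia.
Qed.

(** This is the constant term of [mTr], which interpolates every power of z separately. *)
Definition tr (x : Lmat) : C :=
  A0_interp lnq (fun n => \sum_(i < n) ct (x i i)) lam.

Hypothesis q_ru : forall k, (0 < k)%N -> qexp lnq 1 ^+ k != 1.

Lemma A0_interpE s g N w : A0 g -> (forall n, (N <= n)%N -> g n%:R = s n) ->
  A0_interp lnq s w = g w.
Proof.
move=> gA gE; congr (_ w); rewrite /A0_interp; case: xgetP => [f -> [fA [N' fE]]|].
  apply: (A0_uniq q_ru (N := maxn N N') fA gA) => n; rewrite geq_max => /andP[Nn N'n].
  by rewrite fE // gE.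
by move=> /(_ g) []; split => //; exists N.
Qed.

Lemma trE (x : Lmat) g N : A0 g -> (forall n, (N <= n)%N -> g n%:R = \sum_(i < n) ct (x i i)) ->
  tr x = g lam.
Proof. exact: A0_interpE. Qed.

(** Beyond row N the partial sums satisfy s(n + 1) = s(n) + F(n) with F in A_0; the solution with
    the right value at N + 1 interpolates them. *)
Lemma trP (x : Lmat) : exists g N, A0 g /\
  forall n, (N <= n)%N -> g n%:R = \sum_(i < n) ct (x i i).
Proof.
have [b [N [_ xF]]] := lmP x; have [F [FA FE _]] := xF 0.
pose s n := \sum_(i < n) ct (x i i).
have [g [gA gE g0]] := A0_diff_solve 0 (N.+1)%:R (s N.+1) (A0K_ct FA).
exists g, N.+1; split => // n; elim: n => // n IHn.
rewrite leq_eqVlt => /orP[/eqP <- //|Nn].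
rewrite -natr1 gE expr0z mul1r IHn // big_ord_recr /=; congr (_ + ct _).
by rewrite -(FE n n) ?addr0.
Qed.

Lemma tr_is_linear : linear_for *%R tr.
Proof.
move=> c x y; have [f [N [fA fE]]] := trP x; have [g [N' [gA gE]]] := trP y.
rewrite (trE fA fE) (trE gA gE).
apply: (@trE _ (fun w => c * f w + g w) (maxn N N')).
  by apply: A0_add => //; apply: A0_scale.
move=> n; rewrite geq_max => /andP[Nn N'n]; rewrite fE // gE //.
rewrite mulr_sumr -big_split; apply: eq_bigr => i _ /=.
by rewrite entD entZ linearP.
Qed.

Lemma trD (x y : Lmat) : tr (x + y) = tr x + tr y.
Proof. by rewrite -[x]scale1r tr_is_linear mul1r scale1r. Qed.
Lemma tr0 : tr 0 = 0.
Proof. by apply: (addrI (tr 0)); rewrite -trD !addr0. Qed.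
Lemma trZ c (x : Lmat) : tr (c *: x) = c * tr x.
Proof. by rewrite -[c *: x]addr0 tr_is_linear tr0 addr0. Qed.
Lemma trN (x : Lmat) : tr (- x) = - tr x.
Proof. by rewrite -scaleN1r trZ mulN1r. Qed.
Lemma trB (x y : Lmat) : tr (x - y) = tr x - tr y.
Proof. by rewrite trD trN. Qed.
Lemma tr_sum I (r : seq I) (P : pred I) (F : I -> Lmat) :
  tr (\sum_(i <- r | P i) F i) = \sum_(i <- r | P i) tr (F i).
Proof.
elim: r => [|i r IH]; first by rewrite !big_nil tr0.
by rewrite !big_cons; case: (P i); rewrite // trD IH.
Qed.

Lemma tr_ext (x y : Lmat) : (forall i, ct (x i i) = ct (y i i)) -> tr x = tr y.
Proof.
by move=> e; congr (A0_interp _ _ _); apply/funext => n; apply: eq_bigr.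
Qed.

Lemma tr_hM w x : tr (hM w x) = tr x.
Proof. by apply: tr_ext => i; rewrite ent_hM ct_hK. Qed.

(** The partial sums are eventually constant, so the interpolating function is constant and its
    value at lam is an ordinary finite sum. *)
Lemma tr_finite n (x : Lmat) : (forall i, (n <= i)%N -> ct (x i i) = 0) ->
  tr x = \sum_(i < n) ct (x i i).
Proof.
move=> x0; rewrite (@trE _ (fun=> \sum_(i < n) ct (x i i)) n) //; first exact: A0_const.
move=> m nm; rewrite -!(big_mkord xpredT (fun i => ct (x i i))).
rewrite [RHS](@big_cat_nat _ _ _ n) //= [X in _ + X]big1_seq ?addr0 // => i.
by rewrite mem_index_iota => /andP[_ /andP[ni _]]; apply: x0.
Qed.

(* The commutator sum up to n only involves entries X_(n-p, n+s) Y_(n+s, n-p)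
   with 1 <= p <= b, 0 <= s <= b, whose interpolations vanish at n = lam. *)
Lemma trC (x y : Lmat) : tr (x * y) = tr (y * x).
Proof.
apply/eqP; rewrite -subr_eq0 -trB; apply/eqP.
have [b [N [[xb /choice[F hF]] [yb /choice[G hG]]]]] := isL_common (lmP x) (lmP y).
pose T (X Y : int -> C -> lser) p s (w : C) :=
  ct (X (s + p)%N%:Z (w - p%:R) * Y (- (s + p)%N%:Z) (w + s%:R)).
pose g (w : C) := \sum_(p < b) \sum_(s < b.+1) (T F G p.+1 s w - T G F p.+1 s w).
have TA X Y (p s : nat) : (forall n, A0K (X n)) -> (forall n, A0K (Y n)) -> A0 (T X Y p s).
  move=> XA YA; apply: A0K_ct; apply: A0K_mul.
    exact: (A0K_shift (- p%:R) (XA (s + p)%N%:Z)).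
  exact: (A0K_shift s%:R (YA (- (s + p)%N%:Z))).
have FA n : A0K (F n) by case: (hF n).
have GA n : A0K (G n) by case: (hG n).
have gA : A0 g.
  by apply: A0_sum => p _; apply: A0_sum => s _; apply: A0_sub; apply: TA.
rewrite (@trE _ g (N + b + b).+2 gA).
  apply: big1 => -[p pb] _; apply: big1 => -[s sb] _ /=.
  rewrite /T; have [_ _ F0] := hF (s + p.+1)%N%:Z; have [_ _ G0] := hG (s + p.+1)%N%:Z.
  by rewrite F0 ?G0 ?mul0r ?subrr //; lia.
move=> n nN.
(* The part with both indices below n is unchanged when u and v are exchanged; the rest crosses the
   boundary n and, by the band condition, is a sum over a fixed number of indices. *)
have comm (u v : Lmat) : (forall i j : nat, (j + b < i)%N -> u i j = 0) ->
    (forall i j : nat, (j + b < i)%N -> v i j = 0) ->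
    \sum_(i < n) ct ((u * v) i i) =
    \sum_(i < n) \sum_(k < n) ct (u i k * v k i) +
    \sum_(p < b) \sum_(s < b.+1) ct (u (n - p.+1)%N (n + s)%N * v (n + s)%N (n - p.+1)%N).
  move=> ub vb.
  transitivity (\sum_(i < n) (\sum_(k < n) ct (u i k * v k i) +
      \sum_(s < b.+1) ct (u i (n + s)%N * v (n + s)%N i))).
    apply: eq_bigr => -[i iN] _ /=; rewrite (@entM _ _ _ _ _ _ _ (n + b.+1)); last first.
      by move=> k kB; apply: vb; lia.
    by rewrite raddf_sum big_split_ord.
  rewrite big_split /=; congr (_ + _).
  rewrite -(big_mkord xpredT (fun i => \sum_(s < b.+1) ct (u i (n + s)%N * v (n + s)%N i))).
  rewrite (@big_cat_nat _ _ _ (n - b)) //=; try lia.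
  rewrite big1_seq ?add0r; last first.
    move=> i /andP[_]; rewrite mem_index_iota => ib; apply: big1 => s _.
    by rewrite vb ?mulr0 ?raddf0 //; lia.
  rewrite -{1}[(n - b)%N]add0n big_addn (_ : n - (n - b) = b)%N; last by lia.
  rewrite big_mkord (reindex_inj rev_ord_inj); apply: eq_bigr => -[p pb] _ /=.
  by rewrite (_ : b - p.+1 + (n - b) = n - p.+1)%N //; lia.
have -> : \sum_(i < n) ct ((x * y - y * x) i i) =
    \sum_(i < n) ct ((x * y) i i) - \sum_(i < n) ct ((y * x) i i).
  by rewrite -sumrB; apply: eq_bigr => i _; rewrite entB raddfB.
rewrite !comm // exchange_big /=.
rewrite (eq_bigr (fun j : 'I_n => \sum_(i < n) ct (y j i * x i j))); last first.
  by move=> j _; apply: eq_bigr => i _; rewrite mulrC.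
rewrite opprD addrACA subrr add0r /g -sumrB; apply: eq_bigr => -[p pb] _ /=.
rewrite -sumrB; apply: eq_bigr => -[s sb] _ /=; rewrite /T.
have e1 : n%:R - p.+1%:R = (n - p.+1)%N%:R :> C by rewrite natrB //; lia.
have e2 : n%:R + s%:R = (n + s)%N%:R :> C by rewrite natrD.
have dd X u (H : int -> C -> lser) : (forall n, diag_data lnq lam N n X (H n)) ->
    forall i j : nat, (N < i)%N -> j%:Z = i%:Z + u -> H u i%:R = X i j.
  by move=> hH i j Ni ij; have [_ -> ] := hH u.
rewrite e1 e2 !(dd _ _ _ hF (n - p.+1)%N (n + s)%N) ?(dd _ _ _ hG (n + s)%N (n - p.+1)%N);
  try lia.
by rewrite !(dd _ _ _ hG (n - p.+1)%N (n + s)%N) ?(dd _ _ _ hF (n + s)%N (n - p.+1)%N); try lia.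
Qed.

End MatrixTrace.

(** * Comparison of the matrix algebra with the image of [Lgl_q] at t = lambda *)

Section Lifting.
Context (R : realType) (lnq lam : R[i]).
Local Notation C := R[i].
Local Notation lser := (lser R).
Local Notation A0 := (A0 lnq).
Local Notation Lmat := (Lmat lnq lam).
Local Notation isL := (isL lnq lam).

Lemma A0_reflect f c : A0 f -> A0 (fun t => f (c - t)).
Proof.
elim=> [d||||{}f g _ fA _ gA|{}f g _ fA _ gA].
- exact: A0_const.
- by apply: A0_sub; [apply: A0_const | apply: A0_id].
- under eq_fun do rewrite qexpE qexpD.
  by apply: A0_mul; [apply: A0_const | apply: A0_qexpN].
- under eq_fun do rewrite qexpE opprB qexpD.
  by apply: A0_mul; [apply: A0_qexp | apply: A0_const].
- exact: A0_add.
- exact: A0_mul.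
Qed.

(** A tensor as a list of pairs: sums become concatenations and products become lists of all pairs,
    which avoids arithmetic on the ordinals in [A0_two]. *)
Definition A0_sep (f : C -> C -> C) := exists s : seq ((C -> C) * (C -> C)),
  (forall p, p \in s -> A0 p.1 /\ A0 p.2) /\
  forall w t, f w t = \sum_(p <- s) p.1 w * p.2 t.

Lemma A0_sep_two f : A0_sep f -> A0_two lnq f.
Proof.
move=> [s [sA fE]]; exists (size s), (fun k : 'I_(size s) => (nth (id, id) s k).1),
  (fun k : 'I_(size s) => (nth (id, id) s k).2); split.
  by move=> k; apply/sA/mem_nth.
by move=> w t; rewrite fE (big_nth (id, id)) big_mkord.
Qed.

Lemma A0_sep_add f g : A0_sep f -> A0_sep g -> A0_sep (fun w t => f w t + g w t).
Proof.
move=> [s [sA fE]] [s' [sA' gE]]; exists (s ++ s'); split.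
  by move=> p; rewrite mem_cat => /orP[/sA|/sA'].
by move=> w t; rewrite big_cat fE gE.
Qed.

Lemma A0_sep_mul f g : A0_sep f -> A0_sep g -> A0_sep (fun w t => f w t * g w t).
Proof.
move=> [s [sA fE]] [s' [sA' gE]].
exists [seq ((fun w => p.1 w * p'.1 w), (fun t => p.2 t * p'.2 t)) | p <- s, p' <- s'].
split=> [p|w t].
  move=> /allpairsP[[a b] /= [/sA[a1 a2] /sA'[b1 b2] ->]] /=.
  by split; apply: A0_mul.
rewrite fE gE big_allpairs_dep mulr_suml; apply: eq_bigr => p _.
by rewrite mulr_sumr; apply: eq_bigr => p' _ /=; rewrite mulrACA.
Qed.

Lemma A0_sep1 a b : A0 a -> A0 b -> A0_sep (fun w t => a w * b t).
Proof.
move=> aA bA; exists [:: (a, b)]; split; last by move=> w t; rewrite big_seq1.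
by move=> p; rewrite inE => /eqP ->.
Qed.

Lemma A0_sep_diff f c : A0 f -> A0_sep (fun w t => f (w + c - t)).
Proof.
elim=> [d||||{}f g _ fA _ gA|{}f g _ fA _ gA].
- by have := A0_sep1 (A0_const lnq d) (A0_const lnq 1); under eq_fun => w do under eq_fun do rewrite mulr1.
- have h1 := A0_sep1 (A0_add (A0_id lnq) (A0_const lnq c)) (A0_const lnq 1).
  have h2 := A0_sep1 (A0_const lnq 1) (A0_scale (-1) (A0_id lnq)).
  have := A0_sep_add h1 h2.
  by congr A0_sep; apply/funext => w; apply/funext => t; rewrite mulr1 mul1r mulN1r.
- have := A0_sep1 (A0_scale (qexp lnq c) (A0_qexp lnq)) (A0_qexpN lnq).
  by congr A0_sep; apply/funext => w; apply/funext => t; rewrite qexpE !qexpD [X in X * _ = _]mulrC.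
- have := A0_sep1 (A0_scale (qexp lnq (- c)) (A0_qexpN lnq)) (A0_qexp lnq).
  congr A0_sep; apply/funext => w; apply/funext => t.
  by rewrite qexpE opprB opprD !qexpD mulrC (mulrC (qexp lnq (- c))).
- exact: A0_sep_add.
- exact: A0_sep_mul.
Qed.

Lemma A0_two_left f t : A0_two lnq f -> A0 (fun w => f w t).
Proof.
move=> [p [a [b [abA fE]]]]; under eq_fun do rewrite fE.
apply: A0_sum => k _; apply: A0_mul; first by case: (abA k).
exact: A0_const.
Qed.

(** The third condition of gl_q concerns large integer values of t along i = t - k; as an
    A_0-function of t alone, the entry can be continued from there to t = lam. *)
Lemma A0_two_diag f c : A0_two lnq f -> A0 (fun w => f (w + c) w).
Proof.
move=> [p [a [b [abA fE]]]]; under eq_fun do rewrite fE.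
apply: A0_sum => k _; case: (abA k) => aA bA.
by apply: A0_mul => //; apply: A0_shift.
Qed.

Lemma common_vbound n (a : nat -> lser) :
  exists M, forall i, (i < n)%N -> vbound M (lval (a i)).
Proof.
elim: n => [|n [M HM]]; first by exists 0.
case: (lvalP (a n)) => M' vM'; exists (Num.max M M') => i.
rewrite ltnS leq_eqVlt => /orP[/eqP -> m|/HM vi m]; rewrite gt_max => /andP[Mm M'm].
  exact: vM'.
exact: vi.
Qed.

Definition toM (x : Lmat) : mat R := fun i j => lval (x i j).

Lemma toM_inj : injective toM.
Proof.
move=> x y e; apply: LmatP => i j; apply: lval_inj.
exact: (congr1 (fun f => f i j) e).
Qed.

(** The clause on zero diagonals lets one lift serve the upper triangular, diagonal and unipotent
    subsets as well, since these are defined by lifts of the same shape. *)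
Lemma Lgl_lift (x : Lmat) : exists A, [/\ Lgl_q lnq A, toM x = eval_t lam A &
  forall n : int, (forall i j : nat, j%:Z - i%:Z = n -> x i j = 0) ->
  forall i j : nat, j%:Z - i%:Z = n -> A i j = 0].
Proof.
have [b [N [xb xF]]] := lmP x.
have {}xF (n : int) : exists F, diag_data lnq lam N n (lmf x) F /\
    ((forall i j : nat, j%:Z - i%:Z = n -> x i j = 0) -> F = fun=> 0).
  have [z|nz] := pselect (forall i j : nat, j%:Z - i%:Z = n -> x i j = 0).
    exists (fun=> 0); split => //; split => //; first exact: A0K_cst.
    by move=> i j _ ij; apply: z; lia.
  by have [F hF] := xF n; exists F.
have /choice[F hF] := xF.
(* The rows up to N are constant in t, as the interpolation and vanishing conditions only concern
   later rows. *)
pose A : lmat R := fun i j m t => if (i <= N)%N then cf m (x i j)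
  else cf m (F (j%:Z - i%:Z) (i%:R + lam - t)).
have Amode (n : int) : exists M : int, forall m (i j : nat),
    M < m -> j%:Z - i%:Z = n -> A i j m = 0.
  have [M HM] := common_vbound N.+1 (fun i => x i (absz (i%:Z + n)%R)).
  have [[[[M' HM'] _] _ _] _] := hF n.
  exists (Num.max M M') => m i j; rewrite gt_max => /andP[Mm M'm] ij.
  apply/funext => t; rewrite /A; case: leqP => iN; last by rewrite ij; apply: HM'.
  by rewrite (_ : j = absz (i%:Z + n)%R); [apply: HM | lia].
have A0z (n : int) : (forall i j : nat, j%:Z - i%:Z = n -> x i j = 0) ->
    forall i j : nat, j%:Z - i%:Z = n -> A i j = 0.
  move=> z i j ij; apply/funext => m; apply/funext => t.
  rewrite /A ij; case: leqP => iN; first by rewrite z // raddf0.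
  by have [_ ->] := hF n; rewrite ?raddf0.
have Aband (i j : nat) : (j + b < i)%N -> A i j = 0.
  by move=> ij; apply: (A0z (j%:Z - i%:Z)) => // i' j' e; apply: xb; lia.
have AA0 i j m : A0 (A i j m).
  rewrite /A; case: leqP => _; first exact: A0_const.
  have [[[_ /(_ m) FA] _ _] _] := hF (j%:Z - i%:Z).
  exact: (A0_reflect _ FA).
have Areg m : reg_le lnq (maxn b N)%:Z (lcoef A m).
  split.
  - move=> i j ij; rewrite /lcoef Aband //; lia.
  - move=> n _; exists (fun w t => cf m (F n (w + lam - t))).
      have [[[_ /(_ m) FA] _ _] _] := hF n.
      exact/A0_sep_two/(A0_sep_diff lam FA).
    move=> i j Ni ij t; rewrite /lcoef /A ij.
    by rewrite (_ : (i <= N)%N = false) //; lia.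
  - move=> m' i j Nm Ni im mj; rewrite /lcoef /A.
    rewrite (_ : (i <= N)%N = false); last by lia.
    have [[_ _ F0] _] := hF (j%:Z - i%:Z).
    have e : i%:R + lam - m'%:~R = lam - (absz (m' - i%:Z)%R)%:R :> C.
      rewrite -[(absz _)%:R]/((absz _)%:~R) (_ : (absz _)%:Z = m' - i%:Z); last by lia.
      by rewrite intrB -[i%:R]/(i%:~R); ring.
    by rewrite e F0 ?raddf0 //; lia.
exists A; split => //.
- split.
  + split; last first.
      by exists b%:Z => i j ij; apply: Aband; lia.
    move=> i j; split; first exact: AA0.
    have [M HM] := Amode (j%:Z - i%:Z).
    by exists M => m Mm; apply: HM.
  + move=> m; split; last by eexists; apply: Areg.
    split; first by move=> i j; apply: AA0.
    by exists b%:Z => i j ij; rewrite /lcoef Aband //; lia.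
  + by eexists => m; apply: Areg.
  + exact: Amode.
- apply/funext => i; apply/funext => j; apply/funext => m.
  rewrite /eval_t /toM /A; case: leqP => iN //.
  have [[_ FE _] _] := hF (j%:Z - i%:Z).
  by rewrite addrK -(FE i j) //; lia.
Qed.

Hypothesis q_ru : forall k, (0 < k)%N -> qexp lnq 1 ^+ k != 1.

Lemma Lgl_q_eval (A : lmat R) : Lgl_q lnq A -> exists x : Lmat, eval_t lam A = toM x.
Proof.
move=> [[Aent [Nb Aband]] Agl [Nr Areg] Amode].
have lA i j : laurent (eval_t lam A i j).
  have [_ [M HM]] := Aent i j; exists M => m Mm.
  by rewrite /eval_t HM.
pose X : kmat R := fun i j => mkl (lA i j).
suff hX : isL X.
  by exists (mkL hX); apply/funext => i; apply/funext => j.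
exists (absz Nb), (absz Nr); split=> [i j ij|n].
  by apply: lserP => m; rewrite /= /eval_t Aband //; lia.
have [n_small|n_big] := ltP n (- Nr).
  exists (fun=> 0); split => //; first exact: A0K_cst.
  move=> i j Ni ij; apply: lserP => m.
  by have [r1 _ _] := Areg m; have := r1 i j; rewrite /= /eval_t /lcoef => -> //; lia.
have fex m : exists f, A0_two lnq f /\ forall i j : nat, Nr < i%:Z -> j%:Z - i%:Z = n ->
    forall t, A i j m t = f i%:R t.
  by have [_ r2 _] := Areg m; have [f fA fE] := r2 n n_big; exists f.
have /choice[f hf] := fex.
have [M HM] := Amode n.
have lF w : laurent (fun m => if m <= M then f m w lam else 0).
  by exists M => m Mm; rewrite leNgt Mm.
exists (fun w => mkl (lF w)); split.
- split; first by exists M => w m Mm; rewrite /= leNgt Mm.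
  move=> m; rewrite /cf /=; case: leP => _; last exact: A0_const.
  by apply: A0_two_left; case: (hf m).
- move=> i j Ni ij; apply: lserP => m; rewrite /= /eval_t; case: leP => Mm.
    by have [_ ->] := hf m; rewrite //; lia.
  by rewrite HM //; lia.
- move=> k k0 kn; apply: lserP => m; rewrite /=; case: leP => // _.
  have [fA fE] := hf m.
  (* At a large integer w = m' this is the entry in row m' - k < m' and column m' - k + n >= m',
     which the third condition kills; uniqueness of interpolation extends the zero to w = lam. *)
  have e : (fun w => f m (w - k%:R) w) = fun=> 0.
    apply: (A0_uniq q_ru (N := (k + absz Nr).+1) (A0_two_diag (- k%:R) fA) (A0_const lnq 0)).
    move=> m' km; rewrite -natrB; last by lia.
    rewrite -(fE (m' - k)%N (absz ((m' - k)%N%:Z + n)%R)); try lia.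
    have [_ _ r3] := Areg m; have := r3 m'%:Z (m' - k)%N (absz ((m' - k)%N%:Z + n)%R).
    by rewrite /lcoef; apply; lia.
  exact: (congr1 (fun g => g lam) e).
Qed.

Lemma LglP X : Lgl lnq lam X <-> exists x : Lmat, X = toM x.
Proof.
split=> [[A AL ->]|[x ->]]; first exact: Lgl_q_eval.
by have [A [AL xA _]] := Lgl_lift x; exists A.
Qed.

Lemma Lgl_toM x : Lgl lnq lam (toM x). Proof. by apply/LglP; exists x. Qed.

Lemma Lgl_patternP (P : int -> bool) X :
  (exists A, [/\ Lgl_q lnq A, forall i j : nat, P (j%:Z - i%:Z) -> A i j = 0 & X = eval_t lam A])
  <-> exists2 x : Lmat, X = toM x & forall i j : nat, P (j%:Z - i%:Z) -> x i j = 0.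
Proof.
split=> [[A [AL A0 ->]]|[x -> x0]].
  have [x xA] := Lgl_q_eval AL; exists x => // i j /A0 Aij.
  apply: lserP => m; have := congr1 (fun f => f i j m) xA.
  by rewrite /eval_t Aij => e; exact: (esym e).
have [A [AL xA A0]] := Lgl_lift x; exists A; split => // i j Pij.
by apply: (A0 (j%:Z - i%:Z)) => // i' j' e; apply: x0; rewrite e.
Qed.

Lemma Lb_plusP X : Lb_plus lnq lam X <->
  exists2 x : Lmat, X = toM x & forall i j : nat, (j < i)%N -> x i j = 0.
Proof.
have h := Lgl_patternP (fun n => n < 0) X; split.
  move=> [A [AL A0 XA]]; have [h1 _] := h; case: h1.
    by exists A; split => // i j ij; apply: A0; lia.
  by move=> x xX x0; exists x => // i j ij; apply: x0; lia.
move=> [x xX x0]; have [_ h1] := h; case: h1.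
  by exists x => // i j ij; apply: x0; lia.
by move=> A [AL A0 XA]; exists A; split => // i j ij; apply: A0; lia.
Qed.

Lemma LhP X : Lh lnq lam X <->
  exists2 x : Lmat, X = toM x & forall i j : nat, i != j -> x i j = 0.
Proof.
have h := Lgl_patternP (fun n => n != 0) X; split.
  move=> [A [AL A0 XA]]; have [h1 _] := h; case: h1.
    by exists A; split => // i j ij; apply: A0; lia.
  by move=> x xX x0; exists x => // i j ij; apply: x0; lia.
move=> [x xX x0]; have [_ h1] := h; case: h1.
  by exists x => // i j ij; apply: x0; lia.
by move=> A [AL A0 XA]; exists A; split => // i j ij; apply: A0; lia.
Qed.

Lemma toM1 : toM 1 = mone R.
Proof.
apply/funext => i; apply/funext => j; rewrite /toM ent1 /mone.
by case: eqP.
Qed.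

Lemma toMD x y : toM (x + y) = toM x + toM y. Proof. by []. Qed.

Lemma toMB x y : toM (x - y) = toM x - toM y. Proof. by []. Qed.
Lemma toMZ c x : toM (c *: x) = c *: toM x. Proof. by []. Qed.

Lemma LN_plusP X : LN_plus lnq lam X <->
  exists2 x : Lmat, X = toM x & forall i j : nat, (j <= i)%N -> x i j = (i == j)%:R.
Proof.
have h := Lgl_patternP (fun n => n <= 0) (X - mone R); split.
  move=> [A [AL A0 XA]]; have [h1 _] := h; case: h1.
    by exists A; split => [//|i j ij|]; [apply: A0; lia | rewrite XA addrC addKr].
  move=> x xX x0; exists (1 + x); first by rewrite toMD toM1 -xX addrC subrK.
  by move=> i j ij; rewrite entD ent1 x0 ?addr0 //; lia.
move=> [x xX x0]; have [_ h1] := h; case: h1.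
  exists (x - 1); first by rewrite toMB toM1 xX.
  by move=> i j ij; rewrite entB ent1 x0 ?subrr //; lia.
move=> A [AL A0 XA]; exists A; split => // [i j ij|]; first by apply: A0; lia.
by rewrite -XA addrC subrK.
Qed.

Lemma mmul_toM x y : mmul (toM x) (toM y) = toM (x * y).
Proof.
apply/funext => i; apply/funext => j; apply/funext => m.
have [b yb] := Lband y.
rewrite /toM -[RHS]/(cf m ((x * y) i j)) (@entM _ _ _ _ _ _ _ (j + b).+1); last first.
  by move=> k kB; apply: yb.
rewrite /mmul (@fsum_seq _ _ (iota 0 (j + b).+1)) ?iota_uniq //.
  rewrite raddf_sum -(big_mkord xpredT (fun k => cf m (x i k * y k j))).
  by rewrite /index_iota subn0; apply: eq_bigr => k _; rewrite /cf lvalM.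
move=> k; rewrite mem_iota => kB.
by rewrite -lvalM yb ?mulr0 //; lia.
Qed.

Lemma hm_toM w x : hm lnq w (toM x) = toM (hM w x).
Proof. by apply/funext => i; apply/funext => j; rewrite /hm /toM ent_hM lval_hK. Qed.

Lemma Pupper_toM x : Pupper (toM x) = toM (Pu x).
Proof.
apply/funext => i; apply/funext => j; rewrite /Pupper /toM ent_Pu.
by case: ifP.
Qed.
Lemma Plower_toM x : Plower (toM x) = toM (Pl x).
Proof.
apply/funext => i; apply/funext => j; rewrite /Plower /toM ent_Pl.
by case: ifP.
Qed.
Lemma Pdiag_toM x : Pdiag (toM x) = toM (Pd x).
Proof.
apply/funext => i; apply/funext => j; rewrite /Pdiag /toM ent_Pd.
by case: ifP.
Qed.

Lemma inner_toM x y : inner lnq lam (toM x) (toM y) = tr (x * y).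
Proof. by rewrite /inner mmul_toM. Qed.

End Lifting.
Arguments toM : simpl never.

(** Choice by course-of-values recursion: the n-th value may depend on all the earlier ones. In the
    proof, [u n] is a sequence whose values below n are final. *)
Lemma strong_choice (T : Type) (t0 : T) (Q : nat -> (nat -> T) -> T -> Prop) :
  (forall n s s' a, (forall k, (k < n)%N -> s k = s' k) -> Q n s a -> Q n s' a) ->
  (forall n s, exists a, Q n s a) -> exists t, forall n, Q n t (t n).
Proof.
move=> Qloc Qex.
have /choice[f hf] : forall p : nat * (nat -> T), exists a, Q p.1 p.2 a by move=> [n s]; apply: Qex.
pose u := fix u n := if n is m.+1 then fun k => if k == m then f (m, u m) else u m k
  else fun=> t0.
have uE n m k : (k < n)%N -> (n <= m)%N -> u m k = u n k.
  move=> kn; elim: m => [|m IH nm]; first by case: n kn.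
  have [->//|nm'] := eqVneq n m.+1.
  by rewrite /= ltn_eqF ?IH //; lia.
exists (fun n => u n.+1 n) => n; apply: (Qloc n (u n)).
  by move=> k kn; rewrite (uE k.+1 n k).
by rewrite /= eqxx; apply: (hf (n, u n)).
Qed.

(** * Unipotent matrices and reduction to companion form *)

Section Reduction.
Context (R : realType) (lnq lam : R[i]).
Local Notation C := R[i].
Local Notation lser := (lser R).
Local Notation A0K := (A0K lnq).
Local Notation hK := (hK lnq).
Local Notation Lmat := (Lmat lnq lam).
Local Notation isLN := (isLN lnq lam).
Local Notation isL := (isL lnq lam).
Local Notation diag_data := (diag_data lnq lam).

Definition unitri (x : Lmat) := forall i j : nat, (j <= i)%N -> x i j = (i == j)%:R.

Lemma unitri1 : unitri 1.
Proof. by move=> i j _; rewrite ent1. Qed.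

Lemma unitri_hM w x : unitri x -> unitri (hM w x).
Proof. by move=> xu i j ij; rewrite ent_hM xu // rmorph_nat. Qed.

Lemma unitri_mul x y : unitri x -> unitri y -> unitri (x * y).
Proof.
move=> xu yu i j ij.
rewrite (@entM _ _ _ _ _ _ _ j.+1) => [|k kj]; last by rewrite yu ?gtn_eqF // ltnW.
rewrite big_ord_recr /= xu // yu // eqxx mulr1 big1 ?add0r // => -[k kj] _ /=.
by rewrite xu ?gtn_eqF ?mul0r //; lia.
Qed.

Lemma expr_strict (s : Lmat) k : (forall i j : nat, (j <= i)%N -> s i j = 0) ->
  forall i j : nat, (j < i + k)%N -> (s ^+ k) i j = 0.
Proof.
move=> s0; elim: k => [|k IH] i j ij; first by rewrite expr0 ent1 gtn_eqF //; lia.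
rewrite exprS (@entM _ _ _ _ _ _ _ (j + 1)); last by move=> l lj; apply: IH; lia.
apply: big1 => -[l lj] _ /=.
have [il|li] := ltnP i l; first by rewrite IH ?mulr0 //; lia.
by rewrite s0 ?mul0r.
Qed.

(** Neumann series in the strictly upper triangular s = 1 - x. On the n-th diagonal only the powers
    up to n contribute, and all powers of s share one regularity bound, so the sum stays in the
    algebra. *)
Lemma unitri_rinv x : unitri x -> exists y, unitri y /\ x * y = 1.
Proof.
move=> xu; pose s : Lmat := 1 - x.
have s0 i j : (j <= i)%N -> s i j = 0 by move=> ij; rewrite entB ent1 xu // subrr.
have [b [N [_ sF]]] := lmP s.
have sL : isLN 0 N (lmf s).
  by split=> // i j ij; apply: s0; lia.
have sXL k : isLN 0 N (lmf (s ^+ k)).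
  elim: k => [|k IH]; first by rewrite expr0; apply: isLN_mono (isLN_one _ _).
  rewrite exprS; have := isLN_lmul sL IH; apply: isLN_mono; lia.
have sX0 := expr_strict s0.
pose Y : kmat R := fun i j => \sum_(k < (j - i).+1) (s ^+ k) i j.
have YE i j K : (j - i <= K)%N -> Y i j = (\sum_(k < K.+1) s ^+ k) i j.
  move=> jK; rewrite -[RHS]/(ent i j _) raddf_sum /Y.
  rewrite -!(big_mkord xpredT (fun k => (s ^+ k) i j)).
  rewrite [RHS](@big_cat_nat _ _ _ (j - i).+1) //= [X in _ + X]big1_seq ?addr0 //.
  by move=> k; rewrite mem_index_iota => /andP[_ ik]; apply: sX0; lia.
have Y0 i j : (j < i)%N -> Y i j = 0.
  by move=> ji; rewrite (@YE i j 0) ?big_ord1 ?expr0 ?ent1 ?gtn_eqF //; lia.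
have hY : isL Y.
  exists 0, N; split=> [i j ij|n]; first by apply: Y0; lia.
  have [n_neg|n_pos] := ltP n 0.
    exists (fun=> 0); split => //; first exact: A0K_cst.
    by move=> i j _ ij; apply: Y0; lia.
  have /choice[F hF] : forall k, exists F, diag_data N n (lmf (s ^+ k)) F.
    by move=> k; have [_ h] := sXL k; apply: h.
  exists (fun w => \sum_(k < (absz n).+1) F k w); split.
  - by apply: A0K_sum => k _; case: (hF k).
  - move=> i j Ni ij; rewrite /Y (_ : (j - i)%N = absz n); last by lia.
    by apply: eq_bigr => k _; have [_ FE _] := hF k; apply: FE.
  - by move=> k k0 kn; apply: big1 => l _; have [_ _ F0] := hF l; apply: F0.
exists (mkL hY); split.
  move=> i j; rewrite leq_eqVlt => /orP[/eqP ->|ij]; last by rewrite gtn_eqF // ent_mkL Y0.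
  by rewrite ent_mkL (@YE i i 0) ?subnn // big_ord1 expr0 ent1.
apply: LmatP => i j.
rewrite (@entM _ _ _ _ _ _ _ j.+1); last by move=> k kj; rewrite ent_mkL Y0.
have -> : \sum_(k < j.+1) x i k * mkL hY k j = (x * \sum_(k < j.+1) s ^+ k) i j.
  rewrite (@entM _ _ _ _ _ _ _ j.+1) => [|k kj]; last by rewrite -YE ?Y0 //; lia.
  by apply: eq_bigr => k _; rewrite ent_mkL (@YE k j j) ?leq_subr.
(* The geometric sum telescopes to 1 - s^(j+1), and s^(j+1) has no entries in column j. *)
rewrite (_ : x = - (s - 1)); last by rewrite opprB /s subKr.
by rewrite mulNr -subrX1 opprB entB sX0 ?subr0 //; lia.
Qed.

Lemma unitri_inv x : unitri x -> exists y, [/\ unitri y, x * y = 1 & y * x = 1].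
Proof.
move=> /unitri_rinv[y [yu xy]]; exists y; split => //.
have [z [_ yz]] := unitri_rinv yu.
by rewrite (_ : x = z) // -[x]mulr1 -yz mulrA xy mul1r.
Qed.

Definition kcomp (a : nat -> lser) : kmat R :=
  fun i j => if i == 0%N then a j else (i == j.+1)%:R.

Lemma isL_comp a : isL (kcomp a).
Proof.
exists 1, 0; split=> [i j ij|n].
  by rewrite /kcomp !gtn_eqF //; lia.
exists (fun=> (n == -1)%:R); split; first exact: A0K_cst.
  move=> i j i0 ij; rewrite /kcomp (gtn_eqF i0); congr _%:R.
  by apply/eqP/eqP; lia.
by move=> k k0 kn; rewrite gt_eqF //; lia.
Qed.
Fact compan_key : {m : (nat -> lser) -> Lmat | forall a i j, m a i j = kcomp a i j}.
Proof. by exists (fun a => mkL (isL_comp a)). Qed.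
Definition compan : (nat -> lser) -> Lmat := sval compan_key.

Lemma ent_compan a i j : compan a i j = if i == 0%N then a j else (i == j.+1)%:R.
Proof. exact: (svalP compan_key). Qed.

Lemma comp0 a j : compan a 0%N j = a j.
Proof. by rewrite ent_compan. Qed.
Lemma compS a i j : compan a i.+1 j = (i == j)%:R.
Proof. by rewrite ent_compan /= eqSS. Qed.

Lemma comp_mulS a x i j : (compan a * x) i.+1 j = x i j.
Proof.
have [b xb] := Lband x.
rewrite (@entM _ _ _ _ _ _ _ (i + j + b).+1); last by move=> k kB; apply: xb; lia.
have iB : (i < (i + j + b).+1)%N by lia.
rewrite (bigD1 (Ordinal iB)) //= compS eqxx mul1r big1 ?addr0 // => k /negPf ki.
rewrite compS (_ : i == k = false) ?mul0r //.
by apply/eqP => ik; move/eqP: ki; apply; apply: val_inj.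
Qed.

Lemma mul_comp a x i j : (x * compan a) i j = x i 0%N * a j + x i j.+1.
Proof.
rewrite (@entM _ _ _ _ _ _ _ j.+2) => [|k kB].
  rewrite big_ord_recl comp0; congr (_ + _).
  rewrite big_ord_recr /= compS eqxx mulr1 big1 ?add0r // => -[k kj] _ /=.
  by rewrite compS ltn_eqF ?mulr0.
by case: k kB => // k kB; rewrite compS gtn_eqF.
Qed.

Definition hessenberg (M : Lmat) :=
  (forall j, M j.+1 j = 1) /\ forall i j : nat, (j.+1 < i)%N -> M i j = 0.

Lemma hessenberg_comp a : hessenberg (compan a).
Proof.
split=> [j|[|i] j ij //]; rewrite compS ?eqxx //.
by rewrite gtn_eqF.
Qed.

Hypothesis q_ru : forall k, (0 < k)%N -> qexp lnq 1 ^+ k != 1.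

(** [t n] interpolates the n-th superdiagonal of the gauge matrix T. For M with ones below the
    diagonal, the row equation T_i = h(T_{i+1}) M isolates h(t_n(i + 1)), whose other terms involve
    only diagonals l < n; this gives a triangular system of first-order equations. *)
Lemma reduction_diagonals (N : nat) (M : Lmat) (F : int -> C -> lser) :
  (forall n, diag_data N n (lmf M) (F n)) -> exists t : nat -> C -> lser,
  [/\ forall n, A0K (t n), forall w, t 0%N w = 1,
    forall n w, t n (w + 1) = hK (- 1) (t n w)
      - \sum_(l < n) t l (w + 1) * hK (- 1) (F (n.-1%:Z - l%:Z) (w + 1 + l%:R))
  & forall n k : nat, (0 < k <= n)%N -> t n (lam - k%:R) = 0].
Proof.
move=> hF.
pose rec n (s : nat -> C -> lser) w :=
  \sum_(l < n) s l (w + 1) * hK (- 1) (F (n.-1%:Z - l%:Z) (w + 1 + l%:R)).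
pose Q n (s : nat -> C -> lser) (a : C -> lser) :=
  (forall l, (l < n)%N -> A0K (s l)) ->
  [/\ A0K a, forall w, a (w + 1) = hK (- 1) (a w) - rec n s w,
    n = 0%N -> forall w, a w = 1 & (0 < n)%N -> a (lam - 1) = 0].
have rec_ext n s s' w : (forall k, (k < n)%N -> s k = s' k) -> rec n s w = rec n s' w.
  by move=> e; apply: eq_bigr => -[l ln] _ /=; rewrite e.
have [t ht] : exists t, forall n, Q n t (t n).
  apply: (@strong_choice _ (fun=> 0) Q) => [n s s' a e h sA|n s].
    have [|aA aE a1 a0] := h; first by move=> l ln; rewrite e //; apply: sA.
    by split => // w; rewrite aE (rec_ext n s s').
  have [sA|nsA] := pselect (forall l, (l < n)%N -> A0K (s l)); last first.
    by exists (fun=> 0) => /nsA.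
  case: n sA => [|n] sA.
    exists (fun=> 1) => _; split=> //; first exact: A0K_cst.
    by move=> w; rewrite /rec big_ord0 subr0 rmorph1.
  have recA : A0K (fun w => - rec n.+1 s w).
    apply: A0K_opp; apply: A0K_sum => -[l ln] _ /=; apply: A0K_mul.
      by apply: (A0K_shift 1); apply: sA.
    have [FA _ _] := hF (n.+1.-1%:Z - l%:Z).
    apply: A0K_hK; under eq_fun do rewrite -addrA.
    exact: A0K_shift.
  (* The free constant of the equation is spent on the first required zero, at lam - 1. *)
  have [G [GA GE G0]] := A0K_diff_solve (lam - 1) 0 recA.
  by exists G => _; split.
have tA n : A0K (t n).
  elim/ltn_ind: n => n IH; by case: (ht n IH).
have tE n w : t n (w + 1) = hK (- 1) (t n w) - rec n t w by case: (ht n (fun l _ => tA l)).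
exists t; split => //.
  by move=> w; case: (ht 0%N (fun l _ => tA l)) => _ _ + _; apply.
(* The equation is read backwards, from lam - (k + 1) to lam - (k + 2): in each summand either l > k
   and [t l] vanishes by induction, or the factor of M is evaluated at one of its own zeros. *)
move=> n k; elim: k n => // -[_ n|k IH n] /andP[_ kn].
  by case: (ht n (fun l _ => tA l)) => _ _ _; apply.
apply: (@hK_eq0 _ lnq (-1)).
have e : lam - k.+2%:R + 1 = lam - k.+1%:R by rewrite -[k.+2%:R]natr1; ring.
have := tE n (lam - k.+2%:R); rewrite /rec e (IH n (ltnW kn)) big1 => [|[l ln] _ /=].
  by rewrite subr0.
have [kl|lk] := leqP k.+1 l; first by rewrite (IH l kl) mul0r.
have {}e : lam - k.+1%:R + l%:R = lam - (k.+1 - l)%N%:R.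
  by rewrite natrB; [ring | apply: ltnW].
have [_ _ F0] := hF (n.-1%:Z - l%:Z).
by rewrite e F0 ?raddf0 ?mulr0 //; lia.
Qed.

(** The interpolated diagonals describe T only beyond row N. The row equation T_i = h(T_{i+1}) M
    determines the remaining rows downwards to i = 0, and finitely many rows do not affect
    membership. *)
Lemma reduction_exists (M : Lmat) : hessenberg M ->
  exists T S a, [/\ unitri T, unitri S, T * S = 1, S * T = 1 & hM 1 T * M * S = compan a].
Proof.
move=> [M1 M0]; have [b [N [_ /choice[F hF]]]] := lmP M.
have [t [tA t1 tE t0]] := reduction_diagonals hF.
(* [row k] is row N + 1 - k of T, starting from the first row given by [t]. *)
pose row := fix row (k : nat) : nat -> lser := if k is k'.+1
  then fun j => \sum_(l < j.+2) hK 1 (row k' l) * M l j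
  else fun j => if (N.+1 <= j)%N then t (j - N.+1)%N N.+1%:R else 0.
pose T0 : kmat R := fun i j => if (N < i)%N then
  (if (i <= j)%N then t (j - i)%N i%:R else 0) else row (N.+1 - i)%N j.
have T0E i j : T0 i j = \sum_(l < j.+2) hK 1 (T0 i.+1 l) * M l j.
  rewrite {1}/T0; case: (ltnP N i) => Ni; last first.
    rewrite subSn //=; apply: eq_bigr => l _; congr (hK _ _ * _).
    rewrite /T0; case: (ltnP N i.+1) => Ni1; last by rewrite subSS.
    have NE : N = i by lia.
    by rewrite (_ : N - i = 0)%N /=; [rewrite NE | lia].
  have Ni1 : (N < i.+1)%N by lia.
  under eq_bigr => l _ do rewrite /T0 Ni1.
  case: (leqP i j) => ij; last first.
    by rewrite big1 // => -[l lj] _ /=; rewrite ifF ?raddf0 ?mul0r //; lia.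
  pose n := (j - i)%N; have jE : j = (i + n)%N by rewrite /n; lia.
  rewrite -(big_mkord xpredT (fun l => hK 1 (if (i < l)%N then t (l - i.+1)%N i.+1%:R else 0) * M l j)).
  rewrite (@big_cat_nat _ _ _ i.+1) //=; last by lia.
  rewrite big1_seq ?add0r; last first.
    move=> l /andP[_]; rewrite mem_index_iota => li.
    by rewrite ifF ?raddf0 ?mul0r //; lia.
  rewrite -{1}[i.+1]add0n big_addn (_ : j.+2 - i.+1 = n.+1)%N; last by lia.
  rewrite big_nat_recr //= ifT; last by lia.
  rewrite (_ : (n + i.+1 = j.+1)%N) ?M1 ?mulr1; last by lia.
  rewrite (_ : (j.+1 - i.+1 = n)%N); last by lia.
  rewrite -natr1 tE raddfB /= hKVK raddf_sum /= big_mkord.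
  rewrite [X in _ = X + _](eq_bigr (fun l : 'I_n => hK 1 (t l (i%:R + 1) *
    hK (-1) (F (n.-1%:Z - l%:Z) (i%:R + 1 + l%:R))))); first by rewrite addrC subrK.
  move=> -[l ln] _ /=; rewrite rmorphM /= hKVK ifT; last by lia.
  rewrite addnK natr1 -natrD; congr (_ * _).
  by have [_ FE _] := hF (n.-1%:Z - l%:Z); rewrite (FE _ j) //; [rewrite addnC | lia | lia].
have T0u i j : (j <= i)%N -> T0 i j = (i == j)%:R.
  have big i' j' : (N < i')%N -> (j' <= i')%N -> T0 i' j' = (i' == j')%:R.
    move=> Ni; rewrite /T0 Ni leq_eqVlt => /orP[/eqP ->|ji].
      by rewrite leqnn subnn t1 eqxx.
    by rewrite leqNgt ji gtn_eqF.
  move: {2}(N.+1 - i)%N (leqnn (N.+1 - i)) => m; elim: m i j => [|m IH] i j im ij.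
    by apply: big => //; lia.
  have [?|iN] := ltnP N i; first exact: big.
  rewrite T0E big_ord_recr /= M1 mulr1 IH ?eqSS; try lia.
  rewrite rmorph_nat big1 ?add0r // => -[l lj] _ /=.
  by rewrite IH ?gtn_eqF ?raddf0 ?mul0r //; lia.
have hT : isL T0.
  exists 0, N; split=> [i j ij|n]; first by rewrite T0u ?gtn_eqF //; lia.
  have [n_neg|n_pos] := ltP n 0.
    exists (fun=> 0); split => //; first exact: A0K_cst.
    by move=> i j _ ij; rewrite T0u ?gtn_eqF //; lia.
  exists (t (absz n)); split=> // [i j Ni ij|k k0 kn].
    by rewrite /T0 Ni ifT; [congr (t _ _); lia | lia].
  by apply: t0; lia.
pose T : Lmat := mkL hT.
have [S [Su TS ST]] := unitri_inv (T0u : unitri T).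
(* Row i + 1 of h(T) M is row i of T, so multiplying by S = T^-1 leaves the shifted identity below
   the first row. *)
exists T, S, (fun j => (hM 1 T * M * S) 0%N j); split => //.
apply: LmatP => -[|i] j; first by rewrite comp0.
rewrite compS -(ent1 lnq lam) -TS.
have rowE k : (hM 1 T * M) i.+1 k = T i k.
  rewrite (@entM _ _ _ _ _ _ _ k.+2); last by move=> l lk; apply: M0.
  by rewrite ent_mkL T0E; apply: eq_bigr => l _; rewrite ent_hM ent_mkL.
rewrite !(@entM _ _ _ _ _ _ _ j.+1) => [|k kj|k kj]; try by rewrite Su ?gtn_eqF // ltnW.
by apply: eq_bigr => k _; rewrite rowE.
Qed.

(** The rows below the first give h(T_{i+1,j+1}) = T_{ij}, so each superdiagonal is interpolated by
    a dilate h^(-w) of its first entry. The required zero at lam - 1 then kills that entry,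
    dilations being injective, and T = 1. *)
Lemma comp_gauge_eq (T : Lmat) a a' : unitri T -> hM 1 T * compan a = compan a' * T -> a = a'.
Proof.
move=> Tu e.
have TS i j : hK 1 (T i.+1 j.+1) = T i j.
  have := congr1 (fun x : Lmat => x i.+1 j) e.
  by rewrite comp_mulS mul_comp !ent_hM (Tu i.+1 0%N) // raddf0 mul0r add0r.
have TE i n : T i (i + n)%N = hK (- i%:R) (T 0%N n).
  elim: i => [|i IH]; first by rewrite oppr0 hK0.
  by rewrite -[LHS](hKK lnq 1) TS IH hKD -opprD nat1r.
have [b [N [_ hT]]] := lmP T.
suff T1 : T = 1.
  move: e; rewrite T1 rmorph1 mul1r mulr1 => /(congr1 (fun x : Lmat => x 0%N)) e.
  by apply/funext => j; have := congr1 (fun f => f j) e; rewrite !comp0.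
apply: LmatP => i j; rewrite ent1.
have [ij|ji] := ltnP i j; last by rewrite Tu.
rewrite ltn_eqF // (_ : j = i + (j - i))%N; last by lia.
rewrite TE; set n := (j - i)%N.
have [F [FA FE F0]] := hT n%:Z.
have FT : F = fun w => hK (- w) (T 0%N n).
  apply: (A0K_uniq q_ru (N := N.+1) FA (A0K_hKN lnq _)) => m Nm.
  by rewrite -TE -(FE m (m + n)%N) //.
have := F0 1%N isT; rewrite FT => /(_ _) T0.
by rewrite (hK_eq0 (T0 _)) ?raddf0 //; rewrite /n; lia.
Qed.

End Reduction.

Lemma xget_eq (T : choiceType) (x0 y : T) (P : set T) :
  P y -> (forall z, P z -> z = y) -> xget x0 P = y.
Proof. by move=> Py yu; case: xgetP => [z _ /yu //|/(_ y)]. Qed.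

(** * The diagonal part of the r-matrix *)

Section DiagonalOperators.
Context (R : realType) (lnq lam : R[i]).
Local Notation C := R[i].
Local Notation lser := (lser R).
Local Notation A0K := (A0K lnq).
Local Notation hK := (hK lnq).
Local Notation Lmat := (Lmat lnq lam).
Local Notation isL := (isL lnq lam).
Local Notation toM := (@toM R lnq lam).
Local Notation tr := (@tr R lnq lam).

Definition isdiag (x : Lmat) := forall i j : nat, i != j -> x i j = 0.

Lemma Pd_diagonal x : isdiag (Pd x).
Proof. by move=> i j /negPf ij; rewrite ent_Pd ij. Qed.

Lemma diagonal_Pd x : isdiag x -> Pd x = x.
Proof.
by move=> xd; apply: LmatP => i j; rewrite ent_Pd; case: eqP => // /eqP /xd ->.
Qed.

Lemma isdiagP x y : isdiag x -> isdiag y -> (forall i, x i i = y i i) -> x = y.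
Proof.
move=> xd yd e; apply: LmatP => i j.
by have [->|ij] := eqVneq i j; rewrite ?e // xd ?yd.
Qed.

Lemma diagonal_mull x y i j : isdiag x -> (x * y) i j = x i i * y i j.
Proof.
move=> xd; have [b yb] := Lband y.
rewrite (@entM _ _ _ _ _ _ _ (i + j + b).+1); last by move=> k kB; apply: yb; lia.
have iB : (i < (i + j + b).+1)%N by lia.
rewrite (bigD1 (Ordinal iB)) //= big1 ?addr0 // => k ki.
by rewrite xd ?mul0r //; apply: contraNneq ki => e; apply/eqP/val_inj.
Qed.

Lemma diagonal_mulr x y i j : isdiag y -> (x * y) i j = x i j * y j j.
Proof.
move=> yd; rewrite (@entM _ _ _ _ _ _ _ j.+1) => [|k kj]; last by rewrite yd ?gtn_eqF.
rewrite big_ord_recr /= big1 ?add0r // => -[k kj] _ /=.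
by rewrite yd ?mulr0 // ltn_eqF.
Qed.

Lemma isL_diag (f : nat -> lser) (N : nat) (F : C -> lser) : A0K F ->
  (forall i, (N < i)%N -> f i = F i%:R) -> isL (fun i j => if i == j then f i else 0).
Proof.
move=> FA fF; exists 0, N; split=> [i j ij|n]; first by rewrite ifF //; lia.
exists (if n == 0 then F else fun=> 0); split.
- by case: eqP => // _; apply: A0K_cst.
- move=> i j Ni ij; case: (n =P 0) => n0; first by rewrite ifT ?fF //; lia.
  by rewrite ifF //; lia.
- by move=> k k0 kn; rewrite ifF //; lia.
Qed.

Fact Uk_key : {m : lser -> Lmat | forall F i j, m F i j = if i == j then hK (- i%:R) F else 0}.
Proof.
by exists (fun F => mkL (isL_diag (f := fun i => hK (- i%:R) F) (N := 0)
  (A0K_hKN lnq F) (fun _ _ => erefl))).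
Qed.
Definition Uk : lser -> Lmat := sval Uk_key.

Lemma ent_Uk F i j : Uk F i j = if i == j then hK (- i%:R) F else 0.
Proof. exact: (svalP Uk_key). Qed.

Lemma Uk_diagonal F : isdiag (Uk F).
Proof. by move=> i j /negPf ij; rewrite ent_Uk ij. Qed.

Lemma toM_Uk F : toM (Uk F) = U_of_ser lnq (lval F).
Proof.
apply/funext => i; apply/funext => j; rewrite /toM ent_Uk /U_of_ser.
by case: eqP => // _; rewrite lval_hK.
Qed.

Lemma Uk_is_linear : linear Uk.
Proof.
move=> c F G; apply: LmatP => i j; rewrite !(entD, entZ, ent_Uk).
by case: eqP => _; rewrite ?linearP // scaler0 addr0.
Qed.
HB.instance Definition _ := GRing.isLinear.Build C lser Lmat _ Uk Uk_is_linear.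

Lemma UkD F G : Uk (F + G) = Uk F + Uk G. Proof. exact: raddfD. Qed.
Lemma UkB F G : Uk (F - G) = Uk F - Uk G. Proof. exact: raddfB. Qed.
Lemma UkZ c F : Uk (c *: F) = c *: Uk F. Proof. exact: linearZ. Qed.

Lemma Uk_inj : injective Uk.
Proof.
move=> F G /(congr1 (fun x : Lmat => x 0%N 0%N)).
by rewrite !ent_Uk eqxx oppr0 !hK0.
Qed.

Lemma hM_Uk w F : hM w (Uk F) = Uk (hK w F).
Proof.
apply: LmatP => i j; rewrite ent_hM !ent_Uk.
by case: eqP => _; [rewrite !hKD addrC | rewrite raddf0].
Qed.

Lemma Uk1 : Uk 1 = 1.
Proof. by apply: LmatP => i j; rewrite ent_Uk ent1 rmorph1; case: eqP. Qed.

Lemma UP X : U lnq X <-> exists F, X = toM (Uk F).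
Proof.
split=> [[F lF ->]|[F ->]]; first by exists (mkl lF); rewrite toM_Uk.
by exists (lval F); [apply: lvalP | rewrite toM_Uk].
Qed.

Hypothesis q_ru : forall k, (0 < k)%N -> qexp lnq 1 ^+ k != 1.

Local Notation trD := (trD (lam := lam) q_ru).
Local Notation trB := (trB (lam := lam) q_ru).
Local Notation trZ := (trZ (lam := lam) q_ru).
Local Notation tr0 := (tr0 lam q_ru).
Local Notation tr_sum := (tr_sum (lam := lam) q_ru).

(** All diagonal entries h^(-i)(FG) have the same constant term, so the partial sums are n ct(FG).
    Interpolated at lam this produces the factor lambda that Bbar compensates. *)
Lemma tr_UkM F G : tr (Uk F * Uk G) = lam * ct (F * G).
Proof.
rewrite (@trE _ _ _ q_ru _ (fun w => w * ct (F * G)) 0) //.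
  by apply: A0_mul; [apply: A0_id | apply: A0_const].
move=> n _; rewrite (eq_bigr (fun=> ct (F * G))) => [|i _].
  by rewrite sumr_const card_ord mulr_natl.
by rewrite diagonal_mull ?ent_Uk ?eqxx -?rmorphM ?ct_hK //; apply: Uk_diagonal.
Qed.

Lemma diag_vbound (x : Lmat) : exists M, forall i, vbound M (lval (x i i)).
Proof.
have [b [N [_ xF]]] := lmP x; have [F [[[M HM] _] FE _]] := xF 0.
have [M' HM'] := common_vbound N.+1 (fun i => x i i).
exists (Num.max M M') => i m; rewrite gt_max => /andP[Mm M'm].
have [iN|Ni] := leqP i N; first exact: (HM' i).
by have := FE i i Ni; rewrite addr0 => ->; rewrite ?HM.
Qed.

Lemma ct_mul_Uk (x : Lmat) G i : ct ((x * Uk G) i i) = ct (x i i * hK (- i%:R) G).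
Proof. by rewrite diagonal_mulr ?ent_Uk ?eqxx //; apply: Uk_diagonal. Qed.

Lemma PU_laurent (x : Lmat) : laurent (fun m => lam^-1 * tr (x * Uk (monom 1 (- m)))).
Proof.
have [M HM] := diag_vbound x; exists M => m Mm.
rewrite (@tr_ext _ _ _ _ 0) ?tr0 ?mulr0 // => i.
by rewrite ct_mul_Uk hK_monom mulrC ct_monomM opprK /cf HM ?mulr0 ?raddf0.
Qed.
Fact PU_key : {p : Lmat -> lser |
  forall x m, cf m (p x) = lam^-1 * tr (x * Uk (monom 1 (- m)))}.
Proof. by exists (fun x => mkl (PU_laurent x)). Qed.
(** The component F_0 of the projection onto U: pairing with the element of U given by z^(-m) reads
    off the coefficient of z^m, up to the factor lam. *)
Definition PU : Lmat -> lser := sval PU_key.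

Lemma cf_PU m x : cf m (PU x) = lam^-1 * tr (x * Uk (monom 1 (- m))).
Proof. exact: (svalP PU_key). Qed.

Hypothesis lam_neq0 : lam != 0.

(** The definition only tests monomials. Since the diagonal entries of x have a common bound on
    powers of z, just finitely many coefficients of G reach the constant terms, and [y] is the
    corresponding finite combination. *)
Lemma PUE x G : tr (x * Uk G) = lam * ct (PU x * G).
Proof.
have [M HM] := diag_vbound x; case: (lvalP G) => M' vG.
have vPU : vbound M (lval (PU x)).
  move=> m Mm; rewrite -/(cf m _) cf_PU (@tr_ext _ _ _ _ 0) ?tr0 ?mulr0 // => i.
  by rewrite ct_mul_Uk hK_monom mulrC ct_monomM opprK /cf HM ?mulr0 ?raddf0.
rewrite /ct (cfM_window 0 vPU vG) mulr_sumr.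
pose y : Lmat := \sum_(k <- window M M' 0) cf (- k) G *: (x * Uk (monom 1 (- k))).
rewrite (@tr_ext _ _ _ _ y) => [|i].
  rewrite tr_sum; apply: eq_bigr => k _.
  by rewrite trZ sub0r cf_PU -mulrA mulVKf // mulrC.
rewrite ct_mul_Uk /ct (cfM_window 0 (HM i) (vbound_hK _ _ vG)).
rewrite -[y i i]/(ent i i y) /y !raddf_sum; apply: eq_bigr => k _.
transitivity (cf (- k) G * ct ((x * Uk (monom 1 (- k))) i i)); last by [].
rewrite ct_mul_Uk hK_monom [X in _ = _ * ct X]mulrC ct_monomM opprK.
by rewrite sub0r cf_hK mulr1; ring.
Qed.

Lemma PU_eq (x : Lmat) F : (forall G, tr (x * Uk G) = lam * ct (F * G)) -> PU x = F.
Proof.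
move=> e; apply: ct_nondeg => G; apply: (mulfI lam_neq0).
by rewrite ![G * _]mulrC -PUE e.
Qed.

Lemma PU_is_linear : linear PU.
Proof.
move=> c x y; apply: PU_eq => G.
rewrite mulrDl trD -scalerAl trZ !PUE.
by rewrite mulrDl -scalerAl linearP /=; ring.
Qed.

Lemma PUD x y : PU (x + y) = PU x + PU y.
Proof. by rewrite -[x]scale1r PU_is_linear !scale1r. Qed.
Lemma PUZ c x : PU (c *: x) = c *: PU x.
Proof.
have PU0 : PU 0 = 0 by apply: (addrI (PU 0)); rewrite -PUD !addr0.
by rewrite -[c *: x]addr0 PU_is_linear PU0 addr0.
Qed.

Lemma PU_hM w x : PU (hM w x) = hK w (PU x).
Proof.
apply: PU_eq => G; rewrite -[X in Uk X](hKVK lnq w) -hM_Uk -rmorphM /= tr_hM PUE.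
by rewrite ct_hKM.
Qed.

Lemma PU_Pd x : PU (Pd x) = PU x.
Proof.
apply: PU_eq => G; rewrite -PUE; apply: tr_ext => i.
by rewrite !ct_mul_Uk ent_Pd eqxx.
Qed.

Lemma P_UE x : P_U lnq lam (toM x) = toM (Uk (PU x)).
Proof.
apply: xget_eq => [|Y [/UP[F ->] FZ]].
  split=> [|Z /UP[G ->]]; first by apply/UP; exists (PU x).
  by rewrite -toMB inner_toM mulrBl trB PUE tr_UkM subrr.
congr (toM (Uk _)); apply/esym/PU_eq => G.
have UG : U lnq (toM (Uk G)) by apply/UP; exists G.
have := FZ _ UG; rewrite -toMB inner_toM mulrBl trB (tr_UkM F G).
exact: subr0_eq.
Qed.

Lemma P00E F : P00 lnq lam (toM (Uk F)) = cf 0 F *: mone R.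
Proof.
have m1 : mone R = toM (Uk 1) by rewrite Uk1 toM1.
have key c c' : inner lnq lam (toM (Uk F) - c *: mone R) (c' *: mone R)
    = lam * (c' * (cf 0 F - c)).
  rewrite m1 -!toMZ -toMB inner_toM -!UkZ -UkB tr_UkM.
  by rewrite -scalerAr mulr1 ctZ ctB ctZ /ct cf1 mulr1.
apply: xget_eq => [|Y [[c ->] cZ]].
  by split=> [|Z [c' ->]]; [exists (cf 0 F) | rewrite key subrr !mulr0].
have ex1 : exists c' : C, 1 *: mone R = c' *: mone R by exists 1.
have := cZ _ ex1; rewrite key mul1r => e.
suff -> : cf 0 F = c by [].
by apply: subr0_eq; apply: (mulfI lam_neq0); rewrite e mulr0.
Qed.

Definition dropc (F : lser) : lser := mult (fun m => (m != 0)%:R) F.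

Lemma dropcE F : dropc F = F - cf 0 F *: 1.
Proof.
apply: cfP => m; rewrite cf_mult cfB cfZ cf1.
by case: eqP => [->|_]; rewrite /= ?mul0r ?mulr1 ?subrr // mulr0 mul1r subr0.
Qed.

Lemma lval_dropc F : lval (dropc F) = drop_const (lval F).
Proof. by rewrite dropcE. Qed.

Lemma P0'E F : P0' lnq lam (toM (Uk F)) = toM (Uk (dropc F)).
Proof.
rewrite /P0' Pdiag_toM (diagonal_Pd (@Uk_diagonal F)) P00E dropcE.
by rewrite UkB UkZ Uk1 toMB toMZ toM1.
Qed.

Hypothesis q_lam : forall m : int, m != 0 -> qexp lnq lam ^ m != 1.

(** The symbol of (1 - h^lambda)^-1; its value 0 at m = 0 builds in the projection P_0'. Likewise
    [ky] is the symbol of the Cayley transform. *)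
Definition rs (m : int) : C := (m != 0)%:R / (1 - qexp lnq lam ^ m).

Lemma rsE m : rs m * (1 - qexp lnq lam ^ m) = (m != 0)%:R.
Proof.
rewrite /rs; case: eqP => [->|/eqP /q_lam m0]; first by rewrite !mul0r.
by rewrite divfK // subr_eq0 eq_sym.
Qed.

Lemma mult_rs_dropc F : dropc (mult rs F) = mult rs F.
Proof.
apply: cfP => m; rewrite !cf_mult mulrA /rs.
by case: eqP; rewrite ?mul0r // mul1r.
Qed.

Lemma resolvent_eq F G : dropc F = F -> dropc G = G -> G - hK lam G = F -> G = mult rs F.
Proof.
move=> F0 G0 <-; apply: cfP => m.
rewrite cf_mult cfB cf_hK -[X in _ = _ * (X - _)]mul1r -mulrBl mulrA rsE.
by rewrite -[in LHS]G0 cf_mult.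
Qed.

Lemma resolvent_sol F : dropc F = F -> mult rs F - hK lam (mult rs F) = F.
Proof.
move=> F0; apply: cfP => m; rewrite -[in RHS]F0.
rewrite cfB cf_hK !cf_mult -[X in X - _]mul1r -mulrBl mulrA.
by rewrite [X in X * _]mulrC rsE.
Qed.

Lemma resolvent_UE F : dropc F = F ->
  resolvent_U lnq lam (toM (Uk F)) = toM (Uk (mult rs F)).
Proof.
move=> F0; apply: xget_eq.
  split; last by rewrite hm_toM -toMB hM_Uk -UkB resolvent_sol.
  by exists (toM (Uk (mult rs F))); [apply/UP; eexists | rewrite P0'E mult_rs_dropc].
move=> _ [[_ /UP[G ->] <-]]; rewrite P0'E hm_toM -toMB hM_Uk -UkB.
move=> /toM_inj /Uk_inj e; congr (toM (Uk _)); apply: resolvent_eq => //.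
by apply: cfP => m; rewrite !cf_mult; case: eqP; rewrite ?mul0r ?mul1r.
Qed.

Lemma resolventE F : dropc F = F -> resolvent lnq lam (lval F) = lval (mult rs F).
Proof.
move=> F0; apply: xget_eq.
  split; last by rewrite -lval_hK; have := congr1 (@lval R) (resolvent_sol F0).
  by exists (lval (mult rs F)); [apply: lvalP | rewrite -lval_dropc mult_rs_dropc].
move=> _ [[G lG <-]]; rewrite -[G](mklK lG) -lval_dropc -lval_hK => e.
congr lval; apply: resolvent_eq => //; last exact: lval_inj.
by apply: cfP => m; rewrite !cf_mult; case: eqP; rewrite ?mul0r ?mul1r.
Qed.

Definition ky (m : int) : C := 2^-1 * (rs m + qexp lnq lam ^ m * rs m).

Lemma mult_ky F : mult ky F = 2^-1 *: (mult rs F + hK lam (mult rs F)).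
Proof.
by apply: cfP => m; rewrite cfZ cfD cf_hK !cf_mult /ky; ring.
Qed.

(** With Q = q^(lambda m), (1/2)(1 + Q)/(1 - Q) = 1/(1 - Q) - 1/2 for m non-zero; this is what
    reduces all entries of the second bracket to one symbol. *)
Lemma kyE m : ky m = rs m - 2^-1 * (m != 0)%:R.
Proof. by rewrite -rsE /ky; field. Qed.

Lemma cayley_UE F : dropc F = F -> cayley_U lnq lam (toM (Uk F)) = toM (Uk (mult ky F)).
Proof.
move=> F0; rewrite /cayley_U resolvent_UE // hm_toM hM_Uk mult_ky.
by rewrite UkZ UkD toMZ toMD.
Qed.

Lemma cayleyE F : dropc F = F -> cayley lnq lam (lval F) = lval (mult ky F).
Proof.
by move=> F0; rewrite /cayley resolventE // mult_ky -lval_hK.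
Qed.

End DiagonalOperators.

Lemma subr_subrACA (W : zmodType) (a b c d : W) : (a - b) - (c - d) = (a - c) - (b - d).
Proof. by rewrite !opprB addrACA [RHS]addrACA (addrC (- b)). Qed.

(** * The r-matrix as an operator on the matrix algebra *)

Section RMatrixOperator.
Context (R : realType) (lnq lam : R[i]).
Local Notation C := R[i].
Local Notation lser := (lser R).
Local Notation A0K := (A0K lnq).
Local Notation hK := (hK lnq).
Local Notation Lmat := (Lmat lnq lam).
Local Notation isL := (isL lnq lam).
Local Notation toM := (@toM R lnq lam).
Local Notation tr := (@tr R lnq lam).
Local Notation Uk := (@Uk R lnq lam).
Local Notation hM := (@hM R lnq lam).

Hypothesis q_ru : forall k, (0 < k)%N -> qexp lnq 1 ^+ k != 1.
Local Notation trD := (trD (lam := lam) q_ru).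
Local Notation trB := (trB (lam := lam) q_ru).
Local Notation trZ := (trZ (lam := lam) q_ru).
Local Notation tr0 := (tr0 lam q_ru).

(** The equation f_n - h(f_{n+1}) = x_n with f_0 = 0, solved forward: these are the entries of A^-1
    x. *)
Definition gseq (x : Lmat) : nat -> lser := fix g n :=
  if n is m.+1 then hK (- 1) (g m - x m m) else 0.

(** Beyond row N the recursion is a first-order difference equation with interpolated right-hand
    side, and its solution is anchored at the value for N + 1. *)
Lemma isL_gseq x : isL (fun i j => if i == j then gseq x i else 0).
Proof.
have [b [N [_ xF]]] := lmP x; have [F [FA FE _]] := xF 0.
have FA' : A0K (fun w => - hK (- 1) (F w)) by apply/A0K_opp/A0K_hK.
have [G [GA GE G0]] := A0K_diff_solve N.+1%:R (gseq x N.+1) FA'.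
refine (@isL_diag _ _ _ (gseq x) N G GA _); elim => // i IH.
rewrite ltnS leq_eqVlt => /orP[/eqP <- //|Ni].
by rewrite -natr1 GE -IH //= raddfB /= (FE i i) ?addr0.
Qed.
Fact Ainv_key : {m : Lmat -> Lmat | forall x i j, m x i j = if i == j then gseq x i else 0}.
Proof. by exists (fun x => mkL (isL_gseq x)). Qed.
Definition Ainv : Lmat -> Lmat := sval Ainv_key.

Lemma ent_Ainv x i j : Ainv x i j = if i == j then gseq x i else 0.
Proof. exact: (svalP Ainv_key). Qed.

Lemma Ainv_diagonal x : isdiag (Ainv x).
Proof. by move=> i j /negPf ij; rewrite ent_Ainv ij. Qed.

Lemma Ainv_eq (x y : Lmat) : isdiag y -> y 0%N 0%N = 0 ->
  (forall i, y i i - hK 1 (y i.+1 i.+1) = x i i) -> y = Ainv x.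
Proof.
move=> yd y0 yE; apply: (isdiagP yd (Ainv_diagonal x)) => i.
rewrite ent_Ainv eqxx; elim: i => [|i IH]; first by rewrite y0.
by rewrite /= -IH -yE subKr hKK.
Qed.

Lemma Ainv_spec (x : Lmat) i : Ainv x i i - hK 1 (Ainv x i.+1 i.+1) = x i i.
Proof. by rewrite !ent_Ainv !eqxx /= hKVK subKr. Qed.

Lemma AinvB x y : Ainv (x - y) = Ainv x - Ainv y.
Proof.
apply/esym/Ainv_eq => [i j ij||i].
- by rewrite entB !Ainv_diagonal // subrr.
- by rewrite entB !ent_Ainv !eqxx subrr.
- rewrite !entB raddfB /= -(Ainv_spec x) -(Ainv_spec y).
  by move: (Ainv x i i) (Ainv y i i) (hK _ _) (hK _ _) => p q r s; ring.
Qed.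

Lemma Ainv_hM w x : Ainv (hM w x) = hM w (Ainv x).
Proof.
apply/esym/Ainv_eq => [i j ij||i].
- by rewrite ent_hM Ainv_diagonal // raddf0.
- by rewrite ent_hM ent_Ainv eqxx raddf0.
- by rewrite !ent_hM -(Ainv_spec x) raddfB /= !hKD (addrC w 1).
Qed.

Lemma Aop_invE x : isdiag x -> Aop_inv lnq lam (toM x) = toM (Ainv x).
Proof.
move=> xd; apply: xget_eq.
  split.
    split; first by apply/LhP => //; exists (Ainv x) => //; apply: Ainv_diagonal.
    by rewrite /toM ent_Ainv eqxx.
  apply/funext => i; apply/funext => j.
  rewrite /Aop !fctE /hm /shat /toM -lval_hK -[X in X = _]/(lval (_ - _)).
  have [->|ij] := eqVneq i j; first by rewrite Ainv_spec.
  by rewrite !Ainv_diagonal ?eqSS // xd // raddf0 subrr.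
move=> Y [[/(LhP _ q_ru)[y -> yd] y0] Ay]; congr toM; apply: Ainv_eq => //.
  exact: lval_inj.
move=> i; apply: lval_inj; have := congr1 (fun f => f i i) Ay.
by rewrite /Aop !fctE /hm /shat /toM -lval_hK.
Qed.

Hypothesis lam_neq0 : lam != 0.
Hypothesis q_lam : forall m : int, m != 0 -> qexp lnq lam ^ m != 1.

Section Operator.
Variable dl : int -> C.

(* The operator r_0 + 1/2 of the statement. *)
Definition rho (x : Lmat) : Lmat :=
  Ainv x + Uk (mult (fun m => lam * (ky lnq lam m + dl m) + lam / 2) (PU q_ru x)).

Lemma rhoB x y : rho (x - y) = rho x - rho y.
Proof.
rewrite /rho AinvB -[x - y]scale1r -[- y]scaleN1r (PUZ q_ru lam_neq0) scale1r.
rewrite (PUD q_ru lam_neq0) (PUZ q_ru lam_neq0) scaleN1r raddfB /= UkB.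
by rewrite opprD addrACA.
Qed.

Lemma rho_hM w x : rho (hM w x) = hM w (rho x).
Proof.
rewrite /rho Ainv_hM (PU_hM q_ru lam_neq0) hM_add hM_Uk /hK !mult_mult.
by congr (_ + Uk _); apply: mult_ext => m; rewrite mulrC.
Qed.

Lemma rho_diagonal x : isdiag (rho x).
Proof.
by move=> i j ij; rewrite entD Ainv_diagonal // Uk_diagonal // addr0.
Qed.

Definition rr (x : Lmat) : Lmat := 2^-1 *: (Pu x - Pl x) + (rho (Pd x) - 2^-1 *: Pd x).

Lemma rr_hM w x : rr (hM w x) = hM w (rr x).
Proof.
by rewrite /rr hM_add !(hM_scale, hM_sub) -rho_hM /Pu /Pl /Pd !hM_dmask.
Qed.

Lemma rrB x y : rr (x - y) = rr x - rr y.
Proof.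
rewrite /rr /Pu /Pl /Pd !dmask_sub rhoB [X in 2^-1 *: X + _]subr_subrACA.
rewrite [X in X + _]scalerBr [2^-1 *: (dmask _ x - dmask _ y)]scalerBr.
by rewrite [X in _ + X = _]subr_subrACA addrACA -opprD.
Qed.

Lemma tr_upper (x y : Lmat) : (forall i j : nat, (j <= i)%N -> x i j = 0) ->
  (forall i j : nat, (j < i)%N -> y i j = 0) -> tr (x * y) = 0.
Proof.
move=> x0 y0; rewrite -tr0; apply: tr_ext => i.
rewrite (@entM _ _ _ _ _ _ _ i.+1) => [|k ki]; last by apply: y0.
by rewrite big1 // => -[k ki] _ /=; rewrite x0 ?mul0r.
Qed.

Lemma tr_PdM (x y : Lmat) : (forall i j : nat, (j < i)%N -> x i j = 0) ->
  (forall i j : nat, (j < i)%N -> y i j = 0) -> tr (Pd x * y) = tr (x * y).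
Proof.
move=> x0 y0; rewrite [in RHS](Psplit x) (_ : Pl x = 0); last first.
  by apply: LmatP => i j; rewrite ent_Pl; case: ifP => // /x0.
rewrite addr0 mulrDl trD (tr_upper (x := Pu x) _ y0) ?add0r // => i j ij.
by rewrite ent_Pu ltnNge ij.
Qed.

(** The strictly upper part of z is orthogonal to the upper triangular w and z has no lower part, so
    the pairing only sees r_0 on the diagonal. *)
Lemma tr_rr_upper (z w : Lmat) : (forall i j : nat, (j < i)%N -> z i j = 0) ->
  (forall i j : nat, (j < i)%N -> w i j = 0) ->
  tr (rr z * w) = tr (rho (Pd z) * w) - 2^-1 * tr (z * w).
Proof.
move=> z0 w0; have Plz : Pl z = 0.
  by apply: LmatP => i j; rewrite ent_Pl; case: ifP => // /z0.
have -> : rr z * w = 2^-1 *: (Pu z * w) + (rho (Pd z) * w - 2^-1 *: (Pd z * w)).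
  by rewrite /rr Plz subr0 mulrDl mulrBl -!scalerAl.
have Puz i j : (j <= i)%N -> Pu z i j = 0 by move=> ij; rewrite ent_Pu ltnNge ij.
rewrite trD trB (trZ _ (Pu z * w)) (trZ _ (Pd z * w)) (tr_PdM z0 w0).
by rewrite (tr_upper Puz w0) mulr0 add0r.
Qed.

(* If a - h(a') and b - h(b') are upper triangular and tr(ab) = tr(a'b'), the
   r-matrix bracket only involves these two differences and a itself. *)
Lemma rr_bracket (a a' b b' : Lmat) : tr (a * b) = tr (a' * b') ->
  (forall i j : nat, (j < i)%N -> (a - hM 1 a') i j = 0) ->
  (forall i j : nat, (j < i)%N -> (b - hM 1 b') i j = 0) ->
  tr ((rr a - hM 1 (rr a' + 2^-1 *: a')) * b)
  - tr ((hM (- 1) (rr a - 2^-1 *: a) - rr a') * b')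
  = tr (rho (Pd (a - hM 1 a')) * (b - hM 1 b')) - tr (a * (b - hM 1 b')).
Proof.
move=> ab; set z := a - hM 1 a'; set w := b - hM 1 b' => z0 w0.
(* The trace is invariant under h and [rr] commutes with h, so the second slot can be written in
   terms of h(a') and h(b'). *)
have e1 : tr ((hM (- 1) (rr a - 2^-1 *: a) - rr a') * b') =
    tr ((rr a - 2^-1 *: a - rr (hM 1 a')) * hM 1 b').
  rewrite -[LHS](tr_hM 1); congr tr; rewrite hM_mul hM_sub.
  by rewrite hMVK rr_hM.
have e2 : hM 1 (rr a' + 2^-1 *: a') = rr (hM 1 a') + 2^-1 *: hM 1 a'.
  by rewrite hM_add hM_scale rr_hM.
have e3 : rr z = rr a - rr (hM 1 a') by rewrite rrB.
have e4 := tr_rr_upper z0 w0.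
have e5 : tr (hM 1 a' * hM 1 b') = tr (a * b) by rewrite -hM_mul tr_hM ab.
rewrite e1 e2; have -> : tr (rho (Pd z) * w) = tr (rr z * w) + 2^-1 * tr (z * w).
  by rewrite e4 subrK.
rewrite e3 /w /z; clear e1 e2 e3 e4 ab z0 w0 z w; move: e5.
move: (rr a) (rr (hM 1 a')) (hM 1 a') (hM 1 b') => p p' c d e5.
rewrite !(mulrBl, mulrDl, mulrBr, mulrDr) !(trB, trD) -!scalerAl !trZ.
rewrite !(mulrBl, mulrBr) !trB e5.
by field.
Qed.

End Operator.

Section Delta.
Variable Delta : mat R -> mat R.
Hypothesis Delta_skew : skew_operator_on_U lnq lam Delta.
Hypothesis Delta_h : forall F, U lnq F -> Delta (hm lnq 1 F) = hm lnq 1 (Delta F).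

Lemma qexpz_inj : injective (fun m : int => qexp lnq 1 ^ m).
Proof.
suff key (m : int) (k : nat) : qexp lnq 1 ^ (m + k%:Z) = qexp lnq 1 ^ m -> k = 0%N.
  move=> m n /= e; case: (leP m n) => mn.
    have := key m (absz (n - m)%R); rewrite (_ : m + _ = n); last by lia.
    by move=> /(_ (esym e)); lia.
  have := key n (absz (m - n)%R); rewrite (_ : n + _ = m); last by lia.
  by move=> /(_ e); lia.
have x0 := qexp_neq0 lnq 1.
rewrite expfzDr // -[RHS]mulr1 => /(mulfI (expfz_neq0 _ x0)) e.
by case: k e => // k /eqP; rewrite -exprnP (negPf (q_ru _)).
Qed.

(* An operator commuting with h acts on the z^m line, the kernel of h - q^m, and
   preserves the image of h - q^m, the series without z^m term. *)
Lemma Delta_mult : exists dl, forall F, Delta (toM (Uk F)) = toM (Uk (mult dl F)).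
Proof.
have Ufun F : U lnq (toM (Uk F)) by apply/UP; exists F.
have /choice[d hd] : forall F, exists G, Delta (toM (Uk F)) = toM (Uk G).
  by move=> F; apply/UP/(skewU_stable Delta_skew)/Ufun.
have inj F G : toM (Uk F) = toM (Uk G) -> F = G by move=> /toM_inj /Uk_inj.
have dlin c F G : d (c *: F + G) = c *: d F + d G.
  apply: inj; rewrite -hd UkD UkZ toMD toMZ (skewU_linear Delta_skew) // !hd.
  by rewrite UkD UkZ.
have dh F : d (hK 1 F) = hK 1 (d F).
  by apply: inj; rewrite -hd -!hM_Uk -!hm_toM Delta_h // hd.
have d0 : d 0 = 0 by have := dlin (-1) 0 0; rewrite !scaleN1r oppr0 addr0 addNr.
have dZ c F : d (c *: F) = c *: d F by rewrite -[c *: F]addr0 dlin d0 addr0.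
have dB F G : d (F - G) = d F - d G.
  by rewrite addrC -scaleN1r dlin scaleN1r addrC.
exists (fun m => cf m (d (monom 1 m))) => F; rewrite hd; congr (toM (Uk _)).
apply: cfP => m; rewrite cf_mult.
pose G := mult (fun k => if k == m then 0 else (qexp lnq 1 ^ k - qexp lnq 1 ^ m)^-1) F.
have FE : F = cf m F *: monom 1 m + (hK 1 G - qexp lnq 1 ^ m *: G).
  apply: cfP => k; rewrite cfD cfZ cfB cfZ cf_hK cf_monom cf_mult.
  case: eqP => [->|km]; first by rewrite !mul0r !mulr0 mulr1 subr0 addr0.
  rewrite mulr0 add0r -mulrBl mulrA divff ?mul1r // subr_eq0.
  by apply/eqP => /qexpz_inj.
by rewrite {1}FE dlin dB dZ dh cfD cfZ cfB cfZ cf_hK subrr addr0 mulrC.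
Qed.

Variable dl : int -> C.
Hypothesis Delta_dl : forall F, Delta (toM (Uk F)) = toM (Uk (mult dl F)).

Lemma r0E x : isdiag x -> r0 lnq lam Delta (toM x) = toM (rho dl x - 2^-1 *: x).
Proof.
move=> xd; rewrite /r0 (P_UE q_ru lam_neq0) /Bbar (P0'E q_ru lam_neq0).
rewrite (cayley_UE q_ru lam_neq0 q_lam) ?Delta_dl ?Aop_invE //; last first.
  by apply: cfP => m; rewrite !cf_mult; case: eqP; rewrite ?mul0r ?mul1r.
transitivity (toM (- (2^-1 *: x) + Ainv x + (lam *: (Uk (mult (ky lnq lam)
  (dropc (PU q_ru x))) + Uk (mult dl (PU q_ru x))) + (lam / 2) *: Uk (PU q_ru x)))).
  by [].
apply: (congr1 toM); rewrite /rho [RHS]addrC [RHS]addrA; congr (_ + _).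
rewrite -!UkD -!UkZ -UkD; apply: (congr1 Uk); apply: cfP => m.
rewrite cfD !cfZ cfD !cf_mult /ky.
(* At m = 0 both sides agree because the symbol [ky] is zero there, which absorbs P_0'. *)
by case: (m =P 0) => [->|_]; rewrite /rs ?eqxx /=; ring.
Qed.

Lemma rmatE x : rmat lnq lam Delta (toM x) = toM (rr dl x).
Proof.
rewrite /rmat Pupper_toM Plower_toM Pdiag_toM r0E; last exact: Pd_diagonal.
by rewrite -toMB -toMZ -toMD.
Qed.

Lemma block_bracketE a a' b b' :
  pairing2 (inner lnq lam)
    (block2 (rmat lnq lam Delta) (\- (hm lnq 1 \o rmat_plus lnq lam Delta))
       (hm lnq (- 1) \o rmat_minus lnq lam Delta) (\- rmat lnq lam Delta)
       (toM a, toM a')) (toM b, toM b')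
  = tr ((rr dl a - hM 1 (rr dl a' + 2^-1 *: a')) * b)
  - tr ((hM (- 1) (rr dl a - 2^-1 *: a) - rr dl a') * b').
Proof.
rewrite /pairing2 /block2 /= /rmat_plus /rmat_minus !rmatE.
by rewrite -!toMZ -!toMB -!toMD !hm_toM -!toMB !inner_toM.
Qed.

End Delta.

End RMatrixOperator.

(** * Gradients of gauge invariant functionals *)

(** Chain rule, the inner derivative 2t being 0 at t = 0. It disposes of the second-order remainder
    of a gauge transformation. *)
Lemma is_derive_square (K : numFieldType) (f : K^o -> K^o) (v : K^o) :
  is_derive (0 : K^o) (1 : K^o) f v ->
  is_derive (0 : K^o) (1 : K^o) (fun t : K^o => f (t * t)) (0 : K^o).
Proof.
move=> [df _].
have sq : is_derive (0 : K^o) (1 : K^o) (fun t : K^o => t * t : K^o) (0 : K^o).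
  have := is_deriveM (is_derive_id (0 : K^o) (1 : K^o)) (is_derive_id (0 : K^o) (1 : K^o)).
  by rewrite scale0r addr0.
have [dsq vsq] := sq.
have dsq' : differentiable (fun t : K^o => t * t : K^o) (0 : K^o).
  exact/derivable1_diffP.
have df' : differentiable f ((fun t : K^o => t * t : K^o) 0).
  by rewrite mul0r; apply/derivable1_diffP.
have dc := differentiable_comp dsq' df'.
split; first exact/derivable1_diffP.
rewrite -[LHS]/('D_1 (f \o (fun t : K^o => t * t)) 0) deriveE //.
rewrite (diff_comp dsq' df').
have e : 'd (fun t : K^o => t * t : K^o) (0 : K^o) 1 = 0 by rewrite -(deriveE _ dsq').
by rewrite -[LHS]/('d f _ ('d (fun t : K^o => t * t : K^o) (0 : K^o) 1)) e linear0.
Qed.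

Lemma is_derive_uniq (K : numFieldType) (f g : K^o -> K^o) (v w : K^o) :
  is_derive (0 : K^o) (1 : K^o) f v -> is_derive (0 : K^o) (1 : K^o) g w ->
  f =1 g -> v = w.
Proof.
by move=> [_ <-] [_ <-] /funext ->.
Qed.

Section Gradients.
Context (R : realType) (lnq lam : R[i]).
Local Notation C := R[i].
Local Notation lser := (lser R).
Local Notation hK := (hK lnq).
Local Notation Lmat := (Lmat lnq lam).
Local Notation isL := (isL lnq lam).
Local Notation toM := (@toM R lnq lam).
Local Notation tr := (@tr R lnq lam).
Local Notation hM := (@hM R lnq lam).
Local Notation compan := (@compan R lnq lam).
Local Notation unitri := (@unitri R lnq lam).

Hypothesis q_ru : forall k, (0 < k)%N -> qexp lnq 1 ^+ k != 1.
Local Notation trB := (trB (lam := lam) q_ru).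
Local Notation trC := (trC (lam := lam) q_ru).

Lemma isL_unit (i j : nat) (g : lser) :
  isL (fun i' j' => if (i' == i) && (j' == j) then g else 0).
Proof.
apply: (isL_finite_rows lnq lam (n := i.+1)) => i' j' ii'.
by rewrite gtn_eqF.
Qed.
Fact Eij_key : {m : nat -> nat -> lser -> Lmat |
  forall i j g i' j', m i j g i' j' = if (i' == i) && (j' == j) then g else 0}.
Proof. by exists (fun i j g => mkL (isL_unit i j g)). Qed.
Definition Eij : nat -> nat -> lser -> Lmat := sval Eij_key.

Lemma ent_Eij i j g i' j' : Eij i j g i' j' = if (i' == i) && (j' == j) then g else 0.
Proof. exact: (svalP Eij_key). Qed.

Lemma mul_Eij (x : Lmat) i j g i' j' :
  (x * Eij i j g) i' j' = if j' == j then x i' i * g else 0.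
Proof.
rewrite (@entM _ _ _ _ _ _ _ i.+1) => [|k ki]; last by rewrite ent_Eij gtn_eqF.
rewrite big_ord_recr /= ent_Eij eqxx /= big1 ?add0r => [|[k ki] _ /=]; last first.
  by rewrite ent_Eij ltn_eqF ?mulr0.
by case: eqP => _; rewrite ?mulr0.
Qed.

Lemma tr_mul_Eij (x : Lmat) i j g : tr (x * Eij i j g) = ct (x j i * g).
Proof.
rewrite (@tr_finite _ _ _ q_ru j.+1) => [|k kj]; last by rewrite mul_Eij gtn_eqF ?raddf0.
rewrite big_ord_recr /= mul_Eij eqxx big1 ?add0r // => -[k kj] _ /=.
by rewrite mul_Eij ltn_eqF ?raddf0.
Qed.

(** Against an elementary matrix the interpolated trace is a single constant term. This gives
    uniqueness of gradients. *)
Lemma tr_nondeg (x y : Lmat) : (forall z, tr (x * z) = tr (y * z)) -> x = y.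
Proof.
move=> e; apply: LmatP => i j; apply: ct_nondeg => g.
by have := e (Eij j i g); rewrite !tr_mul_Eij ![g * _]mulrC.
Qed.

Lemma unitri_LN (x : Lmat) : unitri x -> LN_plus lnq lam (toM x).
Proof. by move=> xu; apply/(LN_plusP lam q_ru); exists x. Qed.

Lemma gauge_equivP (x : Lmat) M' : gauge_equiv lnq lam (toM x) M' <->
  exists T S, [/\ unitri T, unitri S, T * S = 1, S * T = 1 & M' = toM (hM 1 T * x * S)].
Proof.
split=> [[T' [S']]|[T [S [Tu Su TS ST ->]]]]; last first.
  exists (toM T), (toM S); split; try exact: unitri_LN.
  - by rewrite mmul_toM TS toM1.
  - by rewrite mmul_toM ST toM1.
  - by rewrite hm_toM !mmul_toM.
move=> [/(LN_plusP lam q_ru)[T -> Tu] /(LN_plusP lam q_ru)[S -> Su]].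
rewrite !mmul_toM hm_toM !mmul_toM -(toM1 lnq lam) => /toM_inj TS /toM_inj ST ->.
by exists T, S.
Qed.

Variable phi : mat R -> C.
Hypothesis phi_inv : gauge_invariant lnq lam phi.

Lemma phi_gauge (x T S : Lmat) : unitri T -> unitri S -> T * S = 1 -> S * T = 1 ->
  phi (toM (hM 1 T * x * S)) = phi (toM x).
Proof.
move=> Tu Su TS ST; apply: phi_inv; first exact: Lgl_toM.
by apply/gauge_equivP; exists T, S.
Qed.

Definition gradient (x d : Lmat) := forall y, is_derive (0 : C^o) (1 : C^o)
  (fun t : C^o => phi (toM (x + (t : C) *: y)) : C^o) (tr (d * y) : C^o).

Lemma is_gradientP x D : is_gradient lnq lam phi (toM x) D <->
  exists2 d, D = toM d & gradient x d.
Proof.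
split=> [[/(LglP lam q_ru)[d ->] dD]|[d -> hd]].
  exists d => // y; have := dD (toM y) (Lgl_toM q_ru y).
  by rewrite inner_toM.
split; first exact: Lgl_toM.
move=> X /(LglP lam q_ru)[y ->]; rewrite inner_toM; exact: hd.
Qed.

(** The gauge action is linear in the matrix, so the derivative at x along y is the derivative at
    the image along h(T) y S; cyclicity and nondegeneracy of the trace give the rest. *)
Lemma gradient_gauge (x T S dx dc : Lmat) : unitri T -> unitri S ->
  T * S = 1 -> S * T = 1 -> gradient x dx -> gradient (hM 1 T * x * S) dc ->
  dx = S * dc * hM 1 T.
Proof.
move=> Tu Su TS ST gx gc; apply: tr_nondeg => y.
have -> : tr (S * dc * hM 1 T * y) = tr (dc * (hM 1 T * y * S)).
  by rewrite -!mulrA trC -!mulrA.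
apply: (is_derive_uniq (gx y) (gc (hM 1 T * y * S))) => t.
by rewrite -(phi_gauge _ Tu Su TS ST) mulrDr mulrDl -scalerAr -scalerAl.
Qed.

(* With theta^2 = 0, the matrices c + t (h(theta) c - c theta) and
   c + t^2 h(theta) c theta are gauge equivalent. *)
Lemma gradient_nilpotent (c d th : Lmat) : (forall i j : nat, (j <= i)%N -> th i j = 0) ->
  th * th = 0 -> gradient c d -> tr (d * (hM 1 th * c - c * th)) = 0.
Proof.
move=> th0 thth gc; pose w := hM 1 th * c * th.
have hth : hM 1 th * hM 1 th = 0 by rewrite -hM_mul thth raddf0.
have Tu (t : C) : unitri (1 + t *: th).
  by move=> i j ij; rewrite entD entZ th0 // scaler0 addr0 ent1.
have inv (t : C) : (1 + t *: th) * (1 - t *: th) = 1.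
  rewrite mulrDl mul1r mulrBr mulr1 -scalerAl -scalerAr thth !scaler0 subr0.
  by rewrite subrK.
have inv' (t : C) : (1 - t *: th) * (1 + t *: th) = 1.
  by have := inv (- t); rewrite scaleNr opprK.
(* Acting with 1 + t theta on c creates the term -t^2 w. Adding t^2 w beforehand cancels it, since w
   is itself fixed by the action: h(theta) w = w theta = 0. *)
have key (t : C) : phi (toM (c + t *: (hM 1 th * c - c * th))) = phi (toM (c + (t * t) *: w)).
  rewrite -[RHS](@phi_gauge _ (1 + t *: th) (1 - t *: th)) //; last first.
    by rewrite -scaleNr; apply: Tu.
  congr (phi (toM _)).
  have hw : hM 1 th * w = 0 by rewrite /w !mulrA hth !mul0r.
  have wt : w * th = 0 by rewrite /w -mulrA thth mulr0.
  rewrite hM_add hM_scale rmorph1 [(1 + t *: hM 1 th) * (c + _)]mulrDr [in RHS]mulrDl.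
  have -> : (1 + t *: hM 1 th) * ((t * t) *: w) * (1 - t *: th) = (t * t) *: w.
    rewrite mulrDl mul1r -scalerAl -scalerAr hw !scaler0 addr0.
    by rewrite mulrBr mulr1 -scalerAl -scalerAr wt !scaler0 subr0.
  rewrite mulrDl mul1r mulrBr mulr1 mulrDl -!scalerAr -!scalerAl -/w !scalerA.
  by rewrite scalerBr opprD !addrA subrK.
have := is_derive_square (gc w) => /(is_derive_uniq (gc _)); apply => t.
exact: key.
Qed.

(** The test matrix theta has the single entry h^-1(g) in position (j, i) with j < i, hence is
    strictly upper with square zero; by cyclicity and h-invariance the derivative along it is the
    pairing of g with the (i, j) entry of the defect. *)
Lemma gradient_constraint (a : nat -> lser) d : gradient (compan a) d ->
  forall i j : nat, (j < i)%N -> (compan a * d - hM 1 (d * compan a)) i j = 0.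
Proof.
move=> gd i j ji; set b := _ - _.
apply: ct_nondeg => g; rewrite mulr0 raddf0 mulrC.
pose th := Eij j i (hK (- 1) g).
have th0 k l : (l <= k)%N -> th k l = 0.
  move=> lk; rewrite ent_Eij; case: andP => // -[/eqP kj /eqP li].
  by move: lk; rewrite kj li leqNgt ji.
have thth : th * th = 0.
  by apply: LmatP => k l; rewrite mul_Eij ent_Eij (ltn_eqF ji) andbF mul0r; case: eqP.
have := gradient_nilpotent th0 thth gd.
have hth : hM 1 th = Eij j i g.
  by apply: LmatP => k l; rewrite ent_hM !ent_Eij; case: ifP; rewrite ?hKVK ?raddf0.
have -> : tr (d * (hM 1 th * compan a - compan a * th)) = tr (b * hM 1 th).
  rewrite mulrBr trB mulrBl trB; congr (_ - _); first by rewrite mulrA trC mulrA.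
  by rewrite mulrA -hM_mul tr_hM.
by rewrite hth tr_mul_Eij.
Qed.

End Gradients.

(** * The bracket at a companion matrix *)

Section CompanionBracket.
Context (R : realType) (lnq lam : R[i]).
Local Notation C := R[i].
Local Notation lser := (lser R).
Local Notation hK := (hK lnq).
Local Notation Lmat := (Lmat lnq lam).
Local Notation isL := (isL lnq lam).
Local Notation tr := (@tr R lnq lam).
Local Notation hM := (@hM R lnq lam).
Local Notation Uk := (@Uk R lnq lam).
Local Notation compan := (@compan R lnq lam).
Local Notation Eij := (@Eij R lnq lam).

Hypothesis q_ru : forall k, (0 < k)%N -> qexp lnq 1 ^+ k != 1.
Local Notation trD := (trD (lam := lam) q_ru).
Local Notation trB := (trB (lam := lam) q_ru).
Local Notation trC := (trC (lam := lam) q_ru).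
Hypothesis lam_neq0 : lam != 0.

Variable u : int -> lser.
Hypothesis u0 : u 0 = 1.

Let a (j : nat) : lser := - u j.+1%:Z.
Let c := compan a.
Let beta (d : Lmat) := c * d - hM 1 (d * c).

Variable B : nat.

(* For f the first column of d phi at c, xx f is P_0(L d phi) and xs f is
   h^lambda P_0(d phi L). *)
Definition xx (f : nat -> lser) : lser := - \sum_(i < B) u i.+1%:Z * f i.
Definition xs (f : nat -> lser) : lser := - \sum_(i < B) hK i.+1%:R (f i * u i.+1%:Z).

Lemma compan_mul0 (d : Lmat) j K : (forall k, (K <= k)%N -> d k j = 0) ->
  (c * d) 0%N j = - \sum_(k < K) u k.+1%:Z * d k j.
Proof.
move=> d0; rewrite (@entM _ _ _ _ _ _ _ K) // -sumrN.
by apply: eq_bigr => k _; rewrite comp0 mulNr.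
Qed.

Lemma ent_beta0 (d : Lmat) j K : (forall k, (K <= k)%N -> d k j = 0) ->
  beta d 0%N j = - \sum_(k < K) u k.+1%:Z * d k j
    + hK 1 (d 0%N 0%N * u j.+1%:Z) - hK 1 (d 0%N j.+1).
Proof.
move=> d0; rewrite entB (compan_mul0 d0) ent_hM (mul_comp a d) raddfD /= /a mulrN raddfN /=.
by rewrite opprD opprK addrA.
Qed.

Lemma ent_betaS (d : Lmat) i j :
  beta d i.+1 j = d i j + hK 1 (d i.+1 0%N * u j.+1%:Z) - hK 1 (d i.+1 j.+1).
Proof.
rewrite entB (comp_mulS a d) ent_hM (mul_comp a d) raddfD /= /a mulrN raddfN /=.
by rewrite opprD opprK addrA.
Qed.

(** Moving the element of U across by cyclicity gives tr(d z). The subdiagonal of c intertwines U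
    with its h-dilate, so z has only a first row and only the first column of d is seen. *)
Lemma tr_beta_Uk (d : Lmat) G : (forall k, (B <= k)%N -> d k 0%N = 0) ->
  tr (beta d * Uk G) = ct ((xx (d^~ 0%N) - xs (d^~ 0%N)) * G).
Proof.
move=> d0; pose z := Uk G * c - c * Uk (hK (- 1) G).
have z0 i j : z i.+1 j = 0.
  rewrite entB (comp_mulS a (Uk _)) (mul_comp a (Uk G)) !ent_Uk eqSS /= mul0r add0r.
  case: eqP => [->|_]; last by rewrite subrr.
  by rewrite hKD -opprD natr1 subrr.
have zE j : z 0%N j = - (u j.+1%:Z * G) + u j.+1%:Z * hK (- j.+1%:R) G.
  rewrite entB (mul_comp a (Uk G)) (@diagonal_mulr _ _ _ c (Uk _)); last exact: Uk_diagonal.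
  rewrite comp0 !ent_Uk eqxx /= addr0 oppr0 hK0 eqxx hKD -opprD natr1.
  by rewrite /a mulrN mulNr opprK mulrC.
have zrow i j : (1 <= i)%N -> z i j = 0 by case: i => // i _; apply: z0.
have -> : tr (beta d * Uk G) = tr (d * z).
  rewrite mulrBl trB mulrBr trB; congr (_ - _).
    by rewrite -mulrA trC -!mulrA.
  by rewrite mulrA -[RHS](tr_hM 1) [in RHS]hM_mul hM_Uk hKVK.
rewrite (@tr_finite _ _ _ q_ru B) => [|k Bk].
  rewrite mulrBl ctB /xx /xs !mulNr !ctN opprK !mulr_suml !raddf_sum /=.
  rewrite -big_split; apply: eq_bigr => k _ /=.
  rewrite (@entM _ _ _ _ _ _ _ 1) => [|l l1]; last exact: zrow.
  rewrite big_ord1 zE mulrDr ctD mulrN ctN; congr (- ct _ + _); first by ring.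
  by rewrite [in RHS]ct_hKM mulrA.
rewrite (@entM _ _ _ _ _ _ _ 1) => [|l l1]; last exact: zrow.
by rewrite big_ord1 d0 ?mul0r ?raddf0.
Qed.

Lemma tr_beta_UkC (d : Lmat) G : (forall k, (B <= k)%N -> d k 0%N = 0) ->
  tr (Uk G * beta d) = ct (G * (xx (d^~ 0%N) - xs (d^~ 0%N))).
Proof. by move=> d0; rewrite trC tr_beta_Uk // mulrC. Qed.

(* The terms of the component n of <L d phi, L d psi>; the component n of
   <d phi L, d psi L> consists of the terms i - j - n. *)
Definition term (f g : nat -> lser) (i j : nat) (n : int) : C :=
  ct (u (i.+1%:Z - n) * hK n%:~R (f i * u (n + j.+1%:Z)) * g j).

Definition sgC (n : int) : C := (0 < n)%R%:R - (n < 0)%R%:R.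

(** Converts the half-line indicators of the matrix side into the sign that defines R; the
    corrections sit at n = 0. *)
Lemma sgCE n : (0 < n)%R%:R = 2^-1 * (sgC n + 1 - (n == 0)%:R) :> C.
Proof. by rewrite /sgC; case: (ltgtP n 0) => _ /=; field. Qed.

(** The sum over -(j + 1) <= n <= i + 1, the range where both factors u in [term] have nonnegative
    index. It is invariant under n -> i - j - n. *)
Definition wsum (i j : nat) (F : int -> C) : C :=
  \sum_(k < (i + j).+3) F (k%:Z - j.+1%:Z).

Lemma wsum_delta i j n0 F : - j.+1%:Z <= n0 <= i.+1%:Z ->
  wsum i j (fun n => (n == n0)%:R * F n) = F n0.
Proof.
move=> /andP[n0j n0i].
have lk : (`|(n0 + j.+1%:Z)%R|%N < (i + j).+3)%N by lia.
rewrite /wsum (bigD1 (Ordinal lk)) //= big1 => [|k].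
  have -> : `|(n0 + j.+1%:Z)%R|%N%:Z - j.+1%:Z = n0 by lia.
  by rewrite eqxx mul1r addr0.
rewrite -val_eqE /= => kn; rewrite (_ : _ == n0 = false) ?mul0r //.
by apply/eqP; lia.
Qed.

(** Half of this is the contribution of R: the first sign comes from L d phi, the second, at the
    reflected mode i - j - n, from d phi L. *)
Definition mode_sum (f g : nat -> lser) : C := \sum_(i < B) \sum_(j < B)
  wsum i j (fun n => (sgC n - sgC (i%:Z - j%:Z - n)) * term f g i j n).

Lemma sum_term0 f g : \sum_(i < B) \sum_(j < B) term f g i j 0 = ct (xx f * xx g).
Proof.
rewrite /xx mulrNN mulr_suml raddf_sum; apply: eq_bigr => i _ /=.
rewrite mulr_sumr raddf_sum; apply: eq_bigr => j _ /=.
rewrite /term subr0 add0r hK0; congr ct; ring.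
Qed.

(** The mode n = i - j is the zeroth component of the pairing of d phi L with d psi L; dilating
    under the constant term brings it to the form of [xs]. *)
Lemma sum_term_diff f g :
  \sum_(i < B) \sum_(j < B) term f g i j (i%:Z - j%:Z) = ct (xs f * xs g).
Proof.
rewrite /xs mulrNN mulr_suml raddf_sum; apply: eq_bigr => i _ /=.
rewrite mulr_sumr raddf_sum; apply: eq_bigr => j _ /=.
rewrite /term [hK _ _ * hK _ _]mulrC [RHS]ct_hKM hKD mulrAC [g j * _]mulrC; congr ct.
have -> : (i.+1%:Z - (i%:Z - j%:Z)) = j.+1%:Z by lia.
have -> : (i%:Z - j%:Z + j.+1%:Z) = i.+1%:Z by lia.
congr (_ * hK _ _).
by rewrite rmorphB /= -!natr1; ring.
Qed.

Variables d1 d2 : Lmat.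
Hypothesis d1B : forall k, (B <= k)%N -> d1 k 0%N = 0.
Hypothesis d2B : forall k, (B <= k)%N -> d2 k 0%N = 0.
Hypothesis beta1_upper : forall i j : nat, (j < i)%N -> beta d1 i j = 0.
Hypothesis beta2_upper : forall i j : nat, (j < i)%N -> beta d2 i j = 0.

Let f (i : nat) : lser := d1 i 0%N.
Let g (i : nat) : lser := d2 i 0%N.

(* The upper part of d1 which makes c d1 - h(d1 c) vanish outside the first row. *)
Definition upper_part : kmat R := fun i j => if (i < j)%N then
  - \sum_(k < B | (i < k)%N) hK (k%:R - i%:R) (f k * u (j%:Z + k%:Z - i%:Z)) else 0.

Lemma isL_upper_part : isL upper_part.
Proof.
apply: (isL_finite_rows lnq lam (n := B)) => i j Bi; rewrite /upper_part.
case: ifP => // _; rewrite big1 ?oppr0 // => k ik.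
by have := ltn_ord k; lia.
Qed.

(** The summand D of the decomposition of the gradient; [delta] below is E. *)
Definition std : Lmat := d1 - Pu d1 + mkL isL_upper_part.

Lemma ent_std i j : std i j = if (i < j)%N
  then - \sum_(k < B | (i < k)%N) hK (k%:R - i%:R) (f k * u (j%:Z + k%:Z - i%:Z))
  else d1 i j.
Proof.
rewrite entD entB ent_Pu ent_mkL /upper_part.
by case: ifP => _; rewrite ?subrr ?add0r // subr0 addr0.
Qed.

Lemma std0 i : std i 0%N = f i. Proof. by rewrite ent_std. Qed.

Let f_out k : (B <= k)%N -> f k = 0. Proof. exact: d1B. Qed.

Lemma sum_f_from (i : nat) (F : nat -> lser) : (forall k, (B <= k)%N -> F k = 0) ->
  \sum_(k < B | (i <= k)%N) F k = F i + \sum_(k < B | (i < k)%N) F k.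
Proof.
move=> F0; have [iB|Bi] := ltnP i B.
  rewrite (bigD1 (Ordinal iB)) //=; congr (_ + _); apply: eq_bigl => k.
  by rewrite -val_eqE /= ltn_neqAle andbC eq_sym.
rewrite F0 // add0r !big1 // => k; have := ltn_ord k; lia.
Qed.

(** On and below column i nothing changed, so this is the constraint on the gradient. Above, the sum
    over k > i splits into its term k = i + 1 and the sum over k > i + 1, which is exactly the
    recursion the defect asks for. *)
Lemma beta_stdS i j : beta std i.+1 j = 0.
Proof.
rewrite ent_betaS std0 !ent_std ltnS.
case: (ltnP i j) => ij; last first.
  by have := @beta1_upper i.+1 j; rewrite ent_betaS; apply.
rewrite [hK 1 (- _)]raddfN /= opprK [hK 1 (\sum_(k < B | _) _)]raddf_sum /=.
have e : \sum_(k < B | (i < k)%N) hK (k%:R - i%:R) (f k * u (j%:Z + k%:Z - i%:Z)) =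
    hK 1 (f i.+1 * u j.+1%:Z) +
    \sum_(k < B | (i.+1 < k)%N) hK 1 (hK (k%:R - i.+1%:R) (f k * u (j.+1%:Z + k%:Z - i.+1%:Z))).
  rewrite (@sum_f_from i.+1 (fun k => hK (k%:R - i%:R) (f k * u (j%:Z + k%:Z - i%:Z)))).
    congr (_ + _).
      congr (hK _ (_ * u _)); first by rewrite -natr1 addrC addKr.
      by lia.
    apply: eq_bigr => k _; rewrite hKD; congr (hK _ (_ * u _)); last by lia.
    by rewrite -(natr1 i); ring.
  by move=> k /f_out ->; rewrite mul0r raddf0.
by rewrite e -addrA addNr.
Qed.

Let v j : lser := beta std 0%N j.

Lemma v0E : v 0%N = xx f - xs f.
Proof.
rewrite /v (@ent_beta0 _ _ B) => [|k Bk]; last by rewrite std0 f_out.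
rewrite !std0 ent_std /= [hK 1 (- _)]raddfN /= opprK [hK 1 (\sum_(k < B | _) _)]raddf_sum /=.
rewrite /xx /xs opprK -addrA; congr (_ + _).
  by congr (- _); apply: eq_bigr => k _; rewrite std0.
have F0 k : (B <= k)%N -> hK k.+1%:R (f k * u k.+1%:Z) = 0.
  by move=> /f_out ->; rewrite mul0r raddf0.
apply: (etrans _ (esym (@sum_f_from 0 (fun k => hK k.+1%:R (f k * u k.+1%:Z)) F0))).
congr (_ + _); apply: eq_bigr => k _; rewrite hKD; congr (hK _ (_ * u _)); last by lia.
by rewrite subr0 nat1r.
Qed.

Let delta : Lmat := d1 - std.

Lemma delta_upper i j : (j <= i)%N -> delta i j = 0.
Proof. by move=> ji; rewrite entB ent_std ltnNge ji subrr. Qed.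

Lemma beta_delta : beta d1 = beta std + beta delta.
Proof.
rewrite /beta /delta mulrBr mulrBl hM_sub opprB addrACA.
by rewrite subrKC addKr.
Qed.

Lemma PdM_delta : forall i j : nat, (j < i)%N -> (c * delta) i j = 0.
Proof. by move=> [//|i] j; rewrite ltnS (comp_mulS a delta); apply: delta_upper. Qed.

Lemma cdelta00 : (c * delta) 0%N 0%N = 0.
Proof.
rewrite (@compan_mul0 _ _ 0) ?big_ord0 ?oppr0 // => k _.
exact: delta_upper.
Qed.

(** As E is strictly upper, (E c)_ii = E_{i,i+1} = (c E)_{i+1,i+1}, so A maps diag(c E) to the
    diagonal of the defect of E, and A fixes v_0 E_00. Subtracting an element of the kernel U
    restores the normalisation f_0 = 0. *)
Lemma Ainv_beta1 : Ainv (Pd (beta d1)) = Pd (c * delta) + Eij 0 0 (v 0%N) - Uk (v 0%N).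
Proof.
apply/esym/Ainv_eq => [i j ij||i].
- rewrite entB entD Pd_diagonal // Uk_diagonal // ent_Eij subr0 add0r.
  by case: andP => // -[/eqP i0 /eqP j0]; move: ij; rewrite i0 j0.
- by rewrite entB entD ent_Pd eqxx cdelta00 ent_Eij ent_Uk !eqxx oppr0 hK0 add0r subrr.
have yE k : (Pd (c * delta) + Eij 0 0 (v 0%N) - Uk (v 0%N)) k k =
    (c * delta) k k + (if k == 0%N then v 0%N else 0) - hK (- k%:R) (v 0%N).
  by rewrite entB entD ent_Pd ent_Eij ent_Uk !eqxx andbb.
have bE : beta d1 i i = beta std i i + ((c * delta) i i - hK 1 (delta i i.+1)).
  rewrite beta_delta entD; congr (_ + _).
  by rewrite [LHS]entB ent_hM (mul_comp a delta) delta_upper // mul0r add0r.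
rewrite !yE ent_Pd eqxx bE (comp_mulS a delta) /= addr0 [hK 1 (_ - _)]raddfB /= hKD -nat1r.
rewrite (_ : 1 - (1 + i%:R) = - i%:R); last by ring.
rewrite opprB; case: i {bE} => [|i] /=.
  by rewrite cdelta00 !add0r oppr0 hK0 subrr addrA add0r -[beta std _ _]/(v 0%N) addrC.
by rewrite addr0 beta_stdS add0r addrA subrK.
Qed.

Lemma tr_first_row (x z : Lmat) K : (forall i j, x i.+1 j = 0) ->
  (forall k, (K <= k)%N -> z k 0%N = 0) ->
  tr (x * z) = \sum_(k < K) ct (x 0%N k * z k 0%N).
Proof.
move=> x0 z0; rewrite (@tr_finite _ _ _ q_ru 1) => [|[//|i] _].
  by rewrite big_ord1 (@entM _ _ _ _ _ _ _ K) // raddf_sum.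
have [b zb] := Lband z.
rewrite (@entM _ _ _ _ _ _ _ (i.+1 + b).+1); last by move=> k kb; apply: zb.
by rewrite big1 ?raddf0 // => k _; rewrite x0 mul0r.
Qed.

Variable dl : int -> C.

(** The contribution of diag(c E) in A^-1 cancels the part of tr(c d1 beta d2) coming from E. What
    remains of that trace pairs the first row [v] with the first column of h(d2 c). *)
Lemma companion_bracket :
  tr (rho q_ru dl (Pd (beta d1)) * beta d2) - tr (c * d1 * beta d2) =
  \sum_(j < B) ct (v j.+1 * g j) + ct (v 0%N * xs g)
  + 2^-1 * ct (v 0%N * (xx g - xs g))
  + ct (mult (fun m => ky lnq lam m + dl m) (v 0%N) * (xx g - xs g)).
Proof.
(* This 1/lam removes the factor lam from Bbar + lam/2 and leaves the symbol [ky] + [dl] + 1/2. *)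
have e1 : PU q_ru (Pd (beta d1)) = lam^-1 *: v 0%N.
  rewrite PU_Pd //; apply: PU_eq => // G.
  by rewrite tr_beta_Uk // -scalerAl ctZ mulrA divff // mul1r v0E.
have e2 : tr (c * d1 * beta d2) = tr (Pd (c * delta) * beta d2) + tr (c * std * beta d2).
  rewrite tr_PdM //; last exact: PdM_delta.
  by rewrite -trD -mulrDl -mulrDr /delta subrK.
have e3 : - tr (c * std * beta d2) = tr (beta std * hM 1 (d2 * c)).
  rewrite /beta mulrBr trB opprB mulrBl trB; congr (_ - _).
  by rewrite -hM_mul tr_hM mulrA trC !mulrA.
(* The defect of [d2] has no entries here, so h(d2 c) agrees with c d2, which is d2 moved down by
   one row. *)
have zE k : hM 1 (d2 * c) k.+1 0%N = g k.
  have := @beta2_upper k.+1 0%N isT; rewrite entB (comp_mulS a d2).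
  by move=> /subr0_eq.
have z0 : hM 1 (d2 * c) 0%N 0%N = xx g - beta d2 0%N 0%N.
  have := @compan_mul0 d2 0%N B d2B; rewrite -[- _]/(xx g) => <-.
  by rewrite [beta d2 _ _]entB subKr.
have e4 : tr (beta std * hM 1 (d2 * c)) =
    ct (v 0%N * (xx g - beta d2 0%N 0%N)) + \sum_(j < B) ct (v j.+1 * g j).
  rewrite (@tr_first_row _ _ B.+1) => [|i j|[//|k] Bk]; last by rewrite zE /g d2B.
    rewrite big_ord_recl z0; congr (_ + _); apply: eq_bigr => j _.
    by rewrite -zE.
  exact: beta_stdS.
have e5 : tr (Eij 0 0 (v 0%N) * beta d2) = ct (v 0%N * beta d2 0%N 0%N).
  by rewrite trC tr_mul_Eij // mulrC.
rewrite e2 opprD e3 e4 /rho mulrDl trD Ainv_beta1 mulrBl mulrDl trB trD e5 e1.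
rewrite !tr_beta_UkC // -/g.
have -> : mult (fun m => lam * (ky lnq lam m + dl m) + lam / 2) (lam^-1 *: v 0%N) =
    mult (fun m => ky lnq lam m + dl m) (v 0%N) + 2^-1 *: v 0%N.
  by apply: cfP => m; rewrite cfD cfZ !cf_mult cfZ; field.
have -> (p r s : lser) : ct ((p + 2^-1 *: r) * s) = ct (p * s) + 2^-1 * ct (r * s).
  by rewrite [(_ + _) * s]mulrDl ctD -scalerAl ctZ.
have ctMB (p r s : lser) : ct (p * (r - s)) = ct (p * r) - ct (p * s).
  by rewrite [p * _]mulrBr ctB.
by rewrite !ctMB; ring.
Qed.

Hypothesis u_neg : forall k, k < 0 -> u k = 0.

(** Vanishing of the defect below the diagonal reads d_{i+1,j+1} = h^-1(d_ij) + d_{i+1,0} u_{j+1};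
    iterating along the diagonal leaves only the first column. *)
Lemma ent_lower i j : (j <= i)%N ->
  d1 i j = \sum_(k < B | (k <= i)%N) hK (k%:R - i%:R) (f k * u (j%:Z + k%:Z - i%:Z)).
Proof.
elim: j i => [|j IH] i.
  move=> _; have F0 k : (k != i)%N -> (k <= i)%N -> hK (k%:R - i%:R) (f k * u (0%:Z + k%:Z - i%:Z)) = 0.
    by move=> ki lk; rewrite u_neg ?mulr0 ?raddf0 //; lia.
  have [iB|Bi] := ltnP i B; last first.
    rewrite [LHS]f_out // big1 // => k /F0 -> //.
    by have := ltn_ord k; lia.
  rewrite (bigD1 (Ordinal iB)) //= big1 ?addr0 => [|k /andP[ki]]; last first.
    by rewrite -val_eqE /=; move=> /F0; apply.
  by rewrite add0r subrr hK0 subrr u0 mulr1.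
case: i => // i; rewrite ltnS => ji.
have := @beta1_upper i.+1 j ji; rewrite ent_betaS IH // => /subr0_eq e.
have -> : d1 i.+1 j.+1 = hK (- 1) (hK 1 (d1 i.+1 j.+1)) by rewrite hKD addNr hK0.
rewrite -e raddfD /= hKD addNr hK0 raddf_sum /=.
have [iB|Bi] := ltnP i.+1 B; last first.
  rewrite -/(f i.+1) (f_out Bi) mul0r addr0.
  apply: eq_big => [k|k ki]; first by have := ltn_ord k; lia.
  rewrite hKD; congr (hK _ (_ * u _)); last by lia.
  by rewrite -(natr1 i); ring.
rewrite [RHS](bigD1 (Ordinal iB)) //= addrC subrr hK0; congr (_ + _); last first.
  by rewrite -/(f i.+1); congr (f _ * u _); lia.
apply: eq_big => [k|k ki]; first by rewrite -val_eqE /=; lia.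
rewrite hKD; congr (hK _ (_ * u _)); last by lia.
by rewrite -(natr1 i); ring.
Qed.

(** The sums over k <= i and over k > i are complementary parts of one series, taken with opposite
    signs on the two sides of the diagonal; the two indicators record this. *)
Lemma ent_stdE i j : std i j = \sum_(k < B)
  ((k <= i)%N%:R - (i < j)%N%:R) *: hK (k%:R - i%:R) (f k * u (j%:Z + k%:Z - i%:Z)).
Proof.
rewrite ent_std; case: ltnP => ij.
  rewrite -sumrN big_mkcond; apply: eq_bigr => k _ /=.
  by rewrite ltnNge; case: leqP => _ /=; rewrite ?subrr ?scale0r // sub0r scaleN1r.
rewrite ent_lower // big_mkcond; apply: eq_bigr => k _ /=.
by rewrite subr0; case: leqP => _; rewrite ?scale1r ?scale0r.
Qed.

(** Each summand carries one outer coefficient u_p, and n = i + 1 - p is the power of h: the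
    indicator of p <= i becomes n > 0, and that of p > j + 1 becomes i - j - n > 0. *)
Lemma ct_v j : ct (v j.+1 * g j) = \sum_(i < B) wsum i j (fun n =>
  ((0 < n)%R%:R - (0 < i%:Z - j%:Z - n)%R%:R) * term f g i j n).
Proof.
pose K := (B + j).+2.
pose s i (p : nat) : lser := u p%:Z * hK (i.+1%:R - p%:R) (f i * u (j.+1%:Z + i.+1%:Z - p%:Z)).
have s0 i (p : nat) : ((i + j).+2 < p)%N -> s i p = 0.
  by move=> lp; rewrite /s [u (_ - _)]u_neg ?mulr0 ?raddf0 ?mulr0 //; lia.
pose eps i (p : nat) : C := (p <= i)%N%:R - (j.+1 < p)%N%:R.
have vE : v j.+1 = \sum_(i < B) \sum_(p < (i + j).+3) eps i p *: s i p.
  rewrite /v (@ent_beta0 _ _ K) => [|k Kk]; last first.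
    rewrite ent_stdE big1 // => i _.
    by rewrite u_neg ?mulr0 ?raddf0 ?scaler0 //; have := ltn_ord i; lia.
  rewrite std0 ent_stdE.
  have -> : - \sum_(k < K) u k.+1%:Z * std k j.+1 =
      \sum_(i < B) \sum_(k < K) eps i k.+1 *: s i k.+1.
    rewrite exchange_big -sumrN; apply: eq_bigr => k _ /=.
    rewrite ent_stdE mulr_sumr -sumrN; apply: eq_bigr => i _.
    rewrite -scalerAr -scaleNr; congr (_ *: (_ * hK _ (_ * u _))).
    - rewrite /eps [(k.+1 <= i)%N]ltnNge [(j.+1 < k.+1)%N]ltnNge !ltnS.
      by case: (i <= k)%N; case: (k <= j)%N; rewrite /= ?mulr0n ?mulr1n; ring.
    - by rewrite -!natr1; ring.
    - by lia.
  rewrite -addrA.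
  (* These two terms of the defect supply p = 0, as u_0 = 1: the first gives i = 0, the second all i
     > 0. *)
  have -> : hK 1 (f 0%N * u j.+2%:Z) - hK 1 (\sum_(k < B) ((k <= 0)%N%:R - (0 < j.+2)%N%:R) *:
       hK (k%:R - 0%:R) (f k * u (j.+2%:Z + k%:Z - 0))) = \sum_(i < B) s i 0%N.
    rewrite raddf_sum /= -sumrN.
    have [B0|B0] := posnP B.
      rewrite f_out ?B0 // mul0r raddf0 add0r !big1 // => k.
        by case: k.
      by case: k.
    rewrite (bigD1 (Ordinal B0)) //= [RHS](bigD1 (Ordinal B0)) //= subrr scale0r raddf0 oppr0 add0r.
    rewrite /s u0 mul1r !subr0; congr (_ + _).
      by congr (hK _ (_ * u _)); lia.
    apply: eq_bigr => k k0; rewrite leqn0 -val_eqE /= in k0 *.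
    rewrite (negbTE k0) sub0r scaleN1r raddfN /= opprK hKD subr0 mul1r.
    rewrite nat1r; congr (hK _ (_ * u _)); first by rewrite subr0.
    by lia.
  rewrite -big_split; apply: eq_bigr => i _ /=.
  rewrite [RHS]big_ord_recl /= [LHS]addrC; congr (_ + _).
    by rewrite /eps /= subr0 scale1r.
  rewrite [RHS](@big_ord_widen _ _ _ (i + j).+2 K (fun k => eps i k.+1 *: s i k.+1)); last by have := ltn_ord i; lia.
  rewrite [RHS]big_mkcond; apply: eq_bigr => k _ /=.
  by case: ifP => // lk; rewrite s0 ?scaler0 //; lia.
rewrite vE mulr_suml raddf_sum; apply: eq_bigr => i _ /=.
rewrite mulr_suml raddf_sum /wsum (reindex_inj rev_ord_inj); apply: eq_bigr => p _ /=.
have lp := ltn_ord p.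
rewrite -scalerAl ctZ; congr (_ * _).
  by rewrite /eps; congr (_%:R - _%:R); congr nat_of_bool; apply/idP/idP; lia.
rewrite /term /s; congr ct; congr (_ * _).
have e : ((i + j).+3 - p.+1)%N%:Z = i.+1%:Z - (p%:Z - j.+1%:Z) by lia.
congr (u _ * hK _ (_ * u _)) => //; last by lia.
have -> : ((i + j).+3 - p.+1)%N%:R = (i.+1%:Z - (p%:Z - j.+1%:Z))%:~R :> C by rewrite -e.
by rewrite rmorphB /=; ring.
Qed.

Lemma sum_ct_v : \sum_(j < B) ct (v j.+1 * g j) =
  2^-1 * mode_sum f g - 2^-1 * ct (xx f * xx g) + 2^-1 * ct (xs f * xs g).
Proof.
rewrite -sum_term0 -sum_term_diff /mode_sum !mulr_sumr -sumrB -big_split /=.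
under eq_bigr do rewrite ct_v.
rewrite exchange_big; apply: eq_bigr => i _ /=.
rewrite !mulr_sumr -sumrB -big_split; apply: eq_bigr => j _ /=.
rewrite -[term _ _ i j 0](@wsum_delta i j 0); last by lia.
rewrite -[term _ _ i j (_ - _)](@wsum_delta i j (i%:Z - j%:Z)); last by lia.
rewrite /wsum !mulr_sumr -sumrB -big_split; apply: eq_bigr => k _ /=.
move: (k%:Z - _) => n; rewrite !sgCE (subr_eq0 (i%:Z - j%:Z) n) [n == i%:Z - _]eq_sym; ring.
Qed.

(** The symmetric products of [xx] and [xs] from the diagonal modes cancel against those from v_0,
    leaving an antisymmetric remainder. *)
Lemma companion_modes :
  tr (rho q_ru dl (Pd (beta d1)) * beta d2) - tr (c * d1 * beta d2) =
  2^-1 * mode_sum f g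
  + ct (mult (fun m => ky lnq lam m + dl m) (xx f - xs f) * (xx g - xs g))
  + 2^-1 * ct (xx f * xs g) - 2^-1 * ct (xs f * xx g).
Proof.
rewrite companion_bracket sum_ct_v v0E.
have ctBM (p r s : lser) : ct ((p - r) * s) = ct (p * s) - ct (r * s).
  by rewrite [_ * s]mulrBl ctB.
have ctMB (p r s : lser) : ct (p * (r - s)) = ct (p * r) - ct (p * s).
  by rewrite [p * _]mulrBr ctB.
by rewrite !ctMB !ctBM; field.
Qed.

End CompanionBracket.

(** * Pseudodifference operators *)

Section PsdSeries.
Context (R : realType) (lnq lam : R[i]).
Local Notation C := R[i].
Local Notation lser := (lser R).
Local Notation hK := (hK lnq).
Local Notation sgC := (sgC R).

Lemma hKN w (a : lser) : hK w (- a) = - hK w a.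
Proof. exact: raddfN. Qed.

Definition lv (x : int -> lser) : psd R := fun n => lval (x n).

Lemma pmulE w (x y : int -> lser) n (r : seq int) : uniq r ->
  (forall k, k \notin r -> x k * hK (w + k%:~R) (y (n - k)) = 0) ->
  pmul lnq w (lv x) (lv y) n = lval (\sum_(k <- r) x k * hK (w + k%:~R) (y (n - k))).
Proof.
move=> ur r0; apply/funext => m; rewrite -[RHS]/(cf m _) raddf_sum /=.
rewrite -(@fsum_seq _ _ r (fun k => cf m (x k * hK (w + k%:~R) (y (n - k))))) //.
  by apply: eq_fsbigr => k _; rewrite /cf lvalM lval_hK.
by move=> k /r0 ->; rewrite raddf0.
Qed.

Lemma pinnerE (x y : int -> lser) (r : seq int) : uniq r ->
  (forall k, k \notin r -> x k * hK k%:~R (y (- k)) = 0) ->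
  pinner lnq (lv x) (lv y) = \sum_(k <- r) ct (x k * hK k%:~R (y (- k))).
Proof.
move=> ur r0; rewrite /pinner /pTr (@pmulE _ _ _ _ r) //.
  by rewrite -[LHS]/(ct _) raddf_sum; apply: eq_bigr => k _ /=; rewrite add0r sub0r.
by move=> k /r0; rewrite add0r sub0r.
Qed.

Lemma Rop_lv x : Rop (lv x) = lv (fun n => (2^-1 * sgC n) *: x n).
Proof.
apply/funext => n; apply/funext => m; rewrite /Rop /sgC /lv -[RHS]/(cf m _) cfZ.
case: (ltgtP n 0) => n0 /=.
- by rewrite sub0r mulrN1 mulNr.
- by rewrite subr0 mulr1.
- by rewrite subrr mulr0 mul0r.
Qed.

Lemma pP0'_lv x : pP0' (lv x) = lval (dropc (x 0)).
Proof. by rewrite lval_dropc. Qed.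

Lemma J0_lv (F : lser) : J0_of_ser (lval F) = lv (fun n => if n == 0 then F else 0).
Proof. by apply/funext => n; rewrite /J0_of_ser /lv; case: eqP. Qed.

Variables (u : int -> lser) (B : nat).
Hypothesis u_neg : forall k, k < 0 -> u k = 0.

Definition psdL : psd R := lv (fun n => u (- n)).

(* D^-lambda J_+ in terms of the first column of the matrix gradient. *)
Definition dser (f : nat -> lser) (n : int) : lser :=
  if n is Posz k.+1 then - hK (- lam + k.+1%:R) (f k) else 0.

Lemma dserS f k : dser f k.+1%:Z = - hK (- lam + k.+1%:R) (f k).
Proof. by []. Qed.

Definition nab (f : nat -> lser) (n : int) : lser :=
  - \sum_(i < B) u (i.+1%:Z - n) * hK n%:~R (f i).

Definition nab' (f : nat -> lser) (n : int) : lser :=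
  - \sum_(i < B) hK (- lam + i.+1%:R) (f i * u (i.+1%:Z - n)).

Variables f g : nat -> lser.
Hypothesis fB : forall k, (B <= k)%N -> f k = 0.

Lemma sum_iota (W : zmodType) (s : nat -> int) (F : int -> W) :
  \sum_(k <- [seq s i | i <- iota 0 B]) F k = \sum_(i < B) F (s i).
Proof. by rewrite big_map -{1}[B]subn0 big_mkord. Qed.

Lemma nablaE : pmul lnq lam psdL (lv (dser f)) = lv (nab f).
Proof.
apply/funext => n.
rewrite (@pmulE _ _ _ _ [seq n - i.+1%:Z | i <- iota 0 B]).
- rewrite sum_iota /lv /nab -sumrN; congr lval; apply: eq_bigr => i _.
  have -> : n - (n - i.+1%:Z) = i.+1%:Z by ring.
  rewrite dserS hKN.
  rewrite [_ * - _]mulrN [hK _ (hK _ _)]hKD [- (n - _)]opprB.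
  have -> // : lam + (n - i.+1%:Z)%:~R + (- lam + i.+1%:R) = n%:~R.
  by rewrite rmorphB /=; ring.
- by rewrite map_inj_uniq ?iota_uniq // => i j; lia.
move=> k kr; suff -> : dser f (n - k) = 0 by rewrite raddf0 mulr0.
case e : (n - k) => [[|j]|j] //=.
rewrite fB ?raddf0 ?oppr0 // leqNgt; apply/negP => jB.
by move/mapP: kr; apply; exists j; [rewrite mem_iota | lia].
Qed.

Lemma nabla'E : pmul lnq (- lam) (lv (dser f)) psdL = lv (nab' f).
Proof.
apply/funext => n.
rewrite (@pmulE _ _ _ _ [seq i.+1%:Z | i <- iota 0 B]).
- rewrite sum_iota /lv /nab' -sumrN; congr lval; apply: eq_bigr => i _.
  by rewrite [dser f _]/= mulNr opprB rmorphM.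
- by rewrite map_inj_uniq ?iota_uniq // => i j; lia.
move=> k kr; suff -> : dser f k = 0 by rewrite mul0r.
case: k kr => [[|j]|j] //= kr.
rewrite fB ?raddf0 ?oppr0 // leqNgt; apply/negP => jB.
by move/mapP: kr; apply; exists j; rewrite ?mem_iota.
Qed.

Lemma nab0 : nab f 0 = xx u B f.
Proof. by rewrite /nab /xx; congr (- _); apply: eq_bigr => i _; rewrite subr0 hK0. Qed.

Lemma hK_nab'0 : hK lam (nab' f 0) = xs lnq u B f.
Proof.
rewrite raddfN raddf_sum /=; congr (- _); apply: eq_bigr => i _.
by rewrite subr0 hKD addrA subrr add0r.
Qed.

Lemma nab_nab (n : int) : ct (nab f n * hK n%:~R (nab g (- n))) =
  \sum_(i < B) \sum_(j < B) term lnq u f g i j n.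
Proof.
rewrite /nab hKN mulrNN mulr_suml raddf_sum; apply: eq_bigr => i _ /=.
rewrite [hK _ (\sum_(j < B) _)]raddf_sum mulr_sumr raddf_sum; apply: eq_bigr => j _ /=.
rewrite rmorphM /= hKD -rmorphD /= subrr hK0 opprK /term rmorphM /=.
rewrite [n + _]addrC; congr ct; ring.
Qed.

(** Dilating under the constant term and commuting the factors identifies these with the terms of L
    d phi, reindexed by n -> i - j - n. *)
Lemma nab'_nab' (n : int) : ct (nab' f n * hK n%:~R (nab' g (- n))) =
  \sum_(i < B) \sum_(j < B) term lnq u f g i j (i%:Z - j%:Z - n).
Proof.
rewrite /nab' hKN mulrNN mulr_suml raddf_sum; apply: eq_bigr => i _ /=.
rewrite [hK _ (\sum_(j < B) _)]raddf_sum mulr_sumr raddf_sum; apply: eq_bigr => j _ /=.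
rewrite hKD [hK _ _ * hK _ _]mulrC [LHS]ct_hKM hKD opprK /term [u _ * hK _ _ * _]mulrAC.
rewrite [g j * _]mulrC; congr (ct (u _ * _ * hK _ (_ * u _))).
- by lia.
- by rewrite !rmorphB /= -!natr1; ring.
- by lia.
Qed.

Lemma term_out (i j : nat) n : (n < - j.+1%:Z) || (i.+1%:Z < n) -> term lnq u f g i j n = 0.
Proof.
rewrite /term => /orP[] ln.
  by rewrite [u (n + _)]u_neg ?mulr0 ?raddf0 ?mulr0 ?mul0r ?raddf0 //; lia.
by rewrite [u (_ - n)]u_neg ?mul0r ?raddf0 //; lia.
Qed.

Definition win := [seq k%:Z - B%:Z | k <- iota 0 B.*2.+1].

Lemma mem_win (k : int) : (k \in win) = (- B%:Z <= k <= B%:Z).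
Proof.
apply/mapP/idP => [[j]|kB].
  by rewrite mem_iota => jB ->; lia.
by exists `|(k + B%:Z)%R|%N; [rewrite mem_iota; lia | lia].
Qed.

Lemma win_uniq : uniq win.
Proof. by rewrite map_inj_uniq ?iota_uniq // => i j; lia. Qed.

(** Both lists contain every n at which the reindexed term can be non-zero. The map s is the
    identity for L d phi and the reflection n -> i - j - n for d phi L. *)
Lemma sum_win_term (i j : 'I_B) (F : int -> C) (s : int -> int) : involutive s ->
  (forall n, - j.+1%:Z <= n <= i.+1%:Z -> - B%:Z <= s n <= B%:Z) ->
  \sum_(n <- win) F (s n) * term lnq u f g i j (s n) = wsum i j (fun n => F n * term lnq u f g i j n).
Proof.
move=> sK sB.
rewrite /wsum -(big_mkord xpredT (fun k => F (k%:Z - j.+1%:Z) * term lnq u f g i j (k%:Z - j.+1%:Z))).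
rewrite /index_iota subn0.
have -> : \sum_(k <- iota 0 (i + j).+3) F (k%:Z - j.+1%:Z) * term lnq u f g i j (k%:Z - j.+1%:Z) =
    \sum_(n <- [seq s (k%:Z - j.+1%:Z) | k <- iota 0 (i + j).+3]) F (s n) * term lnq u f g i j (s n).
  by rewrite big_map; apply: eq_bigr => k _; rewrite sK.
pose G n := F (s n) * term lnq u f g i j (s n).
apply: (etrans (esym (@fsum_seq _ _ _ G _ _)) (@fsum_seq _ _ _ G _ _)).
- exact: win_uniq.
- move=> n; rewrite mem_win => nB; rewrite /G term_out ?mulr0 //.
  by apply: contraNT nB; rewrite negb_or -!leNgt => /sB; rewrite sK.
- by rewrite map_inj_uniq ?iota_uniq // => k l /(can_inj sK); lia.
- move=> n nr; rewrite /G term_out ?mulr0 //; apply/negPn/negP; rewrite negb_or -!leNgt => sn.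
  move/mapP: nr; apply; exists `|(s n + j.+1%:Z)%R|%N; first by rewrite mem_iota; lia.
  by rewrite -[LHS]sK; congr s; lia.
Qed.

Lemma nab_out n : B%:Z < n -> nab f n = 0.
Proof.
move=> Bn; rewrite /nab big1 ?oppr0 // => i _.
by rewrite u_neg ?mul0r //; have := ltn_ord i; lia.
Qed.

Lemma nab'_out n : B%:Z < n -> nab' f n = 0.
Proof.
move=> Bn; rewrite /nab' big1 ?oppr0 // => i _.
by rewrite u_neg ?mulr0 ?raddf0 //; have := ltn_ord i; lia.
Qed.

Lemma mem_win0 : 0 \in win. Proof. by rewrite mem_win; lia. Qed.

Lemma sum_win0 (G : int -> C) : \sum_(k <- win) (if k == 0 then G k else 0) = G 0.
Proof.
rewrite (bigD1_seq 0) ?mem_win0 ?win_uniq //= big1 ?addr0 // => k.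
by move=> /negbTE ->.
Qed.

Lemma ct_addif (c : C) (x e y : lser) (b : bool) :
  ct ((c *: x + (if b then e else 0)) * y) = c * ct (x * y) + (if b then ct (e * y) else 0).
Proof.
rewrite [(_ + _) * y]mulrDl ctD -scalerAl ctZ; congr (_ + _).
by case: b => //; rewrite mul0r raddf0.
Qed.

End PsdSeries.

(** * The bracket on q-pseudodifference operators in modes *)

Section PsdBracket.
Context (R : realType) (lnq lam : R[i]).
Local Notation C := R[i].
Local Notation lser := (lser R).
Local Notation hK := (hK lnq).
Local Notation sgC := (sgC R).
Variables (u : int -> lser) (B : nat).
Hypothesis u_neg : forall k, k < 0 -> u k = 0.
Local Notation nab := (nab lnq u B).
Local Notation nab' := (nab' lnq lam u B).
Local Notation win := (win B).
Local Notation wsum := (@wsum R).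
Variables f g : nat -> lser.

Lemma pinner_nab (c : int -> C) (e : lser) :
  pinner lnq (lv (fun n => c n *: nab f n + (if n == 0 then e else 0))) (lv (nab g)) =
  \sum_(i < B) \sum_(j < B) wsum i j (fun n => c n * term lnq u f g i j n) + ct (e * nab g 0).
Proof.
rewrite (@pinnerE _ _ _ _ win) ?win_uniq // => [|k]; last first.
  (* Only large positive powers vanish, but the pairing matches k with -k, which truncates both
     ends. *)
  rewrite mem_win; case: (ltP B%:Z k) => [Bk _|kB Nk].
    by rewrite nab_out // scaler0 ifF ?addr0 ?mul0r //; apply/eqP; lia.
  by rewrite [nab g _]nab_out ?raddf0 ?mulr0 //; lia.
under eq_bigr do rewrite ct_addif nab_nab.
rewrite big_split /= sum_win0 oppr0 hK0; congr (_ + _).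
under eq_bigr do rewrite mulr_sumr.
rewrite exchange_big; apply: eq_bigr => i _ /=.
under eq_bigr do rewrite mulr_sumr.
rewrite exchange_big; apply: eq_bigr => j _ /=.
apply: (@sum_win_term _ _ u B u_neg f g i j c id) => // n.
by have := ltn_ord i; have := ltn_ord j; lia.
Qed.

Lemma pinner_nab' (c : int -> C) (e : lser) :
  pinner lnq (lv (fun n => c n *: nab' f n + (if n == 0 then e else 0))) (lv (nab' g)) =
  \sum_(i < B) \sum_(j < B) wsum i j (fun n => c (i%:Z - j%:Z - n) * term lnq u f g i j n)
  + ct (e * nab' g 0).
Proof.
rewrite (@pinnerE _ _ _ _ win) ?win_uniq // => [|k]; last first.
  rewrite mem_win; case: (ltP B%:Z k) => [Bk _|kB Nk].
    by rewrite nab'_out // scaler0 ifF ?addr0 ?mul0r //; apply/eqP; lia.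
  by rewrite [nab' g _]nab'_out ?raddf0 ?mulr0 //; lia.
under eq_bigr do rewrite ct_addif nab'_nab'.
rewrite big_split /= sum_win0 oppr0 hK0; congr (_ + _).
under eq_bigr do rewrite mulr_sumr.
rewrite exchange_big; apply: eq_bigr => i _ /=.
under eq_bigr do rewrite mulr_sumr.
rewrite exchange_big; apply: eq_bigr => j _ /=.
pose s (n : int) := i%:Z - j%:Z - n.
have sK : involutive s by move=> n; rewrite /s; ring.
rewrite -(@sum_win_term _ _ u B u_neg f g i j (fun n => c (s n)) s) // => [|n].
  by apply: eq_bigr => n _; rewrite sK.
by rewrite /s; have := ltn_ord i; have := ltn_ord j; lia.
Qed.

Hypothesis q_lam : forall m : int, m != 0 -> qexp lnq lam ^ m != 1.
Variables (Delta : mat R -> mat R) (dl : int -> C).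
Hypothesis Delta_dl : forall F : lser,
  Delta (toM (Uk lnq lam F)) = toM (Uk lnq lam (mult dl F)).

Lemma EndU_serE (F : lser) : EndU_ser lnq Delta (lval F) = lval (mult dl F).
Proof.
rewrite /EndU_ser -(toM_Uk lnq lam) Delta_dl toM_Uk /U_of_ser eqxx -lval_hK.
by rewrite oppr0 hK0.
Qed.

Lemma lv_add (x y : int -> lser) : lv x + lv y = lv (fun n => x n + y n).
Proof. by []. Qed.

Lemma lv_sub (x y : int -> lser) : lv x - lv y = lv (fun n => x n - y n).
Proof. by []. Qed.

Lemma dropc_hK w (F : lser) : dropc (hK w F) = hK w (dropc F).
Proof. by apply: cfP => m; rewrite !(cf_mult, cf_hK); ring. Qed.

Lemma ct_xs (h : nat -> lser) : ct (xs lnq u B h) = ct (xx u B h).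
Proof.
rewrite /xs /xx !ctN; congr (- _); rewrite [LHS]raddf_sum [RHS]raddf_sum.
apply: eq_bigr => i _ /=.
by rewrite ct_hK mulrC.
Qed.

(** Apart from R, both rows of the operator matrix only see the zeroth components, namely [xx f] for
    L d phi and h^(-lambda) of [xs f] for d phi L. *)
Lemma psd_bracketE :
  let D := EndU_ser lnq Delta in
  pairing2 (pinner lnq)
    (block2
       (@Rop R \+ (@J0_of_ser R \o (cayley lnq lam \+ D) \o @pP0' R))
       (\- (@J0_of_ser R \o (resolvent lnq lam \+ D) \o hs lnq lam \o @pP0' R))
       (@J0_of_ser R \o ((hs lnq lam \o resolvent lnq lam) \+ D) \o hs lnq (- lam) \o @pP0' R)
       (@Rop R \- (@J0_of_ser R \o (cayley lnq lam \+ D) \o @pP0' R))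
       (lv (nab f), lv (nab' f)))
    (lv (nab g), lv (nab' g)) =
  2^-1 * mode_sum lnq u B f g
  + ct (mult (fun m => ky lnq lam m + dl m) (xx u B f - xs lnq u B f) *
        (xx u B g - xs lnq u B g))
  + 2^-1 * ct (xx u B f * xs lnq u B g) - 2^-1 * ct (xs lnq u B f * xx u B g).
Proof.
move=> D.
pose x := xx u B f; pose z := xs lnq u B f.
pose mu := mult (fun m => ky lnq lam m + dl m).
(* In the first row the resolvent on z exceeds the Cayley transform by 1/2; in the second, h^lambda
   times the resolvent on x falls short of it by 1/2. *)
pose e1 := mu (x - z) - 2^-1 *: dropc z.
pose e2 := mu (x - z) - 2^-1 *: dropc x.
(* Since x and z have the same constant term, x - z needs no projection P_0'. *)
have xz : cf 0 x = cf 0 z by rewrite -/(ct _) -/(ct z) /z ct_xs.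
have dropcK (F : lser) : dropc (dropc F) = dropc F.
  by apply: cfP => m; rewrite !cf_mult; case: eqP => _; rewrite ?mul0r ?mul1r.
have E1 : (@J0_of_ser R \o (cayley lnq lam \+ D) \o @pP0' R) (lv (nab f)) -
    (@J0_of_ser R \o (resolvent lnq lam \+ D) \o hs lnq lam \o @pP0' R) (lv (nab' f)) =
    lv (fun n => if n == 0 then e1 else 0).
  rewrite /= !pP0'_lv -lval_hK -dropc_hK hK_nab'0 nab0 -/x -/z /D !EndU_serE.
  rewrite cayleyE // resolventE // -![lval _ + lval _]/(lval (_ + _)) !J0_lv lv_sub.
  congr lv; apply/funext => n; case: eqP => _; last by rewrite subr0.
  apply: cfP => m; rewrite /e1 !(cfB, cfD, cfZ, cf_mult, kyE) //.
  by case: eqP => [->|_] /=; rewrite ?xz; ring.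
have E2 : (@J0_of_ser R \o ((hs lnq lam \o resolvent lnq lam) \+ D) \o hs lnq (- lam) \o @pP0' R)
      (lv (nab f)) - (@J0_of_ser R \o (cayley lnq lam \+ D) \o @pP0' R) (lv (nab' f)) =
    lv (fun n => if n == 0 then hK (- lam) e2 else 0).
  rewrite /= !pP0'_lv -lval_hK -dropc_hK nab0 -/x.
  have -> : nab' f 0 = hK (- lam) z by rewrite /z -(hK_nab'0 lnq lam) hKK.
  rewrite /D !EndU_serE cayleyE // resolventE // -lval_hK.
  rewrite -![lval _ + lval _]/(lval (_ + _)) !J0_lv lv_sub.
  congr lv; apply/funext => n; case: eqP => _; last by rewrite subr0.
  apply: cfP => m; rewrite cf_hK /e2 !(cfB, cfD, cfZ, cf_mult, cf_hK, kyE) //.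
  have := rsE q_lam m; case: eqP => [->|_] /=; first by rewrite ?xz => _; ring.
  set Q := qexp lnq lam ^ m; set r := rs _ _ _ => e.
  have {}e : Q * r = r - 1 by rewrite -[1]/(true%:R) -e; ring.
  set P := qexp lnq (- lam) ^ m.
  transitivity (P * cf m x * (Q * r) + dl m * (1 * (P * cf m x)) -
    ((r - 2^-1 * 1) * (1 * (P * cf m z)) + dl m * (1 * (P * cf m z)))); first by ring.
  by rewrite e; field.
have -> : block2
       (@Rop R \+ (@J0_of_ser R \o (cayley lnq lam \+ D) \o @pP0' R))
       (\- (@J0_of_ser R \o (resolvent lnq lam \+ D) \o hs lnq lam \o @pP0' R))
       (@J0_of_ser R \o ((hs lnq lam \o resolvent lnq lam) \+ D) \o hs lnq (- lam) \o @pP0' R)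
       (@Rop R \- (@J0_of_ser R \o (cayley lnq lam \+ D) \o @pP0' R))
       (lv (nab f), lv (nab' f)) =
    (lv (fun n => (2^-1 * sgC n) *: nab f n + (if n == 0 then e1 else 0)),
     lv (fun n => (2^-1 * sgC n) *: nab' f n + (if n == 0 then hK (- lam) e2 else 0))).
  rewrite -lv_add -E1 -lv_add -E2 -!Rop_lv; congr pair; first by rewrite addrA.
  by rewrite addrCA.
rewrite /pairing2 [(_, _).1]/= [(_, _).2]/= pinner_nab pinner_nab' nab0.
have -> : ct (hK (- lam) e2 * nab' g 0) = ct (e2 * xs lnq u B g).
  by rewrite ct_hKM opprK hK_nab'0.
have -> (p q r s : C) : p + q - (r + s) = p - r + (q - s) by ring.
rewrite -[RHS]addrA -[RHS]addrA; congr (_ + _).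
  rewrite /mode_sum mulr_sumr -sumrB; apply: eq_bigr => i _.
  rewrite mulr_sumr -sumrB; apply: eq_bigr => j _.
  rewrite /wsum mulr_sumr -sumrB; apply: eq_bigr => k _.
  by ring.
(* The products of constant terms created by P_0' are equal in the two components and cancel. *)
have ctdrop (F G : lser) : ct (dropc F * G) = ct (F * G) - ct F * ct G.
  by rewrite dropcE [_ * G]mulrBl ctB -scalerAl ctZ mul1r.
have ctM (p r y : lser) : ct ((p - 2^-1 *: r) * y) = ct (p * y) - 2^-1 * ct (r * y).
  by rewrite [(_ - _) * y]mulrBl ctB -scalerAl ctZ.
have ctMB (p r s : lser) : ct (p * (r - s)) = ct (p * r) - ct (p * s).
  by rewrite [p * _]mulrBr ctB.
rewrite ctMB /e1 /e2 !ctM !ctdrop ct_xs [ct z]ct_xs -/x -/mu; ring.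
Qed.

End PsdBracket.

(** * The Drinfeld-Sokolov projection *)

Section DrinfeldSokolov.
Context (R : realType) (lnq lam : R[i]).
Local Notation C := R[i].
Local Notation lser := (lser R).
Local Notation hK := (hK lnq).
Local Notation Lmat := (Lmat lnq lam).
Local Notation toM := (@toM R lnq lam).
Local Notation tr := (@tr R lnq lam).
Local Notation hM := (@hM R lnq lam).
Local Notation compan := (@compan R lnq lam).

Hypothesis q_ru : forall k, (0 < k)%N -> qexp lnq 1 ^+ k != 1.

Definition rowop (a : nat -> lser) : psd R := fun n =>
  if n is Negz j then - lval (a j) else if n == 0 then sone R else 0.

Lemma Ghat_rowop a : Ghat (rowop a).
Proof.
split=> [[[|n]|j]||[[|n]|j]] //=; first exact: laurent_sone.
- by exists 0.
- by rewrite -[- lval _]/(lval (- a j)); apply: lvalP.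
Qed.

Lemma companion_rowop a : companion (rowop a) = toM (compan a).
Proof.
apply/funext => i; apply/funext => j; rewrite /companion /toM ent_compan.
case: eqP => _; first by rewrite -NegzE /= opprK.
by case: eqP => _.
Qed.

Lemma GhatP L : Ghat L -> exists a, L = rowop a.
Proof.
move=> [Ll L0 Lp]; exists (fun j => - mkl (Ll (Negz j))).
apply/funext => -[[|n]|j] //; first by rewrite Lp.
by rewrite -[LHS]opprK.
Qed.

Lemma hessenberg_YqP M : Yq lnq lam M <-> exists2 x : Lmat, M = toM x & hessenberg x.
Proof.
have La : Lambda R = toM (compan (fun=> 0)).
  apply/funext => i; apply/funext => j; rewrite /Lambda /toM ent_compan.
  by case: i => [|i] //; case: eqP.
split=> [[X /(Lb_plusP lam q_ru)[x -> x0] ->]|[x -> [x1 x0]]].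
  exists (compan (fun=> 0) + x); first by rewrite toMD La.
  have [c1 c0] := @hessenberg_comp _ lnq lam (fun=> 0).
  split=> [j|i j ij]; rewrite entD x0 ?addr0 //; first exact: c0.
  by rewrite ltnW.
exists (toM (x - compan (fun=> 0))); last by rewrite La -toMD addrC subrK.
apply/(Lb_plusP lam q_ru); exists (x - compan (fun=> 0)) => // -[//|i] j.
rewrite ltnS leq_eqVlt => /orP[/eqP<-|ji]; first by rewrite entB compS eqxx x1 subrr.
by rewrite entB compS x0 // gtn_eqF // subrr.
Qed.

(** A second reduction by T' makes T' S a gauge transformation between companion matrices, and these
    are then equal; so the description in [DS_proj] has one solution. *)
Lemma DS_projE (x T S : Lmat) a : unitri T -> unitri S -> T * S = 1 -> S * T = 1 ->
  hM 1 T * x * S = compan a -> DS_proj lnq lam (toM x) = rowop a.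
Proof.
move=> Tu Su TS ST e; apply: xget_eq.
  split; first exact: Ghat_rowop.
  by apply/(gauge_equivP q_ru); exists T, S; rewrite companion_rowop e.
move=> _ [/GhatP[a' ->] /(gauge_equivP q_ru)[T' [S' [T'u S'u TS' ST']]]].
rewrite companion_rowop => /toM_inj e'; congr rowop.
apply/esym/(@comp_gauge_eq _ lnq lam q_ru (T' * S)).
  exact: unitri_mul.
have hST : hM 1 S * hM 1 T = 1 by rewrite -hM_mul ST rmorph1.
rewrite hM_mul -e e' -!mulrA [hM 1 S * _]mulrA hST mul1r.
by rewrite [S' * (T' * _)]mulrA ST' mul1r.
Qed.

Lemma DS_proj_compan a : DS_proj lnq lam (toM (compan a)) = rowop a.
Proof.
apply: (@DS_projE _ 1 1); rewrite ?mulr1 ?rmorph1 ?mul1r //; exact: unitri1.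
Qed.

Lemma Yq_compan a : Yq lnq lam (toM (compan a)).
Proof. by apply/hessenberg_YqP; exists (compan a) => //; apply: hessenberg_comp. Qed.

Lemma isL_first_row (a : nat -> lser) : isL lnq lam (fun i j => if i == 0%N then a j else 0).
Proof. by apply: (@isL_finite_rows _ _ _ 1) => -[]. Qed.

Definition first_row (a : nat -> lser) : Lmat := mkL (isL_first_row a).

Lemma ent_first_row a i j : first_row a i j = if i == 0%N then a j else 0.
Proof. by rewrite /first_row ent_mkL. Qed.

Lemma compan_addrow a b (t : C) :
  compan a + t *: first_row b = compan (fun j => a j + t *: b j).
Proof.
apply: LmatP => i j; rewrite entD entZ ent_first_row !ent_compan.
by case: eqP => _; rewrite ?scaler0 ?addr0.
Qed.

Lemma J_minusP X : J_minus X <-> exists x : int -> lser, X = lv x /\ forall n, 0 <= n -> x n = 0.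
Proof.
split=> [[Xl X0]|[x [-> x0]]].
  exists (fun n => mkl (Xl n)); split => // n n0; apply: lval_inj; exact: X0.
by split=> n; [apply: lvalP | move=> n0; rewrite /lv x0].
Qed.

Lemma tr_first_row_mul (d : Lmat) a K : (forall k, (K <= k)%N -> d k 0%N = 0) ->
  tr (d * first_row a) = ct (\sum_(k < K) a k * d k 0%N).
Proof.
move=> d0; rewrite trC // (@tr_first_row _ _ _ q_ru _ _ K) //.
by rewrite raddf_sum; apply: eq_bigr => k _; rewrite ent_first_row.
Qed.

Variables (phi : psd R -> C) (phih : mat R -> C).
Hypothesis phih_ext : forall M, Yq lnq lam M -> phih M = phi (DS_proj lnq lam M).

Lemma pTr_dser (x : int -> lser) (f : nat -> lser) B : (forall k, (B <= k)%N -> f k = 0) ->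
  pTr (pmul lnq lam (lv x) (lv (dser lnq lam f))) = - ct (\sum_(k < B) x (- k.+1%:Z) * f k).
Proof.
move=> f0; rewrite /pTr (@pmulE _ _ _ _ _ _ [seq - i.+1%:Z | i <- iota 0 B]).
- rewrite sum_iota -[LHS]/(ct _) -ctN -sumrN; congr ct; apply: eq_bigr => k _.
  rewrite sub0r opprK dserS hKN [_ * - _]mulrN [hK _ (hK _ _)]hKD.
  have -> : lam + (- k.+1%:Z)%:~R + (- lam + k.+1%:R) = 0 by rewrite rmorphN /=; ring.
  by rewrite hK0.
- by rewrite map_inj_uniq ?iota_uniq // => i j; lia.
move=> k kr; suff -> : dser lnq lam f (0 - k) = 0 by rewrite raddf0 mulr0.
case e : (0 - k) => [[|j]|j] //=.
rewrite f0 ?raddf0 ?oppr0 // leqNgt; apply/negP => jB.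
by move/mapP: kr; apply; exists j; [rewrite mem_iota | lia].
Qed.

Lemma pDpowE (F : int -> lser) : pmul lnq (- lam) (pDpow R) (lv F) = lv (fun n => hK (- lam) (F n)).
Proof.
have -> : pDpow R = lv (fun n => if n == 0 then 1 else 0).
  by apply/funext => n; rewrite /pDpow /lv; case: eqP.
apply/funext => n; rewrite (@pmulE _ _ _ _ _ _ [:: 0]) // => [|k].
  by rewrite big_seq1 eqxx mul1r subr0 addr0.
by rewrite inE => /negbTE ->; rewrite mul0r.
Qed.

Lemma pTr_test (g : lser) (y : int -> lser) k :
  pTr (pmul lnq lam (lv (fun n => if n == - k.+1%:Z then g else 0)) (lv y)) =
  ct (g * hK (lam - k.+1%:R) (y k.+1%:Z)).
Proof.
rewrite /pTr (@pmulE _ _ _ _ _ _ [:: - k.+1%:Z]) // => [|j].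
  by rewrite -[LHS]/(ct _) big_seq1 eqxx sub0r opprK rmorphN.
by rewrite inE => /negbTE ->; rewrite mul0r.
Qed.

(** Perturbing L by x D^lambda changes only the first row of the companion matrix, by -x, and stays
    inside [Yq]. The derivative therefore only involves the first column of the matrix gradient, and
    the sign is that of [dser]. *)
Lemma derive_rowop a (d : Lmat) B (x : int -> lser) : gradient phih (compan a) d ->
  (forall k, (B <= k)%N -> d k 0%N = 0) -> (forall n, 0 <= n -> x n = 0) ->
  is_derive (0 : C^o) (1 : C^o)
    (fun t : C^o => phi (rowop a + (t : C) *: lv x) : C^o)
    (pTr (pmul lnq lam (lv x) (lv (dser lnq lam (fun k => d k 0%N)))) : C^o).
Proof.
move=> gd d0 x0; pose b j := - x (- j.+1%:Z).
have -> : pTr (pmul lnq lam (lv x) (lv (dser lnq lam (fun k => d k 0%N)))) = tr (d * first_row b).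
  rewrite (pTr_dser _ d0) (tr_first_row_mul _ d0) -ctN -sumrN; congr ct.
  by apply: eq_bigr => k _; rewrite mulNr.
have -> : (fun t : C^o => phi (rowop a + (t : C) *: lv x) : C^o) =
    (fun t : C^o => phih (toM (compan a + (t : C) *: first_row b)) : C^o).
  apply/funext => t; rewrite compan_addrow phih_ext; last exact: Yq_compan.
  rewrite DS_proj_compan; congr phi; apply/funext => n.
  rewrite [LHS]/(rowop a n + t *: lval (x n)).
  case: n => [n|n]; last first.
    rewrite /rowop /b NegzE scalerN -[RHS]/(lval (- (_ - _))) opprB.
    by rewrite addrC.
  by rewrite x0 // (_ : t *: lval 0 = 0); [apply: addr0 | apply: scaler0].
exact: gd.
Qed.

(** For uniqueness, a perturbation with one arbitrary coefficient at D^(-k-1) isolates the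
    coefficient k + 1 of the gradient; the others vanish because it lies in D^-lambda J_+. *)
Lemma G_grad_rowop a (d : Lmat) B : gradient phih (compan a) d ->
  (forall k, (B <= k)%N -> d k 0%N = 0) ->
  G_grad lnq lam phi (rowop a) = lv (dser lnq lam (fun k => d k 0%N)).
Proof.
move=> gd d0; set e := dser _ _ _; apply: xget_eq.
  split; last by move=> X /J_minusP[x [-> x0]]; apply: derive_rowop gd d0 x0.
  exists (lv (fun n => hK lam (e n))).
    split=> [n|[[|n]|n] //|]; first exact: lvalP.
      by move=> _; rewrite /lv /= raddf0.
      by move=> _; rewrite /lv /= raddf0.
    exists B%:Z => -[[|n]|n] // Bn; rewrite /lv /= d0 ?raddf0 ?oppr0 ?raddf0 //; lia.
  by rewrite pDpowE; congr lv; apply/funext => n; rewrite hKK.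
move=> z [[F [Fl Fp _] zF] zder].
pose y n : lser := hK (- lam) (mkl (Fl n)).
have y0 n : n <= 0 -> y n = 0.
  move=> n0; rewrite /y (_ : mkl (Fl n) = 0) ?raddf0 //.
  by apply: lval_inj; apply: Fp.
have zy : z = lv y by rewrite zF -pDpowE.
rewrite zy; congr lv; apply/funext => -[[|k]|k].
- exact: y0.
- apply: (can_inj (hKK lnq (lam - k.+1%:R))); apply: ct_nondeg => g.
  pose x (n : int) : lser := if n == - k.+1%:Z then g else 0.
  have x0 n : 0 <= n -> x n = 0 by rewrite /x; case: eqP => // ->; lia.
  rewrite -!pTr_test -/x; have := zder (lv x); rewrite zy => h.
  apply: (is_derive_uniq (h _) (derive_rowop gd d0 x0)) => //.
  by apply/J_minusP; exists x.
- exact: y0.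
Qed.

End DrinfeldSokolov.

(** * Gauge invariance of the matrix bracket and assembly *)

Section GaugeReduction.
Context (R : realType) (lnq lam : R[i]).
Local Notation C := R[i].
Local Notation lser := (lser R).
Local Notation Lmat := (Lmat lnq lam).
Local Notation toM := (@toM R lnq lam).
Local Notation tr := (@tr R lnq lam).
Local Notation hM := (@hM R lnq lam).
Local Notation compan := (@compan R lnq lam).

Hypothesis q_ru : forall k, (0 < k)%N -> qexp lnq 1 ^+ k != 1.
Hypothesis lam_neq0 : lam != 0.
Hypothesis q_lam : forall m : int, m != 0 -> qexp lnq lam ^ m != 1.
Local Notation trC := (trC (lam := lam) q_ru).

Definition defect (c d : Lmat) : Lmat := c * d - hM 1 (d * c).

Definition upper (x : Lmat) := forall i j : nat, (j < i)%N -> x i j = 0.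

Lemma unitri_upper x : unitri x -> upper x.
Proof. by move=> xu i j ji; rewrite xu ?gtn_eqF // ltnW. Qed.

Lemma upper_mul_diag x y i : upper x -> upper y -> (x * y) i i = x i i * y i i.
Proof.
move=> x0 y0; rewrite (@entM _ _ _ _ _ _ _ i.+1) => [|k ik]; last exact: y0.
rewrite big_ord_recr big1 /= ?add0r // => k _.
by rewrite x0 ?mul0r.
Qed.

Lemma upper_mul x y : upper x -> upper y -> upper (x * y).
Proof.
move=> x0 y0 i j ji; rewrite (@entM _ _ _ _ _ _ _ j.+1) => [|k jk]; last exact: y0.
by rewrite big1 // => k _; rewrite x0 ?mul0r // (leq_trans (ltn_ord k)).
Qed.

Lemma Pd_conj x S T : unitri S -> unitri T -> upper x -> Pd (S * x * T) = Pd x.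
Proof.
move=> Su Tu x0; apply: LmatP => i j; rewrite !ent_Pd; case: eqP => // <-.
have S0 := unitri_upper Su; have T0 := unitri_upper Tu.
rewrite upper_mul_diag //; last exact: upper_mul.
by rewrite upper_mul_diag // Su // Tu // eqxx mul1r mulr1.
Qed.

Lemma defect_gauge c d T S : T * S = 1 -> S * T = 1 ->
  defect (hM 1 S * c * T) (S * d * hM 1 T) = hM 1 S * defect c d * hM 1 T.
Proof.
move=> TS ST; have hTS : hM 1 T * hM 1 S = 1 by rewrite -hM_mul TS rmorph1.
rewrite /defect mulrBr mulrBl -!mulrA; congr (_ - _).
  by rewrite [T * _]mulrA TS mul1r.
by rewrite [hM 1 T * _]mulrA hTS mul1r !hM_mul !mulrA.
Qed.

(** The defect is conjugated by the unipotent h(T). This preserves the diagonal of an upper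
    triangular matrix, which is all that [rho] and its pairing see; the second trace is invariant by
    cyclicity. *)
Lemma bracket_gauge dl c d1 d2 T S : unitri T -> unitri S -> T * S = 1 -> S * T = 1 ->
  upper (defect c d1) -> upper (defect c d2) ->
  let m := hM 1 S * c * T in
  let e1 := S * d1 * hM 1 T in let e2 := S * d2 * hM 1 T in
  tr (rho q_ru dl (Pd (defect m e1)) * defect m e2) - tr (m * e1 * defect m e2) =
  tr (rho q_ru dl (Pd (defect c d1)) * defect c d2) - tr (c * d1 * defect c d2).
Proof.
move=> Tu Su TS ST b1 b2 m e1 e2; rewrite !defect_gauge //.
have hTS : hM 1 T * hM 1 S = 1 by rewrite -hM_mul TS rmorph1.
rewrite Pd_conj //; [|exact: unitri_hM|exact: unitri_hM].
set D := rho _ _ _; have D0 : upper D.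
  by move=> i j ji; apply: rho_diagonal; rewrite gtn_eqF.
have hS0 := unitri_upper (unitri_hM 1 Su); have hT0 := unitri_upper (unitri_hM 1 Tu).
have w0 : upper (hM 1 S * defect c d2 * hM 1 T) by do 2?apply: upper_mul.
congr (_ - _).
  rewrite [LHS]trC -[LHS](tr_PdM q_ru w0 D0) Pd_conj ?(tr_PdM q_ru b2 D0); first exact: trC.
  - exact: unitri_hM.
  - exact: unitri_hM.
  - by [].
rewrite /m /e1 -!mulrA [LHS]trC -!mulrA [T * (S * _)]mulrA TS mul1r.
by rewrite hTS mulr1 [hM 1 T * _]mulrA hTS mul1r.
Qed.

Variables (Delta : mat R -> mat R) (dl : int -> C).
Hypothesis Delta_dl : forall F : lser,
  Delta (toM (Uk lnq lam F)) = toM (Uk lnq lam (mult dl F)).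
Variables (phi psi : psd R -> C) (phih psih : mat R -> C).
Hypothesis phih_smooth : forall M, Yq lnq lam M -> exists d, is_gradient lnq lam phih M d.
Hypothesis psih_smooth : forall M, Yq lnq lam M -> exists d, is_gradient lnq lam psih M d.
Hypothesis phih_inv : gauge_invariant lnq lam phih.
Hypothesis psih_inv : gauge_invariant lnq lam psih.
Hypothesis phih_ext : forall M, Yq lnq lam M -> phih M = phi (DS_proj lnq lam M).
Hypothesis psih_ext : forall M, Yq lnq lam M -> psih M = psi (DS_proj lnq lam M).

Lemma gradP f x d : gradient f x d -> grad lnq lam f (toM x) = toM d.
Proof.
move=> gd; apply: xget_eq; first by apply/(is_gradientP q_ru); exists d.
move=> z /(is_gradientP q_ru)[e -> ge]; congr toM; apply: (tr_nondeg q_ru) => y.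
exact: (is_derive_uniq (ge y) (gd y)).
Qed.

Lemma tr_nablas m d1 d2 : tr (m * d1 * (m * d2)) = tr (d1 * m * (d2 * m)).
Proof. by rewrite -!mulrA [LHS]trC -!mulrA. Qed.

Lemma reduced_bracket M : Yq lnq lam M ->
  Lgl_bracket lnq lam Delta phih psih M =
  G_bracket lnq lam Delta phi psi (DS_proj lnq lam M).
Proof.
move=> /[dup] MY /(hessenberg_YqP lam q_ru)[m Mm mh].
have [T [S [a [Tu Su TS ST ma]]]] := reduction_exists mh.
pose c := compan a.
have [_ /(is_gradientP q_ru)[d1 _ g1]] := phih_smooth (Yq_compan lam q_ru a).
have [_ /(is_gradientP q_ru)[d2 _ g2]] := psih_smooth (Yq_compan lam q_ru a).
rewrite Mm in MY *.
have [_ /(is_gradientP q_ru)[e1 _ ge1]] := phih_smooth MY.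
have [_ /(is_gradientP q_ru)[e2 _ ge2]] := psih_smooth MY.
rewrite (DS_projE q_ru Tu Su TS ST ma).
have e1E : e1 = S * d1 * hM 1 T.
  by apply: (gradient_gauge q_ru phih_inv Tu Su TS ST ge1); rewrite ma.
have e2E : e2 = S * d2 * hM 1 T.
  by apply: (gradient_gauge q_ru psih_inv Tu Su TS ST ge2); rewrite ma.
have mE : m = hM 1 S * c * T.
  have hST : hM 1 S * hM 1 T = 1 by rewrite -hM_mul ST rmorph1.
  by rewrite /c -ma !mulrA hST mul1r -mulrA ST mulr1.
have b1 : upper (defect c d1) by exact: (gradient_constraint q_ru phih_inv g1).
have b2 : upper (defect c d2) by exact: (gradient_constraint q_ru psih_inv g2).
have [B1 d1B] := Lband d1; have [B2 d2B] := Lband d2.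
pose B := (maxn B1 B2).+1.
have d1B' k : (B <= k)%N -> d1 k 0%N = 0 by move=> Bk; apply: d1B; lia.
have d2B' k : (B <= k)%N -> d2 k 0%N = 0 by move=> Bk; apply: d2B; lia.
(* Extending the coefficients by u_0 = 1 and by 0 at negative indices lets one family serve both L
   and the companion matrix. *)
pose u (n : int) : lser := if n is Posz k then (if k is j.+1 then - a j else 1) else 0.
have u_neg n : n < 0 -> u n = 0 by case: n.
have Lu : rowop a = psdL u.
  by apply/funext => -[[|n]|n]; rewrite /psdL /lv.
have cu : (fun j : nat => - u j.+1%:Z) = a by apply/funext => j; rewrite /u opprK.
rewrite /G_bracket /G_nablas (G_grad_rowop q_ru phih_ext g1 d1B').
rewrite (G_grad_rowop q_ru psih_ext g2 d2B') Lu.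
rewrite !(nablaE _ _ u d1B') !(nabla'E _ _ u d1B') !(nablaE _ _ u d2B') !(nabla'E _ _ u d2B').
rewrite (psd_bracketE B u_neg _ _ q_lam Delta_dl).
rewrite -(companion_modes q_ru lam_neq0 (u := u) _ d1B' d2B' _ _ dl u_neg) ?cu //.
rewrite /Lgl_bracket /nablas (gradP ge1) (gradP ge2) !mmul_toM.
rewrite (block_bracketE q_ru lam_neq0 q_lam Delta_dl).
have w1 : upper (defect m e1).
  rewrite mE e1E defect_gauge //; do 2?apply: upper_mul => //; apply: unitri_upper; exact: unitri_hM.
have w2 : upper (defect m e2).
  rewrite mE e2E defect_gauge //; do 2?apply: upper_mul => //; apply: unitri_upper; exact: unitri_hM.
rewrite (rr_bracket q_ru lam_neq0 dl (tr_nablas m e1 e2) w1 w2).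
rewrite -/(defect m e1) -/(defect m e2).
have := bracket_gauge dl Tu Su TS ST b1 b2.
by rewrite /= -mE -e1E -e2E.
Qed.

End GaugeReduction.

(** * Consequences of the conditions on q and lambda *)

Section GenericLambda.
Context (R : realType) (q lnq lam : R[i]).
Hypothesis q_lt1 : `|q| < 1.
Hypothesis lnq_log : principal_log q lnq.
Hypothesis lam_generic :
  forall a : rat, lam <> 2 * (pi : R)%:C%C * 'i%C / lnq * ratr a.

Lemma qexp1 : qexp lnq 1 = q.
Proof. by rewrite -qexpE /qpow mul1r; case: lnq_log. Qed.

Lemma qexp1_not_root k : (0 < k)%N -> qexp lnq 1 ^+ k != 1.
Proof.
move=> k0; rewrite qexp1; apply/eqP => /(congr1 Num.norm); rewrite normrX normr1.
by apply/eqP; rewrite lt_eqF // exprn_ilt1 // -lt0n.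
Qed.

Lemma lnq_neq0 : lnq != 0.
Proof.
apply/eqP => l0; have := qexp1; rewrite -qexpE /qpow l0 mulr0 cexp0 => q1.
by move: q_lt1; rewrite -q1 normr1 ltxx.
Qed.

Lemma generic_neq0 : lam != 0.
Proof. by apply/eqP => l0; apply: (lam_generic (a := 0)); rewrite rmorph0 mulr0. Qed.

(** If q^(lambda n) = 1, then lambda n ln q is 2 pi i k for an integer k, and lambda is 2 pi i / ln
    q times the rational k/n. *)
Lemma qexp_generic_nat n : (0 < n)%N -> qexp lnq lam ^+ n != 1.
Proof.
move=> n0; rewrite -qexpMn -qexpE /qpow; apply/eqP => /cexp_eq1[k e].
apply: (lam_generic (a := k%:~R / n%:R)).
have nn : n%:R != 0 :> R[i] by rewrite pnatr_eq0 -lt0n.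
have -> : ratr (k%:~R / n%:R) = k%:~R / n%:R :> R[i].
  by rewrite fmorph_div /= ratr_int ratr_nat.
apply: (mulIf nn); rewrite mulr_natr; apply: (mulIf lnq_neq0); rewrite e.
by field; rewrite nn lnq_neq0.
Qed.

Lemma qexp_generic (m : int) : m != 0 -> qexp lnq lam ^ m != 1.
Proof.
case: m => [[//|n] _|n _]; first exact: qexp_generic_nat.
by rewrite -[_ ^ Negz n]/(_ ^- n.+1) invr_eq1; apply: qexp_generic_nat.
Qed.

End GenericLambda.

Theorem theorem6p1 (R : realType) (q lnq lam : R[i])
  (q_gt0 : 0 < `|q|) (q_lt1 : `|q| < 1)
  (lnq_log : principal_log q lnq)
  (lam_generic :
     forall a : rat, lam <> 2 * (pi : R)%:C%C * 'i%C / lnq * ratr a)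
  (Delta : mat R -> mat R)
  (Delta_skew : skew_operator_on_U lnq lam Delta)
  (Delta_h : forall F, U lnq F -> Delta (hm lnq 1 F) = hm lnq 1 (Delta F))
  (phi psi : psd R -> R[i])
  (phi_fun : G_functional phi) (psi_fun : G_functional psi)
  (phih psih : mat R -> R[i])
  (phih_smooth : forall M, Yq lnq lam M ->
     exists d, is_gradient lnq lam phih M d)
  (psih_smooth : forall M, Yq lnq lam M ->
     exists d, is_gradient lnq lam psih M d)
  (phih_inv : gauge_invariant lnq lam phih)
  (psih_inv : gauge_invariant lnq lam psih)
  (phih_ext : forall M, Yq lnq lam M -> phih M = phi (DS_proj lnq lam M))
  (psih_ext : forall M, Yq lnq lam M -> psih M = psi (DS_proj lnq lam M)) :
  forall M, Yq lnq lam M ->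
    Lgl_bracket lnq lam Delta phih psih M =
    G_bracket lnq lam Delta phi psi (DS_proj lnq lam M).
Proof.
have q_ru := qexp1_not_root q_lt1 lnq_log.
have lam_neq0 := generic_neq0 lam_generic.
have q_lam := qexp_generic q_lt1 lnq_log lam_generic.
have [dl Delta_dl] := Delta_mult q_ru lam_neq0 Delta_skew Delta_h.
by move=> M; apply: (reduced_bracket q_ru lam_neq0 q_lam Delta_dl).
Qed.
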